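(* Let $n\ge 2$, let $\mathbb{V}:\mathbb{R}^n\to\mathbb{C}^{N\times N}$ be a bounded (measurable) matrix-valued potential, and let $\mathbb{U}\in H^1_{\mathrm{loc}}(\mathbb{R}^n;\mathbb{C}^N)$ be a bounded weak solution of $$(\mathcal{D}_n+\mathbb{V})\,\mathbb{U}=0\quad\text{in }\mathbb{R}^n$$ with $|\mathbb{U}(0)|=1$. Then there exists $\kappa>0$ such that $$M_R[\mathbb{U}]\gtrsim \mathrm{e}^{-\kappa R^2(\log R)^2}\qquad\text{for } R\gg 1,$$ that is, there exist constants $\kappa>0$, $c>0$ and $R_0>1$, independent of $R$, such that $M_R[\mathbb{U}]\ge c\,\mathrm{e}^{-\kappa R^2(\log R)^2}$ for all $R\ge R_0$.
   Context: $N=2^{n/2}$ if $n$ is even and $N=2^{(n+1)/2}$ if $n$ is odd. The massless Dirac operator is $\mathcal{D}_n=-i\sum_{j=1}^n\alpha_j\partial_j$, where $\alpha_1,\dots,\alpha_n$ are fixed constant Hermitian $N\times N$ matrices satisfying $\alpha_j\alpha_k+\alpha_k\alpha_j=2\delta_{jk}I_{N\times N}$ for all $j,k$ (so that $\mathcal{D}_n^2=-\Delta\, I_{N\times N}$). A weak solution of $(\mathcal{D}_n+\mathbb{V})\mathbb{U}=0$ is a solution in the sense of distributions: $\int_{\mathbb{R}^n}\big(\langle \mathbb{U},\mathcal{D}_n\phi\rangle_{\mathbb{C}^N}+\langle \mathbb{V}\mathbb{U},\phi\rangle_{\mathbb{C}^N}\big)\,dx=0$ for all $\phi\in C_c^\infty(\mathbb{R}^n;\mathbb{C}^N)$,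 with $\langle\cdot,\cdot\rangle_{\mathbb{C}^N}$ the standard inner product (for $\mathbb{U}\in H^1_{\mathrm{loc}}$, the equation holds almost everywhere). Such solutions have a locally Hölder continuous representative, and pointwise values of $\mathbb{U}$ refer to it. For $R>0$, $M_R[\mathbb{U}]:=\inf_{|x|=R}\big[\sup_{y\in B_1(x)}|\mathbb{U}(y)|\big]$, where $|\cdot|$ is the Euclidean norm on $\mathbb{C}^N$ and $B_1(x)$ is the open unit ball centered at $x$. *)

(* Defs.v *)
From HB Require Import structures.
From mathcomp Require Import all_boot all_order all_algebra.
From mathcomp Require Import all_classical all_reals all_analysis.
From mathcomp Require Import complex.
Set Implicit Arguments.
Unset Strict Implicit.
Unset Printing Implicit Defensive.
Import Order.TTheory GRing.Theory Num.Theory.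
Import numFieldNormedType.Exports.
Import Normc.
Local Open Scope classical_set_scope.
Local Open Scope ring_scope.

Section measurable_rV.
Context {R : realType} (n : nat).

Let coord : 'I_n -> 'rV[R]_n -> R := fun i x => x 0 i.

Let rV_set0 : g_sigma_preimage coord set0.
Proof. exact: sigma_algebra0. Qed.

Let rV_setC A : g_sigma_preimage coord A -> g_sigma_preimage coord (~` A).
Proof. exact: sigma_algebraC. Qed.

Let rV_bigcup (F : _^nat) : (forall i, g_sigma_preimage coord (F i)) ->
  g_sigma_preimage coord (\bigcup_i (F i)).
Proof. exact: sigma_algebra_bigcup. Qed.

HB.instance Definition _ := @isMeasurable.Build
  (measure_tuple_display default_measure_display)
  'rV[R]_n (g_sigma_preimage coord) rV_set0 rV_setC rV_bigcup.

End measurable_rV.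

Lemma measurable_coord {R : realType} n (i : 'I_n) :
  measurable_fun [set: 'rV[R]_n] (fun x : 'rV[R]_n => x 0 i).
Proof.
move=> _ Y mY; rewrite setTI; apply: sub_sigma_algebra => /=.
rewrite -bigcup_seq/=; exists i => /=; first by rewrite mem_index_enum.
by exists Y => //; rewrite setTI.
Qed.

Lemma measurable_fun_coordP {R : realType} d (T : measurableType d) n
    (f : T -> 'rV[R]_n) :
  measurable_fun [set: T] f <->
  forall i, measurable_fun [set: T] (fun x => f x 0 i).
Proof.
split=> [mf i|mf].
  exact: (measurableT_comp (measurable_coord i) mf).
pose coord (i : 'I_n) := fun x : 'rV[R]_n => x 0 i.
suff : g_sigma_preimage (fun i => coord i \o f) `<=` measurable.
  by rewrite g_sigma_preimage_comp => preS _ A mA; apply: preS; exists A.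
apply: smallest_sub; first exact: sigma_algebra_measurable.
case: n => [|n] in f mf coord *; first by rewrite big_ord0.
rewrite -bigcup_mkord_ord; apply: bigcup_sub => i Ii.
by move=> A [B mB <-]; exact: mf.
Qed.

Section lebesgue_measure_rV.
Context {R : realType}.
Notation mu1 := (@lebesgue_measure R).

Definition cons_rV n (p : measurableTypeR R * 'rV[R]_n) : 'rV[R]_n.+1 :=
  \row_i (if unlift ord0 i is Some j then p.2 0 j else p.1).

Lemma measurable_cons_rV n : measurable_fun [set: _] (@cons_rV n).
Proof.
apply/measurable_fun_coordP => i; have [j ->|->] := unliftP ord0 i.
  under eq_fun do rewrite mxE liftK.
  exact: (measurableT_comp (measurable_coord j) measurable_snd).
under eq_fun do rewrite mxE unlift_none.
exact: measurable_fst.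
Qed.

Section step.
Context n (m : {sigma_finite_measure set 'rV[R]_n -> \bar R}).

Definition lebesgue_step := pushforward (mu1 \x m)%E (@cons_rV n).

Let step0 : lebesgue_step set0 = 0%E.
Proof. by rewrite /lebesgue_step /pushforward preimage_set0 measure0. Qed.

Let step_ge0 A : (0 <= lebesgue_step A)%E.
Proof. by rewrite /lebesgue_step /pushforward measure_ge0. Qed.

Let step_sigma_additive : semi_sigma_additive lebesgue_step.
Proof.
have mcons := @measurable_cons_rV n.
exact: measure_semi_sigma_additive.
Qed.

HB.instance Definition _ := isMeasure.Build _ _ _ lebesgue_step
  step0 step_ge0 step_sigma_additive.

Let step_sigma_finite : sigma_finite setT lebesgue_step.
Proof.
have /sigma_finiteP[F [TF ndF Foo]] := sigma_finiteT mu1.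
have /sigma_finiteP[G [TG ndG Goo]] := sigma_finiteT m.
pose hd (y : 'rV[R]_n.+1) : measurableTypeR R := y 0 ord0.
pose tl (y : 'rV[R]_n.+1) : 'rV[R]_n := \row_j y 0 (lift ord0 j).
have mhd : measurable_fun [set: 'rV[R]_n.+1] hd by exact: measurable_coord.
have mtl : measurable_fun [set: 'rV[R]_n.+1] tl.
  apply/measurable_fun_coordP => j /=.
  under eq_fun do rewrite mxE; exact: measurable_coord.
exists (fun k => hd @^-1` F k `&` tl @^-1` G k).
  apply/esym/seteqP; split=> // y _.
  have [k _ Fk] : (\bigcup_k F k) (hd y) by rewrite -TF.
  have [l _ Gl] : (\bigcup_k G k) (tl y) by rewrite -TG.
  have /subsetPset FS := ndF _ _ (leq_maxl k l).
  have /subsetPset GS := ndG _ _ (leq_maxr k l).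
  by exists (maxn k l) => //; split; [exact: FS|exact: GS].
move=> k; have [mF Fk] := Foo k; have [mG Gk] := Goo k; split.
  by apply: measurableI; rewrite -[X in measurable X]setTI;
    [exact: mhd|exact: mtl].
rewrite /= /lebesgue_step /pushforward.
rewrite (_ : _ @^-1` _ = F k `*` G k).
  by rewrite product_measure1E// lte_mul_pinfty// ge0_fin_numE.
apply/seteqP; split=> -[t x] /=; rewrite /hd /tl mxE unlift_none;
  by rewrite (_ : \row_j _ = x)//; apply/rowP => j; rewrite !mxE liftK.
Qed.

HB.instance Definition _ := Measure_isSigmaFinite.Build _ _ _ lebesgue_step
  step_sigma_finite.

End step.

(* n-fold product of the Lebesgue measure on R; see lebesgue_rV_box. *)
Fixpoint lebesgue_rV n : {sigma_finite_measure set 'rV[R]_n -> \bar R} :=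
  match n with
  | 0 => dirac (0 : 'rV[R]_0)
  | n'.+1 => lebesgue_step (lebesgue_rV n')
  end.

End lebesgue_measure_rV.

Lemma lebesgue_rV_box {R : realType} n (A : 'I_n -> set R) :
  (forall i, measurable (A i)) ->
  lebesgue_rV n [set x | forall i, A i (x 0 i)] =
  (\prod_(i < n) lebesgue_measure (A i))%E.
Proof.
elim: n A => [|n IHn] A mA.
  by rewrite big_ord0 /= diracE mem_set//; case.
pose B := [set x : 'rV[R]_n | forall i, A (lift ord0 i) (x 0 i)].
have mB : measurable B.
  rewrite (_ : B = \big[setI/setT]_(i < n)
      ((fun x : 'rV[R]_n => x 0 i) @^-1` A (lift ord0 i))).
    apply: bigsetI_measurable => i _; rewrite -[X in measurable X]setTI.
    exact: measurable_coord.
  rewrite -bigcap_seq; apply/seteqP; split=> x Bx i //=.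
  by apply: Bx; rewrite /= mem_index_enum.
rewrite big_ord_recl -(IHn (fun i => A (lift ord0 i)))// -product_measure1E//; last exact: mA.
rewrite /= /lebesgue_step /pushforward; congr product_measure1.
apply/seteqP; split=> -[t x] /=.
  move=> Ax; split=> [|i].
    by have := Ax ord0; rewrite mxE unlift_none.
  by have := Ax (lift ord0 i); rewrite mxE liftK.
move=> [At Ax] i; rewrite mxE; case: (unliftP ord0 i) => [j ->|->//].
exact: Ax.
Qed.

Section euclidean.
Context {R : realType}.

(* The library norm on 'rV[R]_n is the sup norm. *)
Definition enorm n (x : 'rV[R]_n) : R := Num.sqrt (\sum_(i < n) x 0 i ^+ 2).

Definition eball n (x : 'rV[R]_n) (r : R) : set 'rV[R]_n :=
  [set y | enorm (y - x) < r].

(* Euclidean norm on C^m for p = 1, Frobenius norm in general. *)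
Definition cnorm m p (A : 'M[R[i]]_(m, p)) : R :=
  Num.sqrt (\sum_(i < m) \sum_(j < p) normc (A i j) ^+ 2).

Definition cdot m (u v : 'cV[R[i]]_m) : R[i] := \sum_(k < m) u k 0 * (v k 0)^*.

End euclidean.

Section function_spaces.
Context {R : realType} (n : nat).
Notation Rn := 'rV[R]_n.
Notation C := R[i].
Implicit Types (f g : Rn -> C).

Notation leb := (@lebesgue_rV R n).

(* Measurability with respect to the completed sigma-algebra: the sigma-algebra
   on 'rV[R]_n is the Borel one. *)
Definition lebesgue_measurable_fun (f : Rn -> R) :=
  exists2 g : Rn -> R, measurable_fun setT g & {ae leb, forall x, f x = g x}.

Definition lebesgue_measurable_cfun f :=
  lebesgue_measurable_fun (fun x => complex.Re (f x)) /\
  lebesgue_measurable_fun (fun x => complex.Im (f x)).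

Definition cintegral f : C :=
  Complex (Rintegral leb setT (fun x => complex.Re (f x)))
          (Rintegral leb setT (fun x => complex.Im (f x))).

Definition ess_bounded m p (A : Rn -> 'M[C]_(m, p)) :=
  exists K : R, {ae leb, forall x, cnorm (A x) <= K}.

Definition ccontinuous f :=
  continuous (fun x => complex.Re (f x)) /\
  continuous (fun x => complex.Im (f x)).

Definition partial (j : 'I_n) (h : Rn -> R) : Rn -> R :=
  fun x => 'D_(delta_mx 0 j) h x.

Definition cpartial (j : 'I_n) f : Rn -> C := fun x =>
  Complex (partial j (fun y => complex.Re (f y)) x)
          (partial j (fun y => complex.Im (f y)) x).

(* Class C^k: the partial derivatives up to order k exist everywhere and are
   continuous. *)
Fixpoint Ck (k : nat) (h : Rn -> R) : Prop :=
  continuous h /\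
  if k is k'.+1 then
    forall j : 'I_n, (forall x, derivable h x (delta_mx 0 j)) /\
                     Ck k' (partial j h)
  else True.

Definition smooth (h : Rn -> R) := forall k, Ck k h.

Definition test_fun f :=
  [/\ smooth (fun x => complex.Re (f x)), smooth (fun x => complex.Im (f x)) &
      compact (closure [set x | f x != 0])].

Definition test_vfun m (phi : Rn -> 'cV[C]_m) :=
  forall k, test_fun (fun x => phi x k 0).

Definition L2loc f := lebesgue_measurable_cfun f /\
  forall K : set Rn, compact K ->
    (\int[leb]_(x in K) ((normc (f x)) ^+ 2)%:E < +oo)%E.

Definition weak_partial (j : 'I_n) f g := forall psi, test_fun psi ->
  cintegral (fun x => f x * cpartial j psi x) =
  - cintegral (fun x => g x * psi x).

Definition H1loc f :=
  L2loc f /\ forall j, exists2 g, L2loc g & weak_partial j f g.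

Definition H1loc_v m (U : Rn -> 'cV[C]_m) := forall k, H1loc (fun x => U x k 0).

Definition continuous_representative m (U Uc : Rn -> 'cV[C]_m) :=
  (forall k, ccontinuous (fun x => Uc x k 0)) /\
  {ae leb, forall x, Uc x = U x}.

End function_spaces.

Definition spinor_dim (n : nat) : nat :=
  (if odd n then 2 ^ (n.+1 %/ 2) else 2 ^ (n %/ 2))%N.

Section dirac.
Context {R : realType} (n : nat).
Notation Rn := 'rV[R]_n.
Notation C := R[i].

Definition dirac_matrices m (alpha : 'I_n -> 'M[C]_m) :=
  (forall j, alpha j \is hermsymmx) /\
  (forall j k, alpha j *m alpha k + alpha k *m alpha j = (2 * (j == k)%:R)%:M).

Definition dirac_op m (alpha : 'I_n -> 'M[C]_m) (phi : Rn -> 'cV[C]_m) :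
    Rn -> 'cV[C]_m := fun x =>
  - 'i%C *: \sum_(j < n)
      alpha j *m \col_k cpartial j (fun y => phi y k 0) x.

Definition weak_solution m (alpha : 'I_n -> 'M[C]_m)
    (V : Rn -> 'M[C]_m) (U : Rn -> 'cV[C]_m) :=
  forall phi : Rn -> 'cV[C]_m, test_vfun phi ->
  cintegral (fun x => cdot (U x) (dirac_op alpha phi x) +
                      cdot (V x *m U x) (phi x)) = 0.

Definition MR (U : Rn -> 'cV[C]_(spinor_dim n)) (r : R) : R :=
  inf [set sup [set cnorm (U y) | y in eball x 1] |
       x in [set x : Rn | enorm x = r]].

End dirac.

(* Main.v *)
Require Import Defs.
From HB Require Import structures.
From mathcomp Require Import all_boot all_order all_algebra.
From mathcomp Require Import all_classical all_reals all_analysis.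
From mathcomp Require Import measurable_realfun complex ring lra.
Set Implicit Arguments.
Unset Strict Implicit.
Unset Printing Implicit Defensive.
Import Order.TTheory GRing.Theory Num.Theory.
Import numFieldNormedType.Exports.
Local Open Scope classical_set_scope.
Local Open Scope ring_scope.

(** The spinor is read as a real field u with twice as many components. The
    Dirac matrices become real symmetric matrices A_j with the same Clifford
    relations, and the equation becomes - sum_j A_j d_j u = H in the weak sense,
    with |H_p| <= K sum_q |u_q| everywhere ([real_form]).

    The engine is a Carleman inequality ([carleman]). Let D = sum_j A_j d_j, let
    l = log |x| - lambda in the Euclidean norm, and let
    W = exp (tau l^2 / 2 - (n/2) log |x|). If v is compactly supported and
    vanishes near the origin, then
      2 tau int W^2 |v|^2 <= int W^2 |x|^2 |D v|^2.
    The matrix X = sum_j x_j A_j satisfies X^2 = |x|^2, so the right-hand side is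
    the square norm of W X D v. With w = W v this vector is a + b, where
    a = E w + (n/2) w is antisymmetric (E being the Euler field sum_j x_j d_j) and
    b = S w - tau l w is symmetric (S collecting the derivatives
    x_j d_k - x_k d_j, which commute with E). Since |a + b|^2 >= 4 <a, b>, only
    <a, b> has to be integrated: the part with S vanishes, and the part with l
    gives tau/2 int |w|^2 because E l = 1. The whole argument consists of
    integrations by parts in Cartesian coordinates, for functions that have just
    one derivative.

    The weight is centred at the point x0 with |x0| = r and the solution is cut
    off to an annulus whose inner and outer sizes are about 1/n and 4 r. There
    |x|^2 |D v|^2 contains at most C K^2 r^2 |v|^2 plus terms supported where the
    cutoff varies, so tau = tau0 r^2 absorbs the potential; this is the source of
    the factor R^2 in the exponent. What is left ([annuli]) compares three
    regions: a small cube around the origin, where |u|^2 >= 1/2 and the weight is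
    at least its value at distance 5/4 r; the outer transition layer, where
    |u| <= B and the weight is at most its value at distance 2 r; and the inner
    transition layer, inside the unit ball around x0, where |u| <= m. The choice lambda = log (8 n r) makes
    the weight decrease with distance, so for large r the contribution of the
    origin beats the outer layer by exp (tau0 r^2 delta) with delta > 0
    independent of r. Hence m^2 exp (tau0 r^2 (log (32 n^2 r))^2) is bounded below
    by a power of 1/r, which is the claim; the factor (log R)^2 is the value of
    l^2 at distance 1/n ([real_landis]).

    The Carleman inequality needs a differentiable function, while the spinor is
    merely continuous. It is applied to mollifications of the cut-off spinor
    ([mollify]), whose errors tend to zero while the other parameters are fixed.
    The cutoffs and the mollifying kernels are tensor products of one-variable
    bumps, so that their products are admissible test functions whose smoothness
    is a one-variable matter. *)

(** * Integration on row vectors *)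

Section measurability.
Context {R : realType} (n : nat).
Notation Rn := 'rV[R]_n.

Let grid (k : nat) (x : Rn) : Rn :=
  \row_i ((Num.floor (x 0 i * k.+1%:R))%:~R / k.+1%:R).

Let grid_cvg (x : Rn) : grid k x @[k --> \oo] --> x.
Proof.
apply/cvgrPdist_le => e e0.
near=> k.
rewrite /Num.Def.normr/= mx_normrE; apply: bigmax_le => [|[i j] _]; first exact: ltW.
rewrite !mxE (ord1 i).
have k0 : 0 < k.+1%:R :> R by rewrite ltr0n.
have -> : x 0 j - (Num.floor (x 0 j * k.+1%:R))%:~R / k.+1%:R =
  (x 0 j * k.+1%:R - (Num.floor (x 0 j * k.+1%:R))%:~R) / k.+1%:R.
  by rewrite mulrBl mulfK// gt_eqF.
rewrite normrM normfV (gtr0_norm k0) ler_pdivrMr//.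
apply: (@le_trans _ _ 1).
  have h1 := floor_le (x 0 j * k.+1%:R).
  have := floorD1_gt (x 0 j * k.+1%:R); rewrite intrD1 => h2.
  by rewrite ger0_norm ?subr_ge0//; lra.
rewrite -ler_pdivrMl// mulr1.
rewrite (@le_trans _ _ k%:R) ?ler_nat//; near: k.
exact: nbhs_infty_ger.
Unshelve. all: by end_near. Qed.

(** The sigma-algebra is generated by the coordinates. A continuous function is
    the limit of its values at the nearest lower grid points of mesh 1/(k+1), and
    each of these approximations is constant on each of countably many boxes. *)
Lemma continuous_measurable_rV (f : Rn -> R) :
  continuous f -> measurable_fun [set: Rn] f.
Proof.
move=> cf; apply: (@measurable_fun_cvg _ _ _ setT (fun k => f \o grid k)).
  move=> k _ Y mY; rewrite setTI.
  pose G (z : 'rV[int]_n) : Rn := \row_i ((z 0 i)%:~R / k.+1%:R).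
  pose P (z : 'rV[int]_n) : set Rn :=
    [set x | (forall i, Num.floor (x 0 i * k.+1%:R) = z 0 i) /\ Y (f (G z))].
  rewrite (_ : _ @^-1` _ = \bigcup_z P z).
    apply: countable_bigcupT_measurable => // z.
    have [Yz|nYz] := pselect (Y (f (G z))); last first.
      by rewrite (_ : P z = set0)//; apply/seteqP; split => x // [].
    rewrite (_ : P z = \big[setI/setT]_(i < n)
      ((fun x : Rn => x 0 i) @^-1` [set t | Num.floor (t * k.+1%:R) = z 0 i])).
      apply: bigsetI_measurable => i _; rewrite -[X in measurable X]setTI.
      apply: measurable_coord => //.
      rewrite (_ : [set _ | _] = `[(z 0 i)%:~R / k.+1%:R, (z 0 i + 1)%:~R / k.+1%:R[%classic)//.
      have k0 : 0 < k.+1%:R :> R by rewrite ltr0n.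
      apply/seteqP; split => t /=; rewrite in_itv/= ler_pdivrMr// ltr_pdivlMr//.
        by move=> <-; rewrite floor_le floorD1_gt.
      by move=> h; apply/eqP; rewrite floor_eq.
    rewrite -bigcap_seq; apply/seteqP; split => x /=.
      by move=> [h _] i _; exact: h.
    by move=> h; split => // i; apply: h; rewrite /= mem_index_enum.
  apply/seteqP; split => x /=.
    move=> Yx; exists (\row_i Num.floor (x 0 i * k.+1%:R)) => //; split.
      by move=> i; rewrite mxE.
    rewrite (_ : G _ = grid k x)//; apply/rowP => i; by rewrite !mxE.
  move=> [z _ [h Yz]]; rewrite (_ : grid k x = G z)//.
  by apply/rowP => i; rewrite !mxE h.
move=> x _; apply: (@continuous_cvg _ _ _ _ _ _ f); [exact: cf|exact: grid_cvg].
Qed.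

End measurability.

Lemma measurable_shift {R : realType} n (a : 'rV[R]_n) :
  measurable_fun [set: 'rV[R]_n] (fun x => a + x).
Proof.
apply/measurable_fun_coordP => i; under eq_fun do rewrite mxE.
by apply: measurable_funD => //; exact: measurable_coord.
Qed.

Section translation.
Context {R : realType}.

Lemma lebesgue_measure_shift (a : R) (A : set (measurableTypeR R)) : measurable A ->
  lebesgue_measure ((fun x => a + x) @^-1` A) = lebesgue_measure A.
Proof.
move=> mA.
have ms : measurable_fun [set: measurableTypeR R] (fun x : measurableTypeR R => (a + x : measurableTypeR R)).
  by apply: measurable_funD => //.
rewrite -[LHS]/(pushforward lebesgue_measure (fun x : measurableTypeR R => (a + x : measurableTypeR R)) A).
apply/esym; rewrite (@lebesgue_measure_unique _ (pushforward lebesgue_measure (fun x : measurableTypeR R => (a + x : measurableTypeR R))))// => X [[b c] /= bc] <-.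
rewrite /pushforward (_ : _ @^-1` _ = `]b - a, c - a]%classic).
  rewrite !lebesgue_measure_itv/= !lte_fin ltrD2r.
  by case: ifP => // _; rewrite -!EFinB opprB addrA subrK.
by apply/seteqP; split => x /=; rewrite !in_itv/= ltrBlDl lerBrDl.
Qed.

(** Translation invariance, slice by slice along the first coordinate. *)
Lemma lebesgue_rV_shift n (a : 'rV[R]_n) (A : set 'rV[R]_n) : measurable A ->
  lebesgue_rV n ((fun x => a + x) @^-1` A) = lebesgue_rV n A.
Proof.
elim: n a A => [|n IHn] a A mA.
  rewrite (_ : _ @^-1` _ = A)//; apply/seteqP.
  by split => x /=; rewrite (_ : a + x = x)//; apply/rowP; case.
rewrite /= /lebesgue_step /pushforward /product_measure1.
set B := @cons_rV R n @^-1` A.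
have mB : measurable B.
  by rewrite -[B]setTI; exact: measurable_cons_rV.
pose g (t : measurableTypeR R) := lebesgue_rV n (xsection B t).
have mg : measurable_fun setT g by exact: measurable_fun_xsection.
pose sh (t : measurableTypeR R) : measurableTypeR R := a 0 ord0 + t.
have msh : measurable_fun setT sh by exact: measurable_funD.
pose a' : 'rV[R]_n := \row_j a 0 (lift ord0 j).
transitivity (\int[lebesgue_measure]_t g (sh t))%E.
  apply: eq_integral => t _ /=; rewrite /g -[RHS](IHn a'); last exact: measurable_xsection.
  apply: (congr1 (fun X => lebesgue_rV n X)); apply/seteqP; split => x /=;
    rewrite /xsection/= !inE /B/=; congr A; apply/rowP => i; rewrite !mxE;
    by case: (unliftP ord0 i) => [j ->|->]; rewrite ?mxE.
rewrite -[LHS]/(\int[lebesgue_measure]_(t in sh @^-1` setT) (g \o sh) t)%E.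
rewrite -(ge0_integral_pushforward msh)//.
  apply: eq_measure_integral => /= X mX _; exact: lebesgue_measure_shift.
Qed.

End translation.

Section bcs_functions.
Context {R : realType} (n : nat).
Notation Rn := 'rV[R]_n.
Notation leb := (lebesgue_rV n).

Definition Int (f : Rn -> R) := Rintegral leb setT f.

(** The bounded measurable functions of compact support. This class is integrable
    and closed under sums, products and translations, so it carries all the
    integrability side conditions below; one constant bounds both the values and
    the support. *)
Definition bcs (f : Rn -> R) := measurable_fun setT f /\
  exists2 C : R, forall x, `|f x| <= C & forall x, C < `|x| -> f x = 0.

Lemma measurable_cube (a : Rn) (c : R) : measurable [set x : Rn | `|x - a| <= c].
Proof.
rewrite -[X in measurable X]setTI.
rewrite (_ : [set _ | _] = (fun x : Rn => `|x - a|) @^-1` [set t | t <= c])//.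
apply: continuous_measurable_rV => //; last first.
  by rewrite -set_itvNyc; exact: measurable_itv.
have h1 : continuous (fun x : Rn => x) by move=> x; exact: cvg_id.
have h2 : continuous (fun _ : Rn => a) by exact: cst_continuous.
by move=> x; exact: (cvg_norm (cvgB (h1 x) (h2 x))).
Qed.

Lemma rV_norm_le (x : Rn) (c : R) : 0 <= c ->
  `|x| <= c <-> forall i, `|x 0 i| <= c.
Proof.
move=> c0; split => [h i|h].
  apply: le_trans h; rewrite [leRHS]/Num.Def.normr/= mx_normrE.
  exact: (le_bigmax _ (fun ij => `|x ij.1 ij.2|) (0, i)).
rewrite /Num.Def.normr/= mx_normrE; apply: bigmax_le => // -[i j] _.
by rewrite (ord1 i).
Qed.

Lemma coord_le_norm (x : Rn) i : `|x 0 i| <= `|x|.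
Proof.
exact: ((rV_norm_le x (normr_ge0 x)).1 (lexx _) i).
Qed.

Lemma lebesgue_rV_cube (a : Rn) (c : R) : 0 <= c ->
  leb [set x : Rn | `|x - a| <= c] = ((2 * c) ^+ n)%:E.
Proof.
move=> c0.
have -> : [set x : Rn | `|x - a| <= c] =
    [set x | forall i, `[a 0 i - c, a 0 i + c]%classic (x 0 i)].
  apply/seteqP; split => x /=.
    by move=> /rV_norm_le -/(_ c0) h i; have := h i; rewrite !mxE in_itv/= ler_distl.
  by move=> h; apply/rV_norm_le => // i; have := h i; rewrite !mxE in_itv/= ler_distl.
rewrite (lebesgue_rV_box (A := fun i => `[a 0 i - c, a 0 i + c]%classic))//.
rewrite (eq_bigr (fun=> (2 * c)%:E)); last first.
  move=> i _; rewrite lebesgue_measure_itv/= lte_fin.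
  case: ifPn => [_|]; first by rewrite -EFinB; congr EFin; ring.
  by rewrite -leNgt => h; congr EFin; lra.
by rewrite prodEFin prodr_const card_ord.
Qed.

Lemma bcs_integrable f : bcs f -> leb.-integrable setT (EFin \o f).
Proof.
move=> [mf [C fC f0]].
pose A := [set x : Rn | `|x| <= C].
have [C0|C0] := ltP C 0.
  rewrite (_ : _ \o _ = cst 0%E); first exact: integrable0.
  by apply/funext => x /=; rewrite f0// (lt_le_trans C0).
have AE : A = [set x : Rn | `|x - 0| <= C] by apply/seteqP; split => x /=; rewrite subr0.
have mA : measurable A by rewrite AE; exact: measurable_cube.
have lA : (leb A < +oo)%E by rewrite AE lebesgue_rV_cube ?ltry.
apply: (@le_integrable _ _ _ leb setT _ _ (EFin \o (fun x => C * \1_A x)))=> //.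
- exact/measurable_EFinP.
- move=> x _ /=; rewrite lee_fin indicE.
  have [xA|xA] := boolP (x \in A).
    by rewrite mulr1 (le_trans (fC x))// ler_norm.
  rewrite f0 ?normr0//; move: xA; rewrite notin_setE /A/=.
  by move/negP; rewrite -ltNge.
have i1 : leb.-integrable setT (EFin \o \1_A).
  apply/integrableP; split; first exact/measurable_EFinP/measurable_indic.
  rewrite (eq_integral (fun x => (\1_A x)%:E)) => [|x _]; last by rewrite /= ger0_norm// indicE.
  by rewrite integral_indic// setIT.
rewrite (_ : _ \o _ = (fun x => C%:E * (EFin \o \1_A) x)%E)//.
exact: integrableZl.
Qed.

Lemma bcsD f g : bcs f -> bcs g -> bcs (fun x => f x + g x).
Proof.
move=> [mf [C fC f0]] [mg [D gD g0]]; split; first exact: measurable_funD.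
exists (`|C| + `|D|) => x.
  by rewrite (le_trans (ler_normD _ _))// lerD// ?(le_trans (fC x)) ?(le_trans (gD x))// ler_norm.
move=> h; rewrite f0 ?g0 ?addr0//; apply: le_lt_trans h.
  by rewrite (le_trans (ler_norm _))// lerDr.
by rewrite (le_trans (ler_norm _))// lerDl.
Qed.

Lemma bcsMl (a f : Rn -> R) : measurable_fun setT a -> bcs f ->
  (exists D, forall x, f x != 0 -> `|a x| <= D) -> bcs (fun x => a x * f x).
Proof.
move=> ma [mf [C fC f0]] [D aD]; split; first exact: measurable_funM.
exists (`|C| * `|D| + `|C|) => x.
  have [->|/aD ax] := eqVneq (f x) 0; first by rewrite mulr0 normr0 addr_ge0// mulr_ge0.
  rewrite normrM (@le_trans _ _ (`|C| * `|D|)) ?lerDl// mulrC ler_pM//.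
    by rewrite (le_trans (fC _))// ler_norm.
  by rewrite (le_trans ax)// ler_norm.
move=> h; rewrite f0 ?mulr0//; apply: le_lt_trans h.
by rewrite (le_trans (ler_norm _))// lerDr mulr_ge0.
Qed.

Lemma bcsM f g : bcs f -> bcs g -> bcs (fun x => f x * g x).
Proof.
move=> [mf [C fC f0]] bg; apply: bcsMl => //; by exists C.
Qed.

Lemma bcsZ (c : R) f : bcs f -> bcs (fun x => c * f x).
Proof. by move=> bf; apply: bcsMl => //; exists `|c|. Qed.

Lemma bcsN f : bcs f -> bcs (fun x => - f x).
Proof. by move=> /(bcsZ (-1)); under eq_fun do rewrite mulN1r. Qed.

Lemma bcsB f g : bcs f -> bcs g -> bcs (fun x => f x - g x).
Proof. by move=> bf /bcsN; exact: bcsD. Qed.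

Lemma bcs0 : bcs (fun=> 0).
Proof. by split => //; exists 0 => // x; rewrite normr0. Qed.

Lemma bcs_sum (I : Type) (r : seq I) (P : pred I) (F : I -> Rn -> R) :
  (forall i, P i -> bcs (F i)) -> bcs (fun x => \sum_(i <- r | P i) F i x).
Proof.
move=> bF; elim: r => [|i r IH].
  by under eq_fun do rewrite big_nil; exact: bcs0.
under eq_fun do rewrite big_cons; have [Pi|//] := boolP (P i).
by apply: bcsD => //; exact: bF.
Qed.

Lemma bcs_shift (a : Rn) f : bcs f -> bcs (fun x => f (a + x)).
Proof.
move=> [mf [C fC f0]]; split; first exact: (measurableT_comp mf (measurable_shift a)).
exists (C + `|a|) => x; first by rewrite (le_trans (fC _))// lerDl.
move=> h; apply: f0; have := ler_normB (a + x) a; rewrite addrAC subrr add0r; lra.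
Qed.

Lemma IntD f g : bcs f -> bcs g -> Int (fun x => f x + g x) = Int f + Int g.
Proof. by move=> /bcs_integrable ? /bcs_integrable ?; exact: RintegralD. Qed.

Lemma IntB f g : bcs f -> bcs g -> Int (fun x => f x - g x) = Int f - Int g.
Proof. by move=> /bcs_integrable ? /bcs_integrable ?; exact: RintegralB. Qed.

Lemma IntZ (c : R) f : bcs f -> Int (fun x => c * f x) = c * Int f.
Proof. by move=> /bcs_integrable ?; exact: RintegralZl. Qed.

Lemma IntN f : bcs f -> Int (fun x => - f x) = - Int f.
Proof. by move=> /(IntZ (-1)); under eq_fun do rewrite mulN1r; rewrite mulN1r. Qed.

Lemma Int0 : Int (fun=> 0) = 0.
Proof. by rewrite /Int /Rintegral integral0. Qed.

Lemma eq_Int f g : f =1 g -> Int f = Int g.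
Proof. by move=> /funext ->. Qed.

Lemma Int_sum (I : Type) (r : seq I) (P : pred I) (F : I -> Rn -> R) :
  (forall i, P i -> bcs (F i)) ->
  Int (fun x => \sum_(i <- r | P i) F i x) = \sum_(i <- r | P i) Int (F i).
Proof.
move=> bF; elim: r => [|i r IH].
  rewrite big_nil -[RHS]Int0; apply: eq_Int => x; by rewrite big_nil.
rewrite big_cons -IH; have [Pi|nPi] := boolP (P i).
  rewrite -IntD//; [|exact: bF|exact: bcs_sum].
  by apply: eq_Int => x; rewrite big_cons Pi.
by apply: eq_Int => x; rewrite big_cons (negbTE nPi).
Qed.

Lemma le_Int f g : bcs f -> bcs g -> (forall x, f x <= g x) -> Int f <= Int g.
Proof.
by move=> /bcs_integrable ? /bcs_integrable ? h; apply: le_Rintegral => // x _.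
Qed.

Lemma Int_ge0 f : (forall x, 0 <= f x) -> 0 <= Int f.
Proof. by move=> h; apply: Rintegral_ge0. Qed.

Lemma Int_shift (a : Rn) f : bcs f -> Int (fun x => f (a + x)) = Int f.
Proof.
move=> bf; have [mf _] := bf; rewrite /Int /Rintegral; congr fine.
transitivity (\int[pushforward leb (fun x : Rn => (a + x)%R)]_x (f x)%:E)%E.
  rewrite integral_pushforward//; [exact: measurable_shift|exact/measurable_EFinP|].
  exact/bcs_integrable/bcs_shift.
apply: eq_measure_integral => [|ms X mX _]; [exact: measurable_shift|exact: lebesgue_rV_shift].
Qed.

(** Indicators of cubes serve as majorants and minorants: they turn pointwise
    bounds into bounds of integrals. *)
Lemma bcs_cube (a : Rn) (c : R) : bcs (\1_[set x | `|x - a| <= c] : Rn -> R).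
Proof.
split; first by apply: measurable_indic; exact: measurable_cube.
exists (1 + `|c| + `|a|) => x.
  rewrite (@le_trans _ _ 1)//; last by rewrite -addrA lerDl.
  by rewrite indicE; case: (_ \in _); rewrite ?normr1 ?normr0.
move=> h; rewrite indicE memNset// => /= h2.
by have := lerB_dist x a; have := ler_norm c; lra.
Qed.

Lemma Int_cube (a : Rn) (c : R) : 0 <= c ->
  Int (\1_[set x | `|x - a| <= c]) = (2 * c) ^+ n.
Proof.
move=> c0; rewrite /Int /Rintegral integral_indic//; last exact: measurable_cube.
by rewrite setIT; exact: (congr1 fine (lebesgue_rV_cube a c0)).
Qed.

End bcs_functions.

(** * Integral identities for compactly supported functions *)

Section directional.
Context {R : realType} {V : normedModType R}.
Implicit Types (f : V -> R) (x v : V).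

Lemma is_derive_line f x v (t df : R) : is_derive (t *: v + x) v f df ->
  is_derive t 1 (fun s : R => f (s *: v + x)) df.
Proof.
have E : (fun h : R => h^-1 *: (f ((h *: 1 + t) *: v + x) - f (t *: v + x))) =
  (fun h => h^-1 *: (f (h *: v + (t *: v + x)) - f (t *: v + x))).
  by apply/funext => h; rewrite [h *: 1]mulr1 scalerDl addrA.
move=> [d <-]; apply: DeriveDef; first by rewrite /derivable /= E.
by rewrite /derive /= E.
Qed.

(** A directional derivative is a derivative along a line, which brings the
    one-variable calculus to functions that have partial derivatives only. *)
Lemma is_derive_of_line f x v (df : R) :
  is_derive (0 : R) 1 (fun s : R => f (s *: v + x)) df -> is_derive x v f df.
Proof.
have E : (fun h : R => h^-1 *: (f ((h *: (1:R) + (0:R)) *: v + x) - f (0 *: v + x))) =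
  (fun h => h^-1 *: (f (h *: v + x) - f x)).
  by apply/funext => h; rewrite [h *: 1]mulr1 addr0 scale0r add0r.
move=> [d <-]; apply: DeriveDef; first by move: d; rewrite /derivable /= E.
by rewrite /derive /= E.
Qed.

Lemma is_derive_compR f (h : R -> R) x v (df dh : R) : is_derive x v f df ->
  is_derive (f x) 1 h dh -> is_derive x v (fun y => h (f y)) (dh * df).
Proof.
move=> ff hh; apply: is_derive_of_line.
have f0 : is_derive (0 : R) 1 (fun s : R => f (s *: v + x)) df.
  by apply: is_derive_line; rewrite scale0r add0r.
have h0 : is_derive (f (0 *: v + x)) 1 h dh by rewrite scale0r add0r.
have [f1 f2] := f0; have [h1 h2] := h0.
apply: DeriveDef.
  apply/derivable1_diffP; apply: (@differentiable_comp _ _ _ _ (fun s : R => f (s *: v + x)) h).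
    exact/derivable1_diffP.
  exact/derivable1_diffP.
rewrite -derive1E.
rewrite (@derive1_comp _ (fun s : R => f (s *: v + x)) h)// !derive1E.
by rewrite f2 h2.
Qed.

Lemma derive_line_bound f x v (C : R) :
  (forall y, derivable f y v) -> (forall y, `|'D_v f y| <= C) ->
  forall h, `|f (h *: v + x) - f x| <= C * `|h|.
Proof.
move=> df dC h.
pose g (s : R) := f (s *: v + x).
have dg (s : R) : is_derive s (1 : R) g ('D_v f (s *: v + x)).
  by apply: is_derive_line; exact: derivableP.
have cg : continuous g.
  by move=> s; apply/differentiable_continuous/derivable1_diffP; case: (dg s).
have E a b : a <= b -> `|g b - g a| <= C * `|b - a|.
  move=> ab.
  have [c _ ->] := MVT_segment ab (fun s _ => dg s) (continuous_subspaceT cg).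
  by rewrite normrM ler_wpM2r.
have -> : f x = g 0 by rewrite /g scale0r add0r.
rewrite -[f _]/(g h); have [h0|h0] := leP 0 h.
  by have := E _ _ h0; rewrite subr0.
by have := E _ _ (ltW h0); rewrite sub0r normrN distrC.
Qed.

Lemma derive_seq f x v (u : R^nat) : derivable f x v ->
  (forall k, u k != 0) -> u @ \oo --> (0 : R) ->
  (u k)^-1 * (f (u k *: v + x) - f x) @[k --> \oo] --> 'D_v f x.
Proof.
by move=> df u0 cu; have /cvgr_dnbhsP := df; exact.
Qed.

Lemma is_derive_near0 f x v : (\near x, f x = 0) -> is_derive x v f 0.
Proof.
move=> h; apply: (@near_eq_is_derive _ _ _ (cst 0)); first by apply: filterS h => y ->.
Qed.

End directional.

Section C1_functions.
Context {R : realType} (n : nat).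
Notation Rn := 'rV[R]_n.
Notation e_ j := (delta_mx 0 j : Rn).
Implicit Types f g : Rn -> R.

(** Bounded partial derivatives are what makes the difference quotients of f
    dominated, hence what allows limits under the integral. *)
Definition C1c f := bcs f /\ forall j,
  (forall x, derivable f x (e_ j)) /\ exists C, forall x, `|partial j f x| <= C.

Let hs (k : nat) : R := k.+1%:R^-1.
Let hs_neq0 k : hs k != 0. Proof. by rewrite /hs invr_neq0. Qed.
Let hs_cvg : hs @ \oo --> 0. Proof. exact: cvg_harmonic. Qed.
Let hsN_neq0 k : - hs k != 0. Proof. by rewrite oppr_eq0. Qed.
Let hsN_cvg : - hs k @[k --> \oo] --> (0 : R).
Proof. by rewrite -oppr0; apply: cvgN; exact: hs_cvg. Qed.
Let hs_le1 k : `|hs k| <= 1.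
Proof. by rewrite /hs ger0_norm ?invr_ge0// invf_le1// ler1n. Qed.

Lemma norm_delta (j : 'I_n) : `|e_ j| <= 1.
Proof.
by apply/rV_norm_le => // i; rewrite mxE eqxx /=; case: (_ == _); rewrite ?normr1 ?normr0.
Qed.

Lemma norm_shift (j : 'I_n) (h : R) (x : Rn) : `|h| <= 1 -> `|x| - 1 <= `|h *: e_ j + x|.
Proof.
move=> h1; have := lerB_dist x (- (h *: e_ j)); rewrite opprK normrN normrZ addrC.
have : `|h| * `|e_ j| <= 1 by rewrite mulr_ile1// norm_delta.
by rewrite [x + _]addrC; lra.
Qed.

Lemma supp_partial f (C : R) j : (forall x, C < `|x| -> f x = 0) ->
  forall x, C < `|x| -> is_derive x (e_ j) f 0.
Proof.
move=> f0 x Cx; apply: is_derive_near0.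
near=> y; apply: f0; near: y.
have : (fun y : Rn => `|y|) @ x --> `|x| by exact: norm_continuous.
by move/cvgr_gt; apply.
Unshelve. all: by end_near. Qed.

Lemma bcs_partial f j : C1c f -> bcs (partial j f).
Proof.
move=> [[mf [C fC f0]] /(_ j) [df [D dfD]]]; split.
  apply: (@measurable_fun_cvg _ _ _ setT
    (fun k x => (hs k)^-1 * (f (hs k *: e_ j + x) - f x))) => [k|x _].
    apply: measurable_funM => //; apply: measurable_funB => //.
    exact: (measurableT_comp mf (measurable_shift _)).
  exact: derive_seq.
exists (`|D| + `|C|) => x.
  by rewrite (le_trans (dfD x))// (le_trans (ler_norm _))// lerDl.
move=> h; have [] := @supp_partial f C j f0 x; last by [].
by rewrite (le_lt_trans _ h)// (le_trans (ler_norm _))// lerDr.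
Qed.

(** Dominated convergence with the indicator of a cube as dominating function. *)
Lemma Int_dct (F : nat -> Rn -> R) f (C : R) :
  (forall k, measurable_fun setT (F k)) ->
  (forall k x, `|F k x| <= C) -> (forall k x, C < `|x| -> F k x = 0) ->
  (forall x, F k x @[k --> \oo] --> f x) ->
  Int (F k) @[k --> \oo] --> Int f.
Proof.
move=> mF FC F0 Ff.
have mf : measurable_fun setT f by exact: (measurable_fun_cvg mF).
have H1 : {ae (@lebesgue_rV R n), forall x, setT x ->
    (fun k => (F k x)%:E) @ \oo --> (f x)%:E}.
  by apply: aeW => x _; apply: cvg_EFin; [exact: nearW|exact: Ff].
have H2 : (@lebesgue_rV R n).-integrable setT
    (EFin \o (fun x => C * \1_[set y : Rn | `|y - 0| <= C] x)).
  by apply/bcs_integrable/bcsZ; exact: bcs_cube.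
have H3 : {ae (@lebesgue_rV R n), forall x (k : nat), setT x ->
    (`|(F k x)%:E| <= (C * \1_[set y : Rn | `|y - 0| <= C] x)%:E)%E}.
  apply: aeW => x k _ /=; rewrite lee_fin indicE.
  have [xA|xA] := boolP (x \in [set y : Rn | `|y - 0| <= C]).
    by rewrite mulr1.
  rewrite mulr0 F0 ?normr0//; move: xA; rewrite notin_setE/= subr0.
  by move/negP; rewrite -ltNge.
have [fi _ h] := dominated_convergence measurableT
  (fun k => (measurable_EFinP _ _).2 (mF k)) ((measurable_EFinP _ _).2 mf) H1 H2 H3.
rewrite /Int /Rintegral.
apply: fine_cvg; rewrite fineK; first exact: h.
exact: integrable_fin_num fi.
Qed.

Lemma C1cD f g : C1c f -> C1c g -> C1c (fun x => f x + g x).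
Proof.
move=> [bf Kf] [bg Kg]; split; first exact: bcsD.
move=> j; have [df [C fC]] := Kf j; have [dg [D gD]] := Kg j; split.
  by move=> x; exact: derivableD.
exists (C + D) => x; rewrite /partial (deriveD (df x) (dg x)).
by rewrite (le_trans (ler_normD _ _))// lerD//; [exact: fC|exact: gD].
Qed.

Lemma C1cZ (c : R) f : C1c f -> C1c (fun x => c * f x).
Proof.
move=> [bf Kf]; split; first exact: bcsZ.
move=> j; have [df [C fC]] := Kf j; split.
  by move=> x; exact: (@derivableZ _ _ _ f c x _ (df x)).
exists (`|c| * C) => x; rewrite /partial (@deriveZ _ _ _ f c x _ (df x)).
by rewrite normrM ler_wpM2l//; exact: fC.
Qed.

Lemma C1cN f : C1c f -> C1c (fun x => - f x).
Proof. by move=> /(C1cZ (-1)); under eq_fun do rewrite mulN1r. Qed.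

Lemma C1cB f g : C1c f -> C1c g -> C1c (fun x => f x - g x).
Proof. by move=> ? /C1cN; exact: C1cD. Qed.

Lemma partialM f g j x : derivable f x (e_ j) -> derivable g x (e_ j) ->
  partial j (fun y => f y * g y) x = partial j f x * g x + f x * partial j g x.
Proof.
by move=> df dg; rewrite /partial (deriveM df dg) addrC [X in X + _]mulrC.
Qed.

Lemma C1cM f g : C1c f -> C1c g -> C1c (fun x => f x * g x).
Proof.
move=> Kf Kg; have [bf hf] := Kf; have [bg hg] := Kg; split; first exact: bcsM.
move=> j; have [df _] := hf j; have [dg _] := hg j; split.
  by move=> x; exact: derivableM.
have bh : bcs (fun x => partial j f x * g x + f x * partial j g x).
  by apply: bcsD; apply: bcsM => //; exact: bcs_partial.
have [_ [C hC _]] := bh; exists C => x; rewrite partialM//; exact: hC.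
Qed.

Lemma C1c_shift (a : Rn) f : C1c f -> C1c (fun x => f (a + x)) /\
  forall j x, partial j (fun y => f (a + y)) x = partial j f (a + x).
Proof.
move=> [bf Kf].
have E j x : is_derive x (e_ j) (fun y => f (a + y)) (partial j f (a + x)).
  have [df _] := Kf j.
  rewrite /partial; have [d <-] := derivableP (df (a + x)).
  have E : (fun h : R => h^-1 *: (f (a + (h *: e_ j + x)) - f (a + x))) =
    (fun h => h^-1 *: (f (h *: e_ j + (a + x)) - f (a + x))).
    by apply/funext => h; rewrite addrCA.
  by apply: DeriveDef; rewrite ?/derivable ?/derive/= E.
split; last by move=> j x; case: (E j x).
split; first exact: bcs_shift.
move=> j; split => [x|]; first by case: (E j x).
have [_ [C hC]] := Kf j; exists C => x.
by rewrite /partial; have [_ ->] := E j x; exact: hC.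
Qed.

(** The mean value theorem bounds the difference quotients uniformly. The integral
    identities for derivatives are obtained in this way as limits of discrete
    identities, which express translation invariance. *)
Lemma quotient_cvg f j (u : R^nat) (g : Rn -> R) : C1c f ->
  (forall k, u k != 0) -> u @ \oo --> (0 : R) -> (forall k, `|u k| <= 1) ->
  bcs g ->
  Int (fun x => (u k)^-1 * (f (u k *: e_ j + x) - f x) * g x) @[k --> \oo] -->
  Int (fun x => partial j f x * g x).
Proof.
move=> Kf u0 cu u1 bg; have [[mf _] /(_ j) [df [M fM]]] := Kf.
have [mg [D gD g0]] := bg.
apply: (@Int_dct _ _ (`|M| * `|D| + `|D|)).
- move=> k; apply: measurable_funM => //; apply: measurable_funM => //.
  apply: measurable_funB => //; exact: (measurableT_comp mf (measurable_shift _)).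
- move=> k x; rewrite normrM (@le_trans _ _ (`|M| * `|D|)) ?lerDl// ler_pM//.
    rewrite normrM normfV mulrC ler_pdivrMr ?normr_gt0//.
    by rewrite (le_trans (derive_line_bound _ df fM _))// ler_wpM2r// ler_norm.
  by rewrite (le_trans (gD x))// ler_norm.
- move=> k x h; rewrite g0 ?mulr0//; apply: le_lt_trans h.
  by rewrite (le_trans (ler_norm _))// lerDr mulr_ge0.
- move=> x; apply: cvgM; last exact: cvg_cst.
  exact: derive_seq.
Qed.

Lemma Int_partial f j : C1c f -> Int (partial j f) = 0.
Proof.
move=> Kf; have [bf _] := Kf; have [mf [C fC f0]] := bf.
pose g : Rn -> R := \1_[set x : Rn | `|x - 0| <= `|C| + 1].
have -> : Int (partial j f) = Int (fun x => partial j f x * g x).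
  apply: eq_Int => x; rewrite /g indicE.
  have [xA|] := boolP (x \in _); first by rewrite mulr1.
  rewrite notin_setE/= subr0 mulr0 => /negP; rewrite -ltNge => h.
  have [] := @supp_partial f C j f0 x; last by [].
  by rewrite (le_lt_trans _ h)// (le_trans (ler_norm _))// lerDl.
have h := @quotient_cvg f j _ _ Kf hs_neq0 hs_cvg hs_le1 (bcs_cube 0 (`|C| + 1)).
have : Int (fun x => (hs k)^-1 * (f (hs k *: e_ j + x) - f x) * g x) @[k --> \oo] --> (0 : R).
  rewrite (_ : (fun k => _) = cst 0); first exact: cvg_cst.
  apply/funext => k.
  transitivity (Int (fun x => (hs k)^-1 * (f (hs k *: e_ j + x) - f x))).
    apply: eq_Int => x; rewrite /g indicE.
    have [xA|] := boolP (x \in _); first by rewrite mulr1.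
    rewrite notin_setE/= subr0 mulr0 => /negP; rewrite -ltNge => h1.
    have := norm_shift j x (hs_le1 k); have := ler_norm C => h2 h3.
    by rewrite !f0 ?subrr ?mulr0//; lra.
  rewrite IntZ; last by apply: bcsB => //; exact: bcs_shift.
  by rewrite IntB ?Int_shift ?subrr ?mulr0//; exact: bcs_shift.
by move/(cvg_unique _ h); apply.
Qed.

Lemma Int_by_parts f g j : C1c f -> C1c g ->
  Int (fun x => f x * partial j g x) = - Int (fun x => partial j f x * g x).
Proof.
move=> Kf Kg; have [bf hf] := Kf; have [bg hg] := Kg.
have := Int_partial j (C1cM Kf Kg).
have -> : partial j (fun x => f x * g x) = (fun x => partial j f x * g x + f x * partial j g x).
  by apply/funext => x; rewrite partialM//; [case: (hf j)|case: (hg j)].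
rewrite IntD; [|by apply: bcsM => //; exact: bcs_partial..].
by move/eqP; rewrite addrC addr_eq0 => /eqP.
Qed.

(** Integrating by parts twice would require second derivatives. Instead the
    derivative along j is replaced by a difference quotient, a translation moves
    the quotient to the other factor, and the step tends to 0. *)
Lemma Int_jacobian f g j k : C1c f -> C1c g ->
  Int (fun x => partial j f x * partial k g x) =
  Int (fun x => partial k f x * partial j g x).
Proof.
move=> Kf Kg; have [bf hf] := Kf; have [bg hg] := Kg.
have h1 := @quotient_cvg f j _ _ Kf hs_neq0 hs_cvg hs_le1 (bcs_partial k Kg).
have hsN_le1 m : `|- hs m| <= 1 by rewrite normrN.
have h2 := @quotient_cvg g j _ _ Kg hsN_neq0 hsN_cvg hsN_le1 (bcs_partial k Kf).
have -> : Int (fun x => partial k f x * partial j g x) =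
  Int (fun x => partial j g x * partial k f x).
  by apply: eq_Int => x; rewrite mulrC.
suff E m : Int (fun x => (hs m)^-1 * (f (hs m *: e_ j + x) - f x) * partial k g x) =
  Int (fun x => (- hs m)^-1 * (g (- hs m *: e_ j + x) - g x) * partial k f x).
  move: h1; under eq_fun do rewrite E.
  by move/(cvg_unique _ h2) => ->.
set a := hs m *: e_ j; set b := - hs m *: e_ j.
have ba x : b + (a + x) = x by rewrite addrA -scalerDl addNr scale0r add0r.
have Kq : C1c (fun x => (- hs m)^-1 * (g (b + x) - g x)).
  by apply: C1cZ; apply: C1cB => //; case: (C1c_shift b Kg).
have Kgb : C1c (fun x => g (b + x)) by case: (C1c_shift b Kg).
have pgb i x : partial i (fun y => g (b + y)) x = partial i g (b + x).
  by have [_ ->] := C1c_shift b Kg.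
transitivity (- Int (fun x => (- hs m)^-1 * (f (a + x) * partial k g x - f x * partial k g x))).
  rewrite -IntN; last first.
    apply: bcsZ; apply: bcsB; apply: bcsM => //; try exact: bcs_partial.
    exact: bcs_shift.
  by apply: eq_Int => x; rewrite invrN; ring.
have bpk := bcs_partial k Kg.
rewrite IntZ; last by apply: bcsB; apply: bcsM => //; exact: bcs_shift.
rewrite IntB; [|by apply: bcsM => //; exact: bcs_shift|exact: bcsM].
have -> : Int (fun x => f (a + x) * partial k g x) =
    Int (fun x => f x * partial k (fun y => g (b + y)) x).
  rewrite -(@Int_shift _ _ a (fun x => f x * partial k (fun y => g (b + y)) x)); last first.
    by apply: bcsM => //; exact: bcs_partial.
  by apply: eq_Int => x; rewrite pgb ba.
rewrite (Int_by_parts _ Kf Kgb) (Int_by_parts _ Kf Kg).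
have bpf := bcs_partial k Kf; have [bgb _] := Kgb.
rewrite opprK addrC -IntB; [|exact: bcsM..].
rewrite -mulrN -IntN; last by apply: bcsB; exact: bcsM.
rewrite -IntZ; last by apply: bcsN; apply: bcsB; exact: bcsM.
by apply: eq_Int => x; ring.
Qed.

End C1_functions.

(** * Multipliers singular at the origin *)

Section coefficients.
Context {R : realType} (n : nat).
Notation Rn := 'rV[R]_n.
Notation e_ j := (delta_mx 0 j : Rn).
Implicit Types f g a : Rn -> R.

Definition vanish_near0 (c : R) f := 0 < c /\ forall x, `|x| < c -> f x = 0.

(** Multipliers such as log |x| may be singular at the origin. Bounds on every
    annulus are enough to multiply functions that vanish near the origin. *)
Definition coef a := [/\ measurable_fun setT a,
  forall j x, x != 0 -> derivable a x (e_ j) &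
  forall c C : R, 0 < c -> exists M, forall x, c <= `|x| -> `|x| <= C ->
    `|a x| <= M /\ forall j, `|partial j a x| <= M].

Lemma vanish_partial c f j : vanish_near0 c f -> vanish_near0 c (partial j f).
Proof.
move=> [c0 f0]; split => // x xc.
suff : is_derive x (e_ j) f 0 by case.
apply: is_derive_near0; near=> y; apply: f0; near: y.
have : (fun y : Rn => `|y|) @ x --> `|x| by exact: norm_continuous.
by move/cvgr_lt; apply.
Unshelve. all: by end_near. Qed.

Lemma vanish_mulr c f a : vanish_near0 c f -> vanish_near0 c (fun x => a x * f x).
Proof. by move=> [c0 f0]; split => // x /f0 ->; rewrite mulr0. Qed.

Lemma bcs_coef c a f : coef a -> bcs f -> vanish_near0 c f -> bcs (fun x => a x * f x).
Proof.
move=> [ma _ ba] bf [c0 fc]; apply: bcsMl => //; have [_ [C _ fC]] := bf.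
have [M hM] := ba c C c0; exists M => x fx.
have [] // := hM x _ _; rewrite leNgt; apply/negP => h; move/eqP: fx.
  by rewrite fc.
by rewrite fC.
Qed.

Lemma C1c_coef c a f : coef a -> C1c f -> vanish_near0 c f ->
  C1c (fun x => a x * f x) /\
  forall j x, partial j (fun y => a y * f y) x = partial j a x * f x + a x * partial j f x.
Proof.
move=> ca [bf hf] vf; have [ma da ba] := ca; have [c0 fc] := vf.
have E j x : derivable (fun y => a y * f y) x (e_ j) /\
   partial j (fun y => a y * f y) x = partial j a x * f x + a x * partial j f x.
  have [df _] := hf j.
  have [xc|xc] := ltP `|x| c.
    have [_ vp] := vanish_partial j vf.
    rewrite fc// vp// !mulr0 addr0.
    suff : is_derive x (e_ j) (fun y => a y * f y) 0 by case.
    apply: is_derive_near0; near=> y; rewrite fc ?mulr0//; near: y.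
    have : (fun y : Rn => `|y|) @ x --> `|x| by exact: norm_continuous.
    by move/cvgr_lt; apply.
  have x0 : x != 0.
    by apply: contraTneq xc => ->; rewrite normr0 -ltNge.
  split; first exact: (derivableM (da _ _ x0)).
  exact: partialM (da _ _ x0) (df _).
split; last by move=> j x; case: (E j x).
split; first exact: bcs_coef vf.
move=> j; split=> [x|]; first by case: (E j x).
have [df [D fD]] := hf j.
have [_ [B fB fC]] := bf; have [M hM] := ba c B c0.
exists (`|M| * `|B| + `|M| * `|D|) => x.
have [_ ->] := E j x.
have [xc|xc] := ltP `|x| c.
  have [_ vp] := vanish_partial j vf.
  by rewrite fc// vp// !mulr0 addr0 normr0 addr_ge0// mulr_ge0.
have [xB|xB] := leP `|x| B.
  have [h1 /(_ j) h2] := hM x xc xB.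
  rewrite (le_trans (ler_normD _ _))// !normrM lerD// ler_pM//.
  - by rewrite (le_trans h2)// ler_norm.
  - by rewrite (le_trans (fB _))// ler_norm.
  - by rewrite (le_trans h1)// ler_norm.
  - by rewrite (le_trans (fD _))// ler_norm.
have [_ h] := @supp_partial _ _ f B j fC x xB.
by rewrite fC// {2}/partial h !mulr0 addr0 normr0 addr_ge0// mulr_ge0.
Unshelve. all: by end_near. Qed.

Lemma is_derive_coord (i j : 'I_n) (x : Rn) :
  is_derive x (e_ j) (fun y : Rn => y 0 i) (i == j)%:R.
Proof.
apply: is_derive_of_line.
have -> : (fun s : R => (s *: e_ j + x) 0 i) =
  (fun s => (i == j)%:R * s + x 0 i).
  by apply/funext => s; rewrite !mxE eqxx /= mulrC.
apply: is_derive_eq; rewrite addr0.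
exact: mulr1.
Qed.

Lemma partial_coord (i j : 'I_n) (x : Rn) : partial j (fun y : Rn => y 0 i) x = (i == j)%:R.
Proof. by rewrite /partial; case: (is_derive_coord i j x). Qed.

Lemma coef_coord i : coef (fun x : Rn => x 0 i).
Proof.
split; first exact: measurable_coord.
  by move=> j x _; case: (is_derive_coord i j x).
move=> c C c0; exists (`|C| + 1) => x _ xC; split => [|j].
  by rewrite (le_trans (coord_le_norm _ _))// (le_trans xC)// (le_trans (ler_norm _))// lerDl.
by rewrite partial_coord ger0_norm// (@le_trans _ _ 1) ?lerDr//; case: (_ == _).
Qed.

(** Square of the Euclidean norm, `|x| being the sup norm. *)
Definition sqn (x : Rn) : R := \sum_i x 0 i ^+ 2.

Lemma sqn_ge (x : Rn) : `|x| ^+ 2 <= sqn x.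
Proof.
have s0 : 0 <= sqn x by apply: sumr_ge0 => i _; exact: sqr_ge0.
rewrite -[leRHS](sqr_sqrtr s0) lerXn2r ?nnegrE ?sqrtr_ge0//.
apply/rV_norm_le => [|i]; first exact: sqrtr_ge0.
rewrite -sqrtr_sqr ler_wsqrtr// /sqn (bigD1 i)//= lerDl.
by apply: sumr_ge0 => k _; exact: sqr_ge0.
Qed.

Lemma sqn_le (x : Rn) : sqn x <= n%:R * `|x| ^+ 2.
Proof.
rewrite mulr_natl -[X in _ *+ X](card_ord n) -sumr_const; apply: ler_sum => i _.
by rewrite -real_normK ?num_real// lerXn2r ?nnegrE// coord_le_norm.
Qed.

Lemma sqn_gt0 (x : Rn) : x != 0 -> 0 < sqn x.
Proof. by move=> x0; apply: lt_le_trans (sqn_ge x); rewrite exprn_gt0// normr_gt0. Qed.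

Lemma measurable_sqn : measurable_fun setT sqn.
Proof.
apply: measurable_sum => i; apply: measurable_funX; exact: measurable_coord.
Qed.

Lemma is_derive_sqn j (x : Rn) : is_derive x (e_ j) sqn (2 * x 0 j).
Proof.
apply: is_derive_of_line.
have -> : (fun s : R => sqn (s *: e_ j + x)) =
  (fun s => sqn x + (2 * x 0 j) * s + s ^+ 2).
  apply/funext => s; rewrite /sqn (bigD1 j)//= [in RHS](bigD1 j)//= !mxE !eqxx/=.
  rewrite (eq_bigr (fun i => x 0 i ^+ 2)); first by ring.
  by move=> i ij; rewrite !mxE (negbTE ij) mulr0 add0r.
apply: is_derive_eq; rewrite /GRing.scale/=; ring.
Qed.

(** Logarithm of the Euclidean norm. *)
Definition lnr (x : Rn) : R := ln (sqn x) / 2.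

Lemma is_derive_lnr j (x : Rn) : x != 0 -> is_derive x (e_ j) lnr (x 0 j / sqn x).
Proof.
move=> x0; have s0 := sqn_gt0 x0.
have h : is_derive x (e_ j) (fun y => ln (sqn y)) ((sqn x)^-1 * (2 * x 0 j)).
  by apply: is_derive_compR; [exact: is_derive_sqn|exact: is_derive1_ln].
have -> : lnr = (2^-1 : R) *: (fun y => ln (sqn y)).
  by apply/funext => y; rewrite /lnr mulrC.
apply: is_derive_eq; rewrite /GRing.scale/=.
by rewrite [in LHS](mulrA 2^-1) [2^-1 * _]mulrC -!mulrA mulKf// mulrC.
Qed.

Lemma coef_lnr : coef lnr.
Proof.
split.
- apply: measurable_funM => //; apply: measurableT_comp => //; exact: measurable_sqn.
- by move=> j x /(is_derive_lnr j) [].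
- move=> c C c0.
  exists (`|ln (c ^+ 2)| + `|ln (n%:R * C ^+ 2)| + `|C| / c ^+ 2) => x cx xC.
  have x0 : x != 0 by apply: contraTneq cx => ->; rewrite normr0 -ltNge.
  have s0 := sqn_gt0 x0.
  have s1 : c ^+ 2 <= sqn x.
    by apply: le_trans (sqn_ge x); rewrite lerXn2r ?nnegrE ?(ltW c0)//.
  have s2 : sqn x <= n%:R * C ^+ 2.
    apply: (le_trans (sqn_le x)); rewrite ler_wpM2l// lerXn2r ?nnegrE//.
    exact: le_trans xC.
  have c20 : 0 < c ^+ 2 by rewrite exprn_gt0.
  split=> [|j].
    rewrite (@le_trans _ _ (`|ln (c ^+ 2)| + `|ln (n%:R * C ^+ 2)|)) ?lerDl//; last first.
      by rewrite divr_ge0// ltW.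
    rewrite /lnr normrM [`|2^-1|]ger0_norm//.
    have l1 : ln (c ^+ 2) <= ln (sqn x) by rewrite ler_ln ?posrE.
    have l2 : ln (sqn x) <= ln (n%:R * C ^+ 2) by rewrite ler_ln ?posrE// (lt_le_trans s0).
    have := ler_norm (ln (n%:R * C ^+ 2)); have := ler_norm (- ln (c ^+ 2)).
    rewrite normrN => h1 h2.
    have h3 : `|ln (sqn x)| <= `|ln (c ^+ 2)| + `|ln (n%:R * C ^+ 2)|.
      rewrite ler_norml; apply/andP; split; last by have := normr_ge0 (ln (c ^+ 2)); lra.
      by have := normr_ge0 (ln (n%:R * C ^+ 2)); lra.
    by have := normr_ge0 (ln (sqn x)); lra.
  rewrite /partial; have [_ ->] := is_derive_lnr j x0.
  rewrite (@le_trans _ _ (`|C| / c ^+ 2)) ?lerDr ?addr_ge0//.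
  rewrite normrM normfV ler_pM ?invr_ge0//.
    by rewrite (le_trans (coord_le_norm _ _))// (le_trans xC)// ler_norm.
  by rewrite (gtr0_norm s0) lef_pV2 ?posrE.
Qed.

Lemma continuous_locally_bounded (h : R -> R) : continuous h ->
  forall M : R, exists M', forall t, `|t| <= M -> `|h t| <= M'.
Proof.
move=> ch M; have [M0|M0] := ltP M 0.
  by exists 0 => t h1; have := normr_ge0 t; lra.
have cn : {within `[(- M), M], continuous (fun t => `|h t|)}.
  apply: continuous_subspaceT => t; exact: (cvg_norm (ch t)).
have MM : - M <= M by lra.
have [c _ hc] := EVT_max MM cn.
by exists `|h c| => t; rewrite ler_norml => /andP[h1 h2]; apply: hc; rewrite in_itv/= h1.
Qed.

Lemma coef_comp a (h h' : R -> R) : coef a -> measurable_fun setT h ->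
  (forall t, is_derive t (1 : R) h (h' t)) -> continuous h' -> coef (fun x => h (a x)).
Proof.
move=> [ma da ba] mh dh ch'.
have ch : continuous h.
  by move=> t; apply/differentiable_continuous/derivable1_diffP; case: (dh t).
split; first exact: measurableT_comp.
  move=> j x /(da j) /derivableP d.
  by case: (is_derive_compR d (dh (a x))).
move=> c C c0; have [M hM] := ba c C c0.
have [M1 hM1] := continuous_locally_bounded ch M.
have [M2 hM2] := continuous_locally_bounded ch' M.
exists (`|M1| + `|M2| * `|M|) => x cx xC; have [h1 h2] := hM x cx xC; split.
  by rewrite (le_trans (hM1 _ h1))// (le_trans (ler_norm _))// lerDl mulr_ge0.
move=> j; have x0 : x != 0 by apply: contraTneq cx => ->; rewrite normr0 -ltNge.
have [_ ] := is_derive_compR (derivableP (da j x x0)) (dh (a x)).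
rewrite {1}/partial => ->; rewrite normrM.
rewrite (@le_trans _ _ (`|M2| * `|M|)) ?lerDr// ler_pM//.
  by rewrite (le_trans (hM2 _ h1))// ler_norm.
by rewrite (le_trans (h2 j))// ler_norm.
Qed.

End coefficients.

(** * The Euler field and rotations *)

Section euler.
Context {R : realType} (n : nat).
Notation Rn := 'rV[R]_n.
Notation e_ j := (delta_mx 0 j : Rn).
Implicit Types f g a : Rn -> R.

Definition euler f (x : Rn) : R := \sum_m x 0 m * partial m f x.

Definition C1c0 (c : R) f := C1c f /\ vanish_near0 c f.

Lemma C1c0_bcs c f : C1c0 c f -> bcs f. Proof. by case=> -[]. Qed.

Lemma C1c0_coef c a f : coef a -> C1c0 c f -> C1c0 c (fun x => a x * f x).
Proof.
move=> ca [Kf vf]; split; last exact: vanish_mulr.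
by have [] := C1c_coef ca Kf vf.
Qed.

Lemma partial_coef c a f j x : coef a -> C1c0 c f ->
  partial j (fun y => a y * f y) x = partial j a x * f x + a x * partial j f x.
Proof. by move=> ca [Kf vf]; have [_ ->] := C1c_coef ca Kf vf. Qed.

Lemma partial_coordM c f m j (x : Rn) : C1c0 c f ->
  partial j (fun y => y 0 m * f y) x = (m == j)%:R * f x + x 0 m * partial j f x.
Proof. by move=> Kf; rewrite (partial_coef _ _ (coef_coord m) Kf) partial_coord. Qed.

Lemma C1c0_coord c f m : C1c0 c f -> C1c0 c (fun x => x 0 m * f x).
Proof. by move=> Kf; apply: C1c0_coef => //; exact: coef_coord. Qed.

Lemma bcs_coordM f m : bcs f -> bcs (fun x => x 0 m * f x).
Proof.
move=> bf; have [_ [C _ fC]] := bf; apply: bcsMl => //; first exact: measurable_coord.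
exists C => x fx; rewrite (le_trans (coord_le_norm _ _))// leNgt.
by apply: contra fx => h; rewrite fC.
Qed.

Lemma bcs_euler f : C1c f -> bcs (euler f).
Proof.
by move=> Kf; apply: bcs_sum => m _; apply: bcs_coordM; exact: bcs_partial.
Qed.

(** Sum over m of [Int_jacobian] for x_m x_j f and g. The term n is the divergence
    of the Euler field; the contributions of m = j and m = k cancel, which is the
    commutation of the Euler field with x_j d_k. *)
Lemma Int_euler_rot c f g j k : C1c0 c f -> C1c0 c g -> j != k ->
  Int (fun x => euler f x * (x 0 j * partial k g x)) +
    n%:R * Int (fun x => f x * (x 0 j * partial k g x)) =
  Int (fun x => euler g x * (x 0 j * partial k f x)).
Proof.
move=> Kf Kg jk; have [K1f _] := Kf; have [K1g _] := Kg.
have bf := C1c0_bcs Kf; have bg := C1c0_bcs Kg.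
have bpf m := bcs_partial m K1f; have bpg m := bcs_partial m K1g.
have E m : Int (fun x => (x 0 m * partial m f x) * (x 0 j * partial k g x)) +
    (1 + (m == j)%:R) * Int (fun x => f x * (x 0 j * partial k g x)) =
    Int (fun x => (x 0 m * partial m g x) * (x 0 j * partial k f x)) +
    (m == k)%:R * Int (fun x => f x * (x 0 j * partial k g x)).
  have Kjf := C1c0_coord j Kf.
  have [Kmj _] := C1c0_coord m Kjf.
  have b1 : bcs (fun x => (x 0 m * partial m f x) * (x 0 j * partial k g x)).
    by apply: bcsM; exact: bcs_coordM.
  have b2 : bcs (fun x => f x * (x 0 j * partial k g x)).
    by apply: bcsM => //; exact: bcs_coordM.
  have b3 : bcs (fun x => (x 0 m * partial m g x) * (x 0 j * partial k f x)).
    by apply: bcsM; exact: bcs_coordM.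
  have b4 : bcs (fun x => f x * (x 0 j * partial m g x)).
    by apply: bcsM => //; exact: bcs_coordM.
  have := Int_jacobian m k Kmj K1g.
  have -> : Int (fun x => partial m (fun y => y 0 m * (y 0 j * f y)) x * partial k g x) =
    Int (fun x => (x 0 m * partial m f x) * (x 0 j * partial k g x)) +
    (1 + (m == j)%:R) * Int (fun x => f x * (x 0 j * partial k g x)).
    rewrite -IntZ// -IntD//; last exact: bcsZ.
    apply: eq_Int => x; rewrite (partial_coordM _ _ _ Kjf) (partial_coordM _ _ _ Kf) eqxx.
    rewrite [j == m]eq_sym; have [->|_] := eqVneq m j => /=; ring.
  have -> : Int (fun x => partial k (fun y => y 0 m * (y 0 j * f y)) x * partial m g x) =
    Int (fun x => (x 0 m * partial m g x) * (x 0 j * partial k f x)) +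
    (m == k)%:R * Int (fun x => f x * (x 0 j * partial k g x)).
    rewrite -IntZ// -IntD//; last exact: bcsZ.
    apply: eq_Int => x; rewrite (partial_coordM _ _ _ Kjf) (partial_coordM _ _ _ Kf).
    rewrite (negbTE jk); have [->|_] := eqVneq m k => /=; ring.
  by [].
have -> : Int (fun x => euler f x * (x 0 j * partial k g x)) =
   \sum_m Int (fun x => (x 0 m * partial m f x) * (x 0 j * partial k g x)).
  rewrite -Int_sum; last by move=> m _; apply: bcsM; exact: bcs_coordM.
  by apply: eq_Int => x; rewrite /euler big_distrl.
have -> : Int (fun x => euler g x * (x 0 j * partial k f x)) =
   \sum_m Int (fun x => (x 0 m * partial m g x) * (x 0 j * partial k f x)).
  rewrite -Int_sum; last by move=> m _; apply: bcsM; exact: bcs_coordM.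
  by apply: eq_Int => x; rewrite /euler big_distrl.
set I0 := Int (fun x => f x * _).
have h : \sum_(m < n) (Int (fun x => (x 0 m * partial m f x) * (x 0 j * partial k g x)) +
      (1 + (m == j)%:R) * I0) =
    \sum_(m < n) (Int (fun x => (x 0 m * partial m g x) * (x 0 j * partial k f x)) +
      (m == k)%:R * I0).
  by apply: eq_bigr => m _; exact: E.
move: h; rewrite !big_split/= -!big_distrl/= big_split/=.
have d (l : 'I_n) : \sum_(m < n) (m == l)%:R = 1 :> R.
  rewrite (bigD1 l)//= eqxx big1 ?addr0// => m /negbTE ->//.
rewrite !d sumr_const card_ord -/I0 mulrDl => h.
by apply: (addIr (1 * I0)); rewrite -addrA.
Qed.

(** The field x_j d_k has no divergence when j and k differ. *)
Lemma Int_rot_antisym c f g j k : C1c0 c f -> C1c0 c g -> j != k ->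
  Int (fun x => g x * (x 0 j * partial k f x)) =
  - Int (fun x => f x * (x 0 j * partial k g x)).
Proof.
move=> Kf Kg jk; have [Kjf _] := C1c0_coord j Kf; have [K1g _] := Kg.
have := Int_by_parts k Kjf K1g => h.
transitivity (Int (fun x => partial k (fun y => y 0 j * f y) x * g x)).
  by apply: eq_Int => x; rewrite (partial_coordM _ _ _ Kf) (negbTE jk) /=; ring.
rewrite -[LHS]opprK -h; congr (- _); apply: eq_Int => x; ring.
Qed.

(** Both E + n/2 and x_j d_k are antisymmetric, and they commute since x_j d_k
    preserves homogeneity; so the composed form is symmetric in f and g. *)
Lemma Int_euler_rot_sym c f g j k : C1c0 c f -> C1c0 c g -> j != k ->
  Int (fun x => (euler f x + n%:R / 2 * f x) * (x 0 j * partial k g x)) =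
  Int (fun x => (euler g x + n%:R / 2 * g x) * (x 0 j * partial k f x)).
Proof.
move=> Kf Kg jk; have [K1f _] := Kf; have [K1g _] := Kg.
have bf := C1c0_bcs Kf; have bg := C1c0_bcs Kg.
have bpf m := bcs_partial m K1f; have bpg m := bcs_partial m K1g.
have bef := bcs_euler K1f; have beg := bcs_euler K1g.
have E f' g' : bcs f' -> bcs (partial k g') -> bcs (euler f') ->
  Int (fun x => (euler f' x + n%:R / 2 * f' x) * (x 0 j * partial k g' x)) =
  Int (fun x => euler f' x * (x 0 j * partial k g' x)) +
  n%:R / 2 * Int (fun x => f' x * (x 0 j * partial k g' x)).
  move=> b1 b2 b3; rewrite -IntZ; last by apply: bcsM => //; exact: bcs_coordM.
  rewrite -IntD; last 2 first.
  - by apply: bcsM => //; exact: bcs_coordM.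
  - by apply: bcsZ; apply: bcsM => //; exact: bcs_coordM.
  by apply: eq_Int => x; ring.
have e1 := E f g bf (bpg k) bef.
have e2 := E g f bg (bpf k) beg.
have e3 := Int_euler_rot Kf Kg jk.
have e4 := Int_rot_antisym Kf Kg jk.
rewrite e1 e2 -e3 e4.
move: (Int _) (Int _) => a b.
by field.
Qed.

End euler.

(** * The Carleman inequality *)

Section clifford.
Context {R : realType} (n M : nat) (A : 'I_n -> 'M[R]_M).

Definition clifford := (forall j, (A j)^T = A j) /\
  forall j k, A j *m A k + A k *m A j = (2 * (j == k)%:R)%:M.

Hypothesis cA : clifford.

Lemma clifford_sqr (x : 'rV[R]_n) :
  (\sum_j x 0 j *: A j) *m (\sum_j x 0 j *: A j) = (sqn x)%:M.
Proof.
set X := \sum_j x 0 j *: A j.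
have E : X *m X = \sum_j \sum_k (x 0 j * x 0 k) *: (A j *m A k).
  rewrite mulmx_suml; apply: eq_bigr => j _.
  rewrite mulmx_sumr; apply: eq_bigr => k _.
  by rewrite -scalemxAl -scalemxAr scalerA.
have E2 : X *m X + X *m X = (sqn x)%:M + (sqn x)%:M.
  rewrite {1}E exchange_big/= E -big_split/= /sqn -raddfD/= -big_split/=.
  rewrite raddf_sum/=; apply: eq_bigr => j _.
  rewrite -big_split/= (bigD1 j)//= [X in _ + X]big1 ?addr0.
    rewrite -scalerDr (cA.2 j j) eqxx mulr1 scale_scalar_mx; congr (_%:M); ring.
  move=> k kj; rewrite [x 0 k * _]mulrC -scalerDr (cA.2 k j) (negbTE kj).
  by rewrite mulr0 raddf0 scaler0.
have h : (2 : R) *: (X *m X) = 2 *: (sqn x)%:M.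
  by rewrite !(scaler_nat 2) !mulr2n E2.
by have /(congr1 (fun Y => 2^-1 *: Y)) := h; rewrite !scalerA mulVf ?pnatr_eq0// !scale1r.
Qed.

(** The matrix is symmetric and its square is |x|^2. *)
Lemma clifford_isometry (x : 'rV[R]_n) (v : 'cV[R]_M) :
  \sum_p (((\sum_j x 0 j *: A j) *m v) p 0) ^+ 2 = sqn x * \sum_p v p 0 ^+ 2.
Proof.
set X := \sum_j x 0 j *: A j.
have XT : X^T = X.
  by rewrite /X raddf_sum; apply: eq_bigr => j _; apply/matrixP => p q; rewrite !mxE -{2}(cA.1 j) mxE.
have sq (y : 'cV[R]_M) : \sum_p y p 0 ^+ 2 = (y^T *m y) 0 0.
  by rewrite mxE; apply: eq_bigr => p _; rewrite mxE expr2.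
rewrite !sq trmx_mul XT -mulmxA [X *m (X *m v)]mulmxA clifford_sqr.
by rewrite mul_scalar_mx -scalemxAr mxE.
Qed.

(** The antisymmetric part of A_j A_k. Contracted with x_j d_k it yields the
    derivatives of the Dirac operator tangent to the spheres. *)
Definition bivec j k : 'M[R]_M := A j *m A k - (j == k)%:R%:M.

Lemma bivec_tr j k p q : bivec j k q p = - bivec j k p q.
Proof.
have h : bivec j k + (bivec j k)^T = 0.
  rewrite /bivec raddfB/= trmx_mul !cA.1 tr_scalar_mx addrACA cA.2 -opprD.
  by rewrite -raddfD/= -mulr2n mulr_natl subrr.
have := congr1 (fun Y : 'M[R]_M => Y p q) h; rewrite !mxE => /eqP.
by rewrite addrC addr_eq0 => /eqP.
Qed.

Lemma bivec_diag j : bivec j j = 0.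
Proof.
apply/matrixP => p q; have := cA.2 j j.
rewrite eqxx mulr1 => h.
have {}h : A j *m A j = 1%:M.
  have : (2 : R) *: (A j *m A j) = 2 *: 1%:M.
    by rewrite [LHS]scaler_nat mulr2n h scale_scalar_mx mulr1.
  by move/(congr1 (fun Y => 2^-1 *: Y)); rewrite !scalerA mulVf ?pnatr_eq0// !scale1r.
by rewrite /bivec h eqxx subrr.
Qed.

End clifford.

Section carleman.
Context {R : realType} (n M : nat) (A : 'I_n -> 'M[R]_M) (cA : clifford A).
Notation Rn := 'rV[R]_n.
Notation e_ j := (delta_mx 0 j : Rn).
Variables (tau lam c : R) (tau0 : 0 <= tau).

(** The weight as a function of log |x|. The factor |x|^(-n/2) is the one that
    turns the radial part of the conjugated operator into E + n/2, which is
    antisymmetric. *)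
Definition profile (t : R) := expR (tau / 2 * (t - lam) ^+ 2 - n%:R / 2 * t).
Definition dprofile (t : R) := (tau * (t - lam) - n%:R / 2) * profile t.

Lemma is_derive_profile t : is_derive t (1 : R) profile (dprofile t).
Proof.
have h : is_derive t (1 : R) (fun t => tau / 2 * (t - lam) ^+ 2 - n%:R / 2 * t)
    (tau * (t - lam) - n%:R / 2).
  by apply: is_derive_eq; rewrite /GRing.scale /=; field.
rewrite /dprofile mulrC; exact: (@is_derive_compR _ _ _ expR _ _ _ _ h).
Qed.

Lemma continuous_profile : continuous profile.
Proof.
by move=> t; apply/differentiable_continuous/derivable1_diffP; case: (is_derive_profile t).
Qed.

Definition weight (x : Rn) := profile (lnr x).

Lemma coef_weight : coef weight.
Proof.
apply: (@coef_comp _ _ (@lnr R n) profile dprofile); first exact: coef_lnr.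
- exact: continuous_measurable_fun continuous_profile.
- exact: is_derive_profile.
- move=> t; apply: cvgM; last exact: continuous_profile.
  apply: cvgB; last exact: cvg_cst.
  apply: cvgM; first exact: cvg_cst.
  apply: cvgB; [exact: cvg_id|exact: cvg_cst].
Qed.

Lemma partial_weight j (x : Rn) : x != 0 ->
  partial j weight x = (tau * (lnr x - lam) - n%:R / 2) * weight x * (x 0 j / sqn x).
Proof.
move=> x0; have [_ h] := is_derive_compR (is_derive_lnr j x0) (is_derive_profile (lnr x)).
exact: h.
Qed.

Variable u : 'I_M -> Rn -> R.
Hypothesis Ku : forall p, C1c0 c (u p).

Definition dirac_real p (x : Rn) : R := \sum_j \sum_q A j p q * partial j (u q) x.

Let w p (x : Rn) := weight x * u p x.
Let Kw p : C1c0 c (w p). Proof. by apply: C1c0_coef => //; exact: coef_weight. Qed.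
(* The radial, spherical and logarithmic parts of the conjugated operator. *)
Let rad p (x : Rn) := euler (w p) x + n%:R / 2 * w p x.
Let sph p (x : Rn) := \sum_j \sum_k \sum_q bivec A j k p q * (x 0 j * partial k (w q) x).
Let lw p (x : Rn) := (lnr x - lam) * w p x.

(** Writing A_j A_k as its antisymmetric part plus delta_jk splits X D into the
    spherical part and the Euler field; conjugation by the weight subtracts
    E (log weight) = tau l - n/2. *)
Let conj_dirac (x : Rn) : x != 0 -> forall p,
  ((\sum_j x 0 j *: A j) *m \col_q (weight x * dirac_real q x)) p 0 =
  rad p x + (sph p x - tau * lw p x).
Proof.
move=> x0 p; have s0 := sqn_gt0 x0.
set X := \sum_j x 0 j *: A j.
pose wc : 'cV[R]_M := \col_q w q x.
pose Dc k : 'cV[R]_M := \col_q partial k (w q) x.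
pose g := tau * (lnr x - lam) - n%:R / 2.
have E1 : \col_q (weight x * dirac_real q x) =
    \sum_k A k *m Dc k - (g / sqn x) *: (X *m wc).
  have -> : (g / sqn x) *: (X *m wc) = \sum_k A k *m ((g * (x 0 k / sqn x)) *: wc).
    rewrite mulmx_suml scaler_sumr; apply: eq_bigr => k _.
    by rewrite -scalemxAl -scalemxAr scalerA; congr (_ *: _); ring.
  rewrite -sumrB; apply/colP => q; rewrite !mxE summxE /dirac_real mulr_sumr.
  apply: eq_bigr => k _; rewrite -mulmxBr !mxE mulr_sumr; apply: eq_bigr => r _.
  rewrite !mxE /w (partial_coef _ _ coef_weight (Ku r)) partial_weight//.
  by rewrite -/g; ring.
rewrite E1 mulmxBr -scalemxAr mulmxA (clifford_sqr cA) mul_scalar_mx scalerA divfK ?gt_eqF//.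
have E2 : X *m (\sum_k A k *m Dc k) =
    \sum_j \sum_k (x 0 j *: (bivec A j k *m Dc k)) + \sum_j x 0 j *: Dc j.
  rewrite mulmx_suml -big_split/=; apply: eq_bigr => j _.
  rewrite mulmx_sumr.
  have -> : x 0 j *: Dc j = \sum_k x 0 j *: ((j == k)%:R *: Dc k).
    rewrite (bigD1 j)//= eqxx scale1r big1 ?addr0// => k kj.
    by rewrite eq_sym (negbTE kj) scale0r scaler0.
  rewrite -big_split/=; apply: eq_bigr => k _.
  by rewrite -scalemxAl /bivec mulmxBl mul_scalar_mx mulmxA -scalerDr subrK.
rewrite E2 !mxE !summxE.
have -> : \sum_(i < n) (\sum_k x 0 i *: (bivec A i k *m Dc k)) p 0 = sph p x.
  apply: eq_bigr => j _; rewrite summxE; apply: eq_bigr => k _.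
  rewrite !mxE mulr_sumr; apply: eq_bigr => q _; rewrite !mxE; ring.
have -> : \sum_(i < n) (x 0 i *: Dc i) p 0 = euler (w p) x.
  by apply: eq_bigr => j _; rewrite !mxE.
by rewrite /rad /lw /g; ring.
Qed.

Let bcs_w p : bcs (w p). Proof. exact: C1c0_bcs (Kw p). Qed.
Let bcs_pw k p : bcs (partial k (w p)).
Proof. by apply: bcs_partial; case: (Kw p). Qed.
Let bcs_rad p : bcs (rad p).
Proof. by apply: bcsD; [apply: bcs_euler; case: (Kw p)|exact: bcsZ]. Qed.
Let bcs_sph p : bcs (sph p).
Proof.
apply: bcs_sum => j _; apply: bcs_sum => k _; apply: bcs_sum => q _.
by apply: bcsZ; exact: bcs_coordM.
Qed.
Let Klw p : C1c0 c (lw p).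
Proof.
have -> : lw p = (fun x => lnr x * w p x - lam * w p x).
  by apply/funext => x; rewrite /lw mulrBl.
have [K1 [c0 h1]] := C1c0_coef (@coef_lnr R n) (Kw p); have [K2 [_ h2]] := Kw p.
split; first by apply: C1cB => //; exact: C1cZ.
by split => // x xc; rewrite h1// h2// mulr0 subr0.
Qed.
Let bcs_lw p : bcs (lw p). Proof. exact: C1c0_bcs (Klw p). Qed.

(** Symmetric forms ([Int_euler_rot_sym]) are paired with antisymmetric matrices. *)
Let Int_rad_sph : \sum_p Int (fun x => rad p x * sph p x) = 0.
Proof.
pose P j k p q := Int (fun x => rad p x * (x 0 j * partial k (w q) x)).
have bP j k p q : bcs (fun x => rad p x * (x 0 j * partial k (w q) x)).
  by apply: bcsM => //; exact: bcs_coordM.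
have E p : Int (fun x => rad p x * sph p x) =
    \sum_j \sum_k \sum_q bivec A j k p q * P j k p q.
  transitivity (Int (fun x => \sum_j \sum_k \sum_q
      bivec A j k p q * (rad p x * (x 0 j * partial k (w q) x)))).
    apply: eq_Int => x; rewrite /sph mulr_sumr; apply: eq_bigr => j _.
    rewrite mulr_sumr; apply: eq_bigr => k _.
    by rewrite mulr_sumr; apply: eq_bigr => q _; rewrite mulrCA.
  rewrite Int_sum; last first.
    by move=> j _; apply: bcs_sum => k _; apply: bcs_sum => q _; exact: bcsZ.
  apply: eq_bigr => j _; rewrite Int_sum; last first.
    by move=> k _; apply: bcs_sum => q _; exact: bcsZ.
  apply: eq_bigr => k _; rewrite Int_sum; last by move=> q _; exact: bcsZ.
  by apply: eq_bigr => q _; rewrite IntZ.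
under eq_bigr do rewrite E.
rewrite exchange_big/= big1// => j _; rewrite exchange_big/= big1// => k _.
have [<-|jk] := eqVneq j k.
  by rewrite big1// => p _; rewrite big1// => q _; rewrite (bivec_diag cA) mxE mul0r.
set S := \sum_p _.
suff : S = - S by move=> h; lra.
rewrite {1}/S exchange_big/= /S -sumrN; apply: eq_bigr => p _.
rewrite -sumrN; apply: eq_bigr => q _.
have -> : P j k q p = P j k p q by exact: (Int_euler_rot_sym (Kw q) (Kw p) jk).
by rewrite (bivec_tr cA) mulNr.
Qed.

(** The integral of the divergence of x l |w|^2 vanishes, and E l = 1. *)
Let Int_rad_lw p : Int (fun x => rad p x * lw p x) = - Int (fun x => w p x ^+ 2) / 2.
Proof.
have K2 : C1c0 c (fun x => lw p x * w p x).
  have [Kl [c0 l0]] := Klw p; have [Kwp [_ w0]] := Kw p.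
  split; first exact: C1cM.
  by split => // x xc; rewrite l0// mul0r.
have bE : bcs (euler (w p)) by apply: bcs_euler; case: (Kw p).
have b1 : bcs (fun x => euler (w p) x * lw p x) by exact: bcsM.
have b2 : bcs (fun x => w p x * lw p x) by exact: bcsM.
have b3 : bcs (fun x => w p x ^+ 2) by exact: bcsM.
have div0 m : Int (partial m (fun x => x 0 m * (lw p x * w p x))) = 0.
  by apply: Int_partial; case: (C1c0_coord m K2).
have bd m : bcs (partial m (fun x => x 0 m * (lw p x * w p x))).
  by apply: bcs_partial; case: (C1c0_coord m K2).
have : \sum_m Int (partial m (fun x => x 0 m * (lw p x * w p x))) = 0.
  by rewrite big1.
rewrite -Int_sum//.
have -> : Int (fun x => \sum_m partial m (fun y => y 0 m * (lw p y * w p y)) x) =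
    Int (fun x => n%:R * (w p x * lw p x) + w p x ^+ 2 + 2 * (euler (w p) x * lw p x)).
  apply: eq_Int => x.
  have [xc|xc] := ltP `|x| c.
    have [_ [_ w0]] := Kw p; have [_ [_ l0]] := Klw p.
    rewrite w0// l0// !mulr0 expr0n/= !addr0 big1// => m _.
    have [_ vp] := C1c0_coord m K2.
    by have [_ ->] := vanish_partial m vp.
  have x0 : x != 0.
    have [_ [c0 _]] := Kw p.
    by apply: contraTneq xc => ->; rewrite normr0 -ltNge.
  have [Kwp _] := Kw p; have [_ hw] := Kwp.
  have E m : partial m (fun y => y 0 m * (lw p y * w p y)) x =
    lw p x * w p x + (w p x ^+ 2 * (x 0 m ^+ 2 / sqn x) +
      2 * (x 0 m * partial m (w p) x * lw p x)).
    rewrite (partial_coordM _ _ _ K2) eqxx/=.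
    have [dw _] := hw m.
    have dl : is_derive x (e_ m) (lw p)
       ((lnr x - lam) * partial m (w p) x + w p x * (x 0 m / sqn x)).
      have d1 : is_derive x (e_ m) (fun y => lnr y - lam) (x 0 m / sqn x).
        have := is_derive_lnr m x0; move=> h.
        have h2 := @is_deriveB _ _ _ (@lnr R n) (cst lam) x (e_ m) _ _ h (is_derive_cst _ _ _).
        by rewrite subr0 in h2.
      have d2 := derivableP (dw x).
      exact: (@is_deriveM _ _ (fun y => lnr y - lam) (w p) x (e_ m) _ _ d1 d2).
    have [dl1 dl2] := dl.
    rewrite (partialM dl1 (dw x)).
    by rewrite {1}/partial dl2 /lw; ring.
  under eq_bigr do rewrite E.
  rewrite !big_split/= sumr_const card_ord -mulr_natl -!mulr_sumr -!mulr_suml.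
  rewrite -/(sqn x) divff ?gt_eqF ?sqn_gt0//.
  by rewrite -/(euler (w p) x); ring.
rewrite IntD; [|by apply: bcsD => //; exact: bcsZ|exact: bcsZ].
rewrite IntD//; last exact: bcsZ.
rewrite !IntZ// => h.
have -> : Int (fun x => rad p x * lw p x) =
  Int (fun x => euler (w p) x * lw p x) + n%:R / 2 * Int (fun x => w p x * lw p x).
  rewrite -IntZ// -IntD//; last exact: bcsZ.
  by apply: eq_Int => x; rewrite /rad mulrDl mulrA.
by move: h; set I1 := Int _; set I2 := Int _; set I3 := Int _ => h; lra.
Qed.

Let W2 (x : Rn) := weight x ^+ 2.

(** The conjugated operator is a + b with a = rad and b = sph - tau lw, and
    |a + b|^2 = |a - b|^2 + 4 <a, b>. The spherical part of <a, b> integrates to 0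
    and the logarithmic part to tau/2 times the integral of |w|^2. *)
Lemma carleman :
  bcs (fun x => W2 x * (sqn x * \sum_p dirac_real p x ^+ 2)) /\
  2 * tau * Int (fun x => W2 x * \sum_p u p x ^+ 2) <=
  Int (fun x => W2 x * (sqn x * \sum_p dirac_real p x ^+ 2)).
Proof.
pose T p x := rad p x + (sph p x - tau * lw p x).
have bT p : bcs (T p).
  by apply: bcsD => //; apply: bcsB => //; exact: bcsZ.
have bT2 p : bcs (fun x => T p x ^+ 2) by exact: bcsM.
have ET : (fun x => W2 x * (sqn x * \sum_p dirac_real p x ^+ 2)) =
    (fun x => \sum_p T p x ^+ 2).
  apply/funext => x.
  have [xc|xc] := ltP `|x| c.
    have z p : w p x = 0 by have [_ [_ ->]] := Kw p.
    have zp m p : partial m (w p) x = 0.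
      by have [_ vp] := Kw p; have [_ ->] := vanish_partial m vp.
    have zu m p : partial m (u p) x = 0.
      by have [_ vp] := Ku p; have [_ ->] := vanish_partial m vp.
    rewrite big1 ?mulr0; last first.
      move=> p _; rewrite /dirac_real big1 ?expr0n// => j _.
      by rewrite big1// => q _; rewrite zu mulr0.
    rewrite big1// => p _; rewrite /T /rad /sph /lw /euler z.
    rewrite big1 => [|m _]; last by rewrite zp mulr0.
    rewrite big1 => [|j _]; first by rewrite !mulr0 subr0 !addr0 expr0n.
    by rewrite big1// => k _; rewrite big1// => q _; rewrite zp !mulr0.
  have [p0|] := boolP [exists p : 'I_M, true]; last first.
    move=> /existsPn h; rewrite !big1 ?mulr0// => p; by have := h p.
  have x0 : x != 0.
    have [p _] := existsP p0; have [_ [c0 _]] := Kw p.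
    by apply: contraTneq xc => ->; rewrite normr0 -ltNge.
  transitivity (sqn x * \sum_p ((\col_q (weight x * dirac_real q x)) p 0) ^+ 2).
    rewrite mulrCA; congr (_ * _); rewrite mulr_sumr; apply: eq_bigr => p _.
    by rewrite mxE exprMn.
  rewrite -(clifford_isometry cA); apply: eq_bigr => p _.
  by rewrite (conj_dirac x0).
rewrite ET; split; first by apply: bcs_sum => p _.
have bw2 p : bcs (fun x => w p x ^+ 2) by exact: bcsM.
have Ew : Int (fun x => W2 x * \sum_p u p x ^+ 2) = \sum_p Int (fun x => w p x ^+ 2).
  rewrite -Int_sum//; apply: eq_Int => x; rewrite mulr_sumr; apply: eq_bigr => p _.
  by rewrite /W2 -exprMn.
rewrite Ew Int_sum//.
have brs p : bcs (fun x => rad p x * sph p x) by exact: bcsM.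
have brl p : bcs (fun x => rad p x * lw p x) by exact: bcsM.
have h p : 4 * Int (fun x => rad p x * sph p x) - 4 * tau * Int (fun x => rad p x * lw p x) <=
   Int (fun x => T p x ^+ 2).
  rewrite -!IntZ// -IntB; [|exact: bcsZ..].
  apply: le_Int => //; first by apply: bcsB; exact: bcsZ.
  move=> x; rewrite /T -subr_ge0.
  rewrite [leRHS](_ : _ = (rad p x - (sph p x - tau * lw p x)) ^+ 2) ?sqr_ge0//.
  by ring.
apply: le_trans (ler_sum _ (fun p _ => h p)).
rewrite sumrB -!mulr_sumr Int_rad_sph mulr0 sub0r.
under [in leRHS]eq_bigr do rewrite Int_rad_lw.
rewrite -mulr_suml sumrN; set S := \sum_p _.
by rewrite (_ : - _ = 2 * tau * S)//; field.
Qed.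

End carleman.

(** * Smooth bumps on the line *)

Section smooth1.
Context {R : realType}.
Implicit Types (f g : R -> R).

(** Existence of the first k derivatives. *)
Fixpoint Dk (k : nat) f : Prop :=
  if k is k'.+1 then (forall x, derivable f x 1) /\ Dk k' ((derive1 f)) else True.

Definition smooth1 f := forall k, Dk k f.

Lemma DkS k f : Dk k.+1 f -> Dk k f.
Proof. by elim: k f => [//|k IH] f [df /IH]. Qed.

Lemma Dk_le k f (df : R -> R) : (forall x, is_derive x (1 : R) f (df x)) -> Dk k df -> Dk k.+1 f.
Proof.
move=> h hk; split; first by move=> x; case: (h x).
by have -> // : (derive1 f) = df by apply/funext => x; rewrite derive1E; case: (h x).
Qed.

Lemma Dk_is_derive k f x : Dk k.+1 f -> is_derive x (1 : R) f ((derive1 f) x).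
Proof. by move=> [df _]; rewrite derive1E; exact: derivableP. Qed.

Lemma Dk_cst k (c : R) : Dk k (fun=> c).
Proof.
by elim: k c => [//|k IH] c; apply: (@Dk_le _ _ (fun=> 0)) => // x; exact: is_derive_cst.
Qed.

Lemma DkD k f g : Dk k f -> Dk k g -> Dk k (fun x => f x + g x).
Proof.
elim: k f g => [//|k IH] f g kf kg.
apply: (@Dk_le _ _ (fun x => (derive1 f) x + (derive1 g) x)); last by apply: IH; [case: kf|case: kg].
by move=> x; exact: (is_deriveD (Dk_is_derive x kf) (Dk_is_derive x kg)).
Qed.

Lemma DkM k f g : Dk k f -> Dk k g -> Dk k (fun x => f x * g x).
Proof.
elim: k f g => [//|k IH] f g kf kg.
apply: (@Dk_le _ _ (fun x => f x * (derive1 g) x + g x * (derive1 f) x)); last first.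
  by apply: DkD; apply: IH; try exact: DkS; [case: kg|case: kf].
by move=> x; exact: (is_deriveM (Dk_is_derive x kf) (Dk_is_derive x kg)).
Qed.

Lemma DkV k f : (forall x, 0 < f x) -> Dk k f -> Dk k (fun x => (f x)^-1).
Proof.
move=> f0; elim: k => [//|k IH] kf.
have IHk := IH (DkS kf).
pose df (x : R) : R := (- 1) * (derive1 f) x * ((f x)^-1 * (f x)^-1).
have kdf : Dk k df.
  by apply: DkM; [apply: DkM; [exact: Dk_cst|case: kf]|exact: DkM].
suff h x : is_derive x (1 : R) (fun x => (f x)^-1) (df x) by exact: Dk_le h kdf.
have [dfx _] := kf; have fx0 : f x != 0 by rewrite gt_eqF.
have d := @derivableV _ _ f x 1 fx0 (dfx x).
apply: DeriveDef; first exact: d.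
rewrite (@deriveV _ _ f x 1 fx0 (dfx x)) -derive1E /GRing.scale/= /df.
by rewrite -exprVn expr2; ring.
Qed.

Lemma Dk_affine k f (a b : R) : Dk k f -> Dk k (fun x => f (a * x + b)).
Proof.
elim: k f => [//|k IH] f kf.
apply: (@Dk_le _ _ (fun x => a * (derive1 f) (a * x + b))); last first.
  by apply: DkM; [exact: Dk_cst|apply: IH; case: kf].
move=> x; rewrite mulrC; apply: is_derive_compR; last exact: (Dk_is_derive _ kf).
by apply: is_derive_eq; rewrite /GRing.scale /=; ring.
Qed.

Lemma smooth1_derive f : smooth1 f -> smooth1 (derive1 f).
Proof. by move=> sf k; have [] := sf k.+1. Qed.

Lemma smooth1_continuous f : smooth1 f -> continuous f.
Proof.
by move=> sf x; have [df _] := sf 1%N; exact/differentiable_continuous/derivable1_diffP.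
Qed.

End smooth1.

Section flat.
Context {R : realType}.

(** With a polynomial in 1/t as a factor, the functions exp(-1/t) extended by 0 form
    a family closed under derivation, so that smoothness follows by induction. *)
Definition flat (p : {poly R}) (t : R) : R :=
  if 0 < t then p.[t^-1] * expR (- t^-1) else 0.

Let flat_bound (p : {poly R}) : exists2 C, 0 <= C & forall t, `|flat p t| <= C * t ^+ 2.
Proof.
exists (\sum_(i < size p) `|p`_i| * (i.+2)`!%:R).
  by apply: sumr_ge0 => i _; rewrite mulr_ge0.
move=> t; rewrite /flat; case: ifPn => [t0|_]; last first.
  by rewrite normr0 mulr_ge0 ?sqr_ge0//; apply: sumr_ge0 => i _; rewrite mulr_ge0.
rewrite normrM [`|expR _|]ger0_norm ?expR_ge0// horner_coef.
have y0 : 0 < t^-1 by rewrite invr_gt0.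
set y := t^-1 in y0 *.
have -> : t = y^-1 by rewrite /y invrK.
rewrite expRN exprVn ler_pdivrMr ?expR_gt0// mulrAC ler_pdivlMr ?exprn_gt0//.
rewrite !mulr_suml; apply: (@le_trans _ _ (\sum_(i < size p) `|p`_i * y ^+ i| * y ^+ 2)).
  by rewrite -mulr_suml ler_wpM2r ?sqr_ge0//; exact: ler_norm_sum.
apply: ler_sum => i _; rewrite normrM -!mulrA ler_wpM2l//.
rewrite ger0_norm ?exprn_ge0 ?(ltW y0)// -exprD addn2.
have := expR_ge1Dxn i.+1 (ltW y0) => h.
rewrite -ler_pdivrMl ?ltr0n ?fact_gt0// mulrC.
by apply: le_trans h; rewrite lerDr.
Qed.

Lemma is_derive_flat (p : {poly R}) t :
  is_derive t (1 : R) (flat p) (flat ('X^2 * (p - p^`())) t).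
Proof.
have [t0|t0|->] := ltgtP t 0.
- rewrite {2}/flat ltNge (ltW t0)/=; apply: is_derive_near0.
  near=> s; rewrite /flat ifF//; apply/negbTE; rewrite -leNgt ltW//; near: s.
  exact: lt_nbhsl.
- have d : is_derive t (1 : R) (fun s => p.[s^-1] * expR (- s^-1))
      (flat ('X^2 * (p - p^`())) t).
    have dV : is_derive t (1 : R) (fun s : R => s^-1) (- t ^- 2).
      have t1 : t != 0 by rewrite gt_eqF.
      have di : derivable (fun s : R => s) t 1 by exact: derivable_id.
      have d1 := @derivableV _ _ (fun s : R => s) t 1 t1 di.
      have d2 := @deriveV _ _ (fun s : R => s) t 1 t1 di.
      apply: DeriveDef; first exact: d1.
      by rewrite [LHS]d2 derive_id /GRing.scale/= mulr1.
    have dp := @is_derive_compR _ _ _ (horner p) _ _ _ _ dV (is_derive_poly p t^-1).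
    have dN : is_derive t (1 : R) (fun s : R => - s^-1) (t ^- 2).
      by have := is_deriveN dV; rewrite opprK.
    have de := @is_derive_compR _ _ _ (@expR R) _ _ _ _ dN (is_derive_expR (- t^-1)).
    have := is_deriveM dp de; rewrite /flat t0 !hornerE.
    rewrite (_ : _ *: _ + _ *: _ = t^-1 ^+ 2 * (p.[t^-1] - p^`().[t^-1]) * expR (- t^-1))//.
    by rewrite /GRing.scale/= -exprVn; ring.
  apply: (near_eq_is_derive _ d); near=> s; rewrite /flat ifT//; near: s.
  exact: lt_nbhsr.
(* at the origin the difference quotients are O(h), as flat p is O(t^2) *)
- have [C C0 hC] := flat_bound p.
  rewrite {2}/flat ltxx.
  have c : (h^-1 *: (flat p (h *: (1 : R) + 0) - flat p 0)) @[h --> 0^'] --> (0 : R).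
    apply/cvgrPdist_le => e e0; near=> h.
    have h0 : h != 0 by near: h; exact: nbhs_dnbhs_neq.
    rewrite sub0r normrN {2}/flat ltxx subr0 addr0 [h *: _]mulr1 normrZ normfV.
    rewrite ler_pdivrMl ?normr_gt0// (le_trans (hC h))// -real_normK ?num_real//.
    rewrite expr2 mulrA mulrC ler_wpM2l//.
    rewrite (@le_trans _ _ (C * (e / (C + 1))))//; last first.
      by rewrite mulrA ler_pdivrMr ?ltr_wpDl// mulrC ler_wpM2l ?(ltW e0)// lerDl.
    rewrite ler_wpM2l//; near: h; apply: dnbhs0_le.
    by rewrite divr_gt0// ltr_wpDl.
  by apply: DeriveDef; [apply/cvg_ex; exists 0; exact: c|apply/cvg_lim => //; exact: c].
Unshelve. all: by end_near. Qed.

Lemma Dk_flat k (p : {poly R}) : Dk k (flat p).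
Proof.
elim: k p => [//|k IH] p; apply: Dk_le; last exact: (IH ('X^2 * (p - p^`()))).
exact: is_derive_flat.
Qed.

Definition ramp : R -> R := flat 1.

Lemma ramp_gt0 t : 0 < t -> 0 < ramp t.
Proof. by move=> t0; rewrite /ramp /flat t0 hornerC mul1r expR_gt0. Qed.

Lemma ramp_le0 t : t <= 0 -> ramp t = 0.
Proof. by move=> t0; rewrite /ramp /flat ltNge t0. Qed.

Lemma ramp_ge0 t : 0 <= ramp t.
Proof. by have [/ramp_le0 ->//|/ramp_gt0/ltW] := leP t 0. Qed.

Definition step (t : R) := ramp t / (ramp t + ramp (1 - t)).

Let step_den (t : R) : 0 < ramp t + ramp (1 - t).
Proof.
have [t0|t0] := leP t 0.
  by rewrite ltr_wpDl ?ramp_ge0// ramp_gt0//; lra.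
by rewrite ltr_pwDl ?ramp_ge0// ramp_gt0.
Qed.

Lemma step_le0 t : t <= 0 -> step t = 0.
Proof. by move=> t0; rewrite /step ramp_le0// mul0r. Qed.

Lemma step_ge1 t : 1 <= t -> step t = 1.
Proof.
move=> t1; have := step_den t; rewrite /step (@ramp_le0 (1 - t)) ?addr0; last lra.
by move=> h; rewrite divff// gt_eqF.
Qed.

Lemma step_ge0 t : 0 <= step t.
Proof. by rewrite /step divr_ge0 ?ramp_ge0// ltW// step_den. Qed.

Lemma step_le1 t : step t <= 1.
Proof. by rewrite /step ler_pdivrMr ?step_den// mul1r lerDl ramp_ge0. Qed.

Lemma Dk_step k : Dk k step.
Proof.
have h1 : Dk k (fun t => ramp (1 - t)).
  have := Dk_affine (-1) 1 (Dk_flat k 1).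
  by under eq_fun do rewrite mulN1r addrC.
apply: DkM; first exact: Dk_flat.
by apply: DkV; [exact: step_den|apply: DkD => //; exact: Dk_flat].
Qed.

Definition plateau (t : R) := step (2 - t) * step (2 + t).
Definition bump (t : R) := ramp (1 - t) * ramp (1 + t).

Lemma smooth_plateau : smooth1 plateau.
Proof.
move=> k; have h1 := Dk_affine (-1) 2 (Dk_step k); have h2 := Dk_affine 1 2 (Dk_step k).
have -> : plateau = (fun t => step (-1 * t + 2) * step (1 * t + 2)).
  by apply/funext => t; rewrite /plateau mulN1r mul1r addrC [2 + t]addrC.
exact: DkM.
Qed.

Lemma smooth_bump : smooth1 bump.
Proof.
move=> k; have h1 := Dk_affine (-1) 1 (Dk_flat k 1); have h2 := Dk_affine 1 1 (Dk_flat k 1).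
have -> : bump = (fun t => flat 1 (-1 * t + 1) * flat 1 (1 * t + 1)).
  by apply/funext => t; rewrite /bump /ramp mulN1r mul1r addrC [1 + t]addrC.
exact: DkM.
Qed.

Lemma plateau_in t : `|t| <= 1 -> plateau t = 1.
Proof. by rewrite ler_norml => /andP[? ?]; rewrite /plateau !step_ge1 ?mulr1//; lra. Qed.

Lemma plateau_out t : 2 <= `|t| -> plateau t = 0.
Proof.
move=> h; rewrite /plateau; have [t0|t0] := leP 0 t.
  by rewrite ger0_norm// in h; rewrite step_le0 ?mul0r//; lra.
by rewrite ltr0_norm// in h; rewrite (@step_le0 (2 + t)) ?mulr0//; lra.
Qed.

Lemma plateau_ge0 t : 0 <= plateau t.
Proof. by rewrite mulr_ge0 ?step_ge0. Qed.

Lemma plateau_le1 t : plateau t <= 1.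
Proof. by rewrite mulr_ile1 ?step_ge0 ?step_le1. Qed.

Lemma bump_ge0 t : 0 <= bump t.
Proof. by rewrite mulr_ge0 ?ramp_ge0. Qed.

Lemma bump_gt0 t : `|t| < 1 -> 0 < bump t.
Proof. by rewrite ltr_norml => /andP[? ?]; rewrite mulr_gt0 ?ramp_gt0//; lra. Qed.

Lemma bump_out t : 1 <= `|t| -> bump t = 0.
Proof.
move=> h; rewrite /bump; have [t0|t0] := leP 0 t.
  by rewrite ger0_norm// in h; rewrite ramp_le0 ?mul0r//; lra.
by rewrite ltr0_norm// in h; rewrite (@ramp_le0 (1 + t)) ?mulr0//; lra.
Qed.

End flat.

(** * Tensor-product test functions *)

Section compact_support.
Context {R : realType} (n : nat).
Notation Rn := 'rV[R]_n.
Notation e_ j := (delta_mx 0 j : Rn).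
Implicit Types f g : Rn -> R.

Definition Cc f := continuous f /\ exists C : R, forall x, C < `|x| -> f x = 0.

Lemma compact_cube (C : R) : compact [set x : Rn | `|x| <= C].
Proof.
apply: bounded_closed_compact.
  exists C; split; first exact: num_real.
  by move=> M CM x /= xC; rewrite (le_trans xC)// ltW.
rewrite (_ : [set x : Rn | _] = (fun x : Rn => `|x|) @^-1` [set t | t <= C])//.
by apply: closed_comp; [move=> x _; exact: norm_continuous|exact: closed_le].
Qed.

Lemma Cc_bounded f : Cc f -> exists C, forall x, `|f x| <= C.
Proof.
move=> [cf [C fC]].
have [h|h] := pselect (forall x, f x = 0).
  by exists 0 => x; rewrite h normr0.
have [x0 fx0] : exists x, f x != 0.
  by apply: contrapT => h2; apply/h => x; apply: contrapT => /eqP h3; apply: h2; exists x.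
have A0 : [set x : Rn | `|x| <= C] !=set0.
  exists x0 => /=; rewrite leNgt; apply: contra fx0 => /fC ->//.
have cn : {within [set x : Rn | `|x| <= C], continuous (fun x => `|f x|)}.
  by apply: continuous_subspaceT => x; exact: (cvg_norm (cf x)).
have [c _ hc] := compact_EVT_max A0 (@compact_cube C) cn.
exists `|f c| => x; have [xC|xC] := leP `|x| C.
  by apply: hc; rewrite inE.
by rewrite fC// normr0.
Qed.

Lemma Cc_bcs f : Cc f -> bcs f.
Proof.
move=> cf; have [c [C fC]] := cf; have [D fD] := Cc_bounded cf.
split; first exact: continuous_measurable_rV.
exists (`|C| + `|D|) => x; first by rewrite (le_trans (fD x))// (le_trans (ler_norm _))// lerDr.
by move=> h; apply: fC; apply: le_lt_trans h; rewrite (le_trans (ler_norm _))// lerDl.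
Qed.

Lemma Cc_unif f : Cc f -> forall d : R, 0 < d ->
  exists2 e, 0 < e <= 1 & forall x y, `|y - x| <= e -> `|f y - f x| <= d.
Proof.
move=> [cf [C fC]] d d0.
have K := @compact_cube (C + 1).
have /compact_near_coveringP/(_ R (0^'+) (fun e x => forall y, `|y - x| <= e -> `|f y - f x| <= d) _) := K.
move=> /(_ _)/wrap[] => [x _|h].
  have d2 : 0 < d / 2 by rewrite divr_gt0.
  have /cvgrPdist_le/(_ _ d2) := cf x.
  move=> /nbhs_normP[r /= r0 hr].
  exists ([set z : Rn | `|x - z| < r / 2], [set e : R | e < r / 2]).
    split => /=.
      have r2 : 0 < r / 2 by rewrite divr_gt0.
      by have := @nbhsx_ballx _ _ x _ r2; rewrite mx_norm_ball.
    by apply: nbhs_right_lt; rewrite divr_gt0.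
  move=> [z e] [/= zx er] y yz.
  have h1 : `|f x - f z| <= d / 2 by apply: hr => /=; lra.
  have h2 : `|f x - f y| <= d / 2.
    apply: hr => /=; have := ler_distD z x y; rewrite [`|z - y|]distrC; lra.
  have := ler_distD (f x) (f y) (f z); rewrite [`|f y - f x|]distrC; lra.
have [e [e0 e1 he]] : exists e, [/\ 0 < e, e <= 1 & forall x, `|x| <= C + 1 -> forall y, `|y - x| <= e -> `|f y - f x| <= d].
  near (0 : R)^'+ => e; exists e; split.
  - by near: e; exact: nbhs_right_gt.
  - by near: e; exact: nbhs_right_le.
  - by move=> x xC; apply: (near h e _ x xC).
exists e; first by rewrite e0.
move=> x y yx; have [xC|xC] := leP `|x| (C + 1); first exact: he.
have := ler_distD 0 x y; rewrite subr0 sub0r normrN => h2.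
have := lerB_dist x y; rewrite [`|x - y|]distrC => h3.
by rewrite !fC ?subr0 ?normr0 ?(ltW d0)//; lra.
Unshelve. all: by end_near. Qed.

Lemma continuous_coord (i : 'I_n) : continuous (fun x : Rn => x 0 i).
Proof. by move=> x; exact: coord_continuous. Qed.

Lemma CcM f g : Cc f -> continuous g -> Cc (fun x => f x * g x).
Proof.
move=> [cf [C fC]] cg; split; first by move=> x; exact: (cvgM (cf x) (cg x)).
by exists C => x /fC ->; rewrite mul0r.
Qed.

Lemma CcD f g : Cc f -> Cc g -> Cc (fun x => f x + g x).
Proof.
move=> [cf [C fC]] [cg [D gD]]; split; first by move=> x; exact: (cvgD (cf x) (cg x)).
exists (`|C| + `|D|) => x h; rewrite fC ?gD ?addr0//; apply: le_lt_trans h.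
  by rewrite (le_trans (ler_norm _))// lerDr.
by rewrite (le_trans (ler_norm _))// lerDl.
Qed.

Lemma Cc0 : Cc (fun=> 0).
Proof. by split; [exact: cst_continuous|exists 0]. Qed.

Lemma CcZ (a : R) f : Cc f -> Cc (fun x => a * f x).
Proof.
by move=> /CcM /(_ (@cst_continuous _ _ a)); under eq_fun do rewrite mulrC.
Qed.

Lemma CcN f : Cc f -> Cc (fun x => - f x).
Proof. by move=> /(CcZ (-1)); under eq_fun do rewrite mulN1r. Qed.

Lemma CcB f g : Cc f -> Cc g -> Cc (fun x => f x - g x).
Proof. by move=> ? /CcN; exact: CcD. Qed.

Lemma Cc_norm f : Cc f -> Cc (fun x => `|f x|).
Proof.
move=> [cf [C fC]]; split; first by move=> x; exact: (cvg_norm (cf x)).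
by exists C => x /fC ->; rewrite normr0.
Qed.

Lemma Cc_sum (I : Type) (r : seq I) (F : I -> Rn -> R) :
  (forall i, Cc (F i)) -> Cc (fun x => \sum_(i <- r) F i x).
Proof.
move=> KF; elim: r => [|i r IH].
  by under eq_fun do rewrite big_nil; exact: Cc0.
by under eq_fun do rewrite big_cons; exact: CcD.
Qed.

End compact_support.

Section tensor.
Context {R : realType} (n : nat).
Notation Rn := 'rV[R]_n.
Notation e_ j := (delta_mx 0 j : Rn).
Implicit Types h : 'I_n -> R -> R.

(** Test functions are products of functions of one coordinate. The partial
    derivatives keep this shape ([diff_at]), which reduces smoothness to one
    variable. *)
Definition tens h (y : Rn) : R := \prod_i h i (y 0 i).

Definition bump1 (f : R -> R) := smooth1 f /\ exists C : R, forall t, C < `|t| -> f t = 0.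

Definition diff_at h j : 'I_n -> R -> R :=
  fun i => if i == j then derive1 (h j) else h i.

Lemma bump1_derive f : bump1 f -> bump1 (derive1 f).
Proof.
move=> [sf [C fC]]; split; first exact: smooth1_derive.
exists C => t Ct.
suff : is_derive t (1 : R) f 0 by rewrite derive1E; case.
apply: is_derive_near0; near=> y; apply: fC; near: y.
have : (fun y : R => `|y|) @ t --> `|t| by exact: norm_continuous.
by move/cvgr_gt; apply.
Unshelve. all: by end_near. Qed.

Lemma bump1_diff_at h j : (forall i, bump1 (h i)) -> forall i, bump1 (diff_at h j i).
Proof. by move=> bh i; rewrite /diff_at; case: eqP => // _; exact: bump1_derive. Qed.

Lemma is_derive_tens h j (y : Rn) : derivable (h j) (y 0 j) 1 ->
  is_derive y (e_ j) (tens h) (tens (diff_at h j) y).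
Proof.
move=> dh; apply: is_derive_of_line.
pose P := \prod_(i < n | i != j) h i (y 0 i).
have -> : (fun s : R => tens h (s *: e_ j + y)) = (fun s => P * h j (1 * s + y 0 j)).
  apply/funext => s; rewrite /tens (bigD1 j)//= !mxE !eqxx mulr1 mul1r mulrC; congr (_ * _).
  by apply: eq_bigr => i ij; rewrite !mxE (negbTE ij) mulr0 add0r.
have -> : tens (diff_at h j) y = P * derive1 (h j) (y 0 j).
  rewrite /tens (bigD1 j)//= /diff_at eqxx mulrC; congr (_ * _).
  by apply: eq_bigr => i ij; rewrite (negbTE ij).
have dh' : is_derive (1 * 0 + y 0 j) (1 : R) (h j) (derive1 (h j) (y 0 j)).
  by rewrite mulr0 add0r derive1E; exact: derivableP.
have da : is_derive (0 : R) (1 : R) (fun s => 1 * s + y 0 j) 1.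
  by apply: is_derive_eq; rewrite /GRing.scale /=; ring.
have d := is_derive_compR da dh'; rewrite mulr1 in d.
have := @is_deriveZ _ _ _ _ P _ _ _ d.
exact.
Qed.

Lemma continuous_tens h : (forall i, continuous (h i)) -> continuous (tens h).
Proof.
move=> ch; rewrite /tens; elim: (index_enum _) => [|i r IH].
  rewrite (_ : (fun _ => _) = cst 1); first exact: cst_continuous.
  by apply/funext => y; rewrite big_nil.
rewrite (_ : (fun _ => _) = (fun y : Rn => h i (y 0 i) * \prod_(i <- r) h i (y 0 i))); last first.
  by apply/funext => y; rewrite big_cons.
move=> y.
have hi : (fun z : Rn => h i (z 0 i)) @ y --> h i (y 0 i).
  by apply: (@continuous_comp _ _ _ (fun z : Rn => z 0 i) (h i) y); [exact: continuous_coord|exact: ch].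
exact: (cvgM hi (IH y)).
Qed.

Lemma Cc_tens h : (forall i, bump1 (h i)) -> Cc (tens h).
Proof.
move=> bh; split; first by apply: continuous_tens => i; apply: smooth1_continuous; case: (bh i).
have [C hC] := choice (fun i => (bh i).2).
exists (\sum_i `|C i|) => x.
rewrite ltNge => /negP hn; apply: contrapT => /eqP hx; apply: hn.
apply/rV_norm_le => [|i]; first by apply: sumr_ge0.
rewrite (@le_trans _ _ `|C i|)//; last first.
  by rewrite (bigD1 i)//= lerDl sumr_ge0.
rewrite (le_trans _ (ler_norm _))// leNgt; apply: contra hx => /hC h0.
by rewrite /tens (bigD1 i)//= h0 mul0r.
Qed.

Lemma partial_tens h j (y : Rn) : (forall i, bump1 (h i)) ->
  derivable (tens h) y (e_ j) /\ partial j (tens h) y = tens (diff_at h j) y.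
Proof.
move=> bh; suff : is_derive y (e_ j) (tens h) (tens (diff_at h j) y) by case.
by apply: is_derive_tens; have [sh _] := bh j; have [] := sh 1%N.
Qed.

Lemma C1c_tens h : (forall i, bump1 (h i)) -> C1c (tens h).
Proof.
move=> bh; split; first exact/Cc_bcs/Cc_tens.
move=> j; split=> [x|]; first by case: (partial_tens j x bh).
have [C hC] := Cc_bounded (Cc_tens (bump1_diff_at j bh)).
by exists C => x; have [_ ->] := partial_tens j x bh.
Qed.

Lemma smooth_tens h : (forall i, bump1 (h i)) -> smooth (tens h).
Proof.
move=> bh k; elim: k h bh => [|k IH] h bh.
  by split => //; case: (Cc_tens bh).
split; first by case: (Cc_tens bh).
move=> j; split => [x|]; first by case: (partial_tens j x bh).
have -> : partial j (tens h) = tens (diff_at h j).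
  by apply/funext => x; case: (partial_tens j x bh).
by apply: IH; exact: bump1_diff_at.
Qed.

Lemma smooth0 : smooth (fun _ : Rn => 0).
Proof.
move=> k; elim: k => [|k IH]; first by split => //; exact: cst_continuous.
split; first exact: cst_continuous.
move=> j; split => [x|]; first exact: derivable_cst.
by rewrite (_ : partial j _ = fun=> 0)//; apply/funext => x; rewrite /partial derive_cst.
Qed.

End tensor.

(** * Mollification *)

Section bump1_closure.
Context {R : realType}.
Implicit Types f g : R -> R.

Lemma bump1M f g : bump1 f -> bump1 g -> bump1 (fun t => f t * g t).
Proof.
move=> [sf [C fC]] [sg _]; split; first by move=> k; exact: DkM.
by exists C => t /fC ->; rewrite mul0r.
Qed.

Lemma bump1_affine f (a b : R) : 0 < a -> bump1 f -> bump1 (fun t => f (a * t + b)).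
Proof.
move=> a0 [sf [C fC]]; split; first by move=> k; exact: Dk_affine.
exists ((`|C| + `|b|) / a) => t; rewrite ltr_pdivrMr// => h; apply: fC.
have := lerB_dist (a * t) (- b); rewrite opprK normrN normrM (gtr0_norm a0) => h2.
have := ler_norm C; lra.
Qed.

Lemma bump1_shift f (a : R) : bump1 f -> bump1 (fun t => f (t - a)).
Proof.
by move=> /(bump1_affine (- a) ltr01); under eq_fun do rewrite mul1r.
Qed.

End bump1_closure.

Section averages.
Context {R : realType} (n : nat).
Notation Rn := 'rV[R]_n.
Notation e_ j := (delta_mx 0 j : Rn).
Variables (e : R) (e0 : 0 < e).
Implicit Types f g : Rn -> R.

Lemma near_normB (x : Rn) (r : R) : 0 < r -> \forall z \near x, `|x - z| < r.
Proof. by move=> r0; have := @nbhsx_ballx _ _ x _ r0; rewrite mx_norm_ball. Qed.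

Lemma bcs_dom f g : measurable_fun setT f -> bcs g -> (forall x, `|f x| <= g x) -> bcs f.
Proof.
move=> mf [mg [C gC g0]] fg; split => //; exists C => x.
  by rewrite (le_trans (fg x))// (le_trans (ler_norm _)).
by move=> /g0 h; have := fg x; rewrite h normr_le0 => /eqP.
Qed.

Lemma le_norm_Int f g : bcs f -> bcs g -> (forall x, `|f x| <= g x) -> `|Int f| <= Int g.
Proof.
move=> bf bg fg; rewrite ler_norml -IntN//; apply/andP; split.
  by apply: le_Int => // [|x]; [exact: bcsN|have := fg x; rewrite ler_norml => /andP[]].
by apply: le_Int => // x; have := fg x; rewrite ler_norml => /andP[].
Qed.

Definition moll1 : 'I_n -> R -> R := fun _ t => bump (e^-1 * t + 0).
Definition moll : Rn -> R := tens moll1.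

Lemma bump1_moll1 i : bump1 (moll1 i).
Proof.
apply: bump1_affine; first by rewrite invr_gt0.
split; first exact: smooth_bump.
by exists 1 => t /ltW; exact: bump_out.
Qed.

Lemma moll_ge0 z : 0 <= moll z.
Proof. by apply: prodr_ge0 => i _; exact: bump_ge0. Qed.

Lemma moll_out z : e < `|z| -> moll z = 0.
Proof.
rewrite ltNge => /negP hn; apply: contrapT => /eqP hz; apply: hn.
apply/rV_norm_le => [|i]; first exact: ltW.
rewrite leNgt; apply: contra hz => h.
rewrite /moll /tens (bigD1 i)//= /moll1 addr0 bump_out ?mul0r//.
by rewrite normrM normfV (gtr0_norm e0) mulrC ler_pdivlMr// mul1r ltW.
Qed.

Lemma Cc_moll : Cc moll. Proof. by apply: Cc_tens; exact: bump1_moll1. Qed.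

Definition mass := Int moll.

Lemma mass_gt0 : 0 < mass.
Proof.
have m0 : 0 < moll 0.
  by apply: prodr_gt0 => i _; rewrite /moll1 mxE mulr0 addr0 bump_gt0// normr0.
have m2 : 0 < moll 0 / 2 by rewrite divr_gt0.
have [r /andP[r0 _] hr] := Cc_unif Cc_moll m2.
apply: (@lt_le_trans _ _ (moll 0 / 2 * (2 * r) ^+ n)).
  by rewrite mulr_gt0// exprn_gt0// mulr_gt0.
rewrite -(@Int_cube _ _ 0 r (ltW r0)) -IntZ; last exact: bcs_cube.
apply: le_Int; [by apply: bcsZ; exact: bcs_cube|exact/Cc_bcs/Cc_moll|].
move=> x; rewrite indicE; have [|] := boolP (_ \in _); last by rewrite mulr0 moll_ge0.
rewrite inE/= => /hr; rewrite mulr1 ler_distl => /andP[h _]; lra.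
Qed.

Lemma Cc_shift f (a : Rn) : Cc f -> Cc (fun y => f (a + y)).
Proof.
move=> [cf [C fC]]; split.
  move=> y; apply: (@continuous_comp _ _ _ (fun y : Rn => a + y) f y); last exact: cf.
  have h1 : continuous (fun _ : Rn => a) by exact: cst_continuous.
  have h2 : continuous (fun y : Rn => y) by move=> z; exact: cvg_id.
  exact: (cvgD (h1 y) (h2 y)).
exists (C + `|a|) => y h; apply: fC.
by have := lerB_dist (a + y) a; have := ler_normB (a + y) a; rewrite addrAC subrr add0r; lra.
Qed.

Lemma Cc_mollB x : Cc (fun y => moll (y - x)).
Proof. by have := Cc_shift (- x) Cc_moll; under eq_fun do rewrite addrC. Qed.

Lemma Int_mollB x : Int (fun y => moll (y - x)) = mass.
Proof.
rewrite /mass -(Int_shift (- x) (Cc_bcs Cc_moll)).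
by apply: eq_Int => y; rewrite addrC.
Qed.

Lemma Int_moll_le x f (B : R) : bcs (fun y => moll (y - x) * f y) ->
  (forall y, `|y - x| <= e -> `|f y| <= B) ->
  `|Int (fun y => moll (y - x) * f y)| <= mass * B.
Proof.
move=> bf h; rewrite mulrC -(Int_mollB x) -IntZ; last exact/Cc_bcs/Cc_mollB.
apply: le_norm_Int => //; first by apply/bcsZ/Cc_bcs/Cc_mollB.
move=> y; rewrite normrM ger0_norm ?moll_ge0// mulrC.
have [/h fB|/moll_out ->] := leP `|y - x| e; last by rewrite !mulr0.
by rewrite ler_wpM2r ?moll_ge0.
Qed.

(** Average of f near x against a bump of radius e, normalised to total mass 1. *)
Definition avg f (x : Rn) := mass^-1 * Int (fun y => moll (y - x) * f y).

Let Cc_mollM x f : Cc f -> Cc (fun y => moll (y - x) * f y).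
Proof. by move=> [cf _]; apply: CcM => //; exact: Cc_mollB. Qed.

Lemma avg_near f x (d : R) : Cc f -> (forall y, `|y - x| <= e -> `|f y - f x| <= d) ->
  `|avg f x - f x| <= d.
Proof.
move=> Cf h; have m0 := mass_gt0.
have b1 := Cc_bcs (Cc_mollM x Cf).
have b2 : bcs (fun y => moll (y - x) * (f y - f x)).
  have : bcs (fun y => moll (y - x) * f y - f x * moll (y - x)).
    by apply: bcsB => //; apply/bcsZ/Cc_bcs/Cc_mollB.
  by under eq_fun do rewrite [f x * _]mulrC -mulrBr.
have -> : avg f x - f x = mass^-1 * Int (fun y => moll (y - x) * (f y - f x)).
  have -> : Int (fun y => moll (y - x) * (f y - f x)) =
      Int (fun y => moll (y - x) * f y) - f x * mass.
    have b3 := Cc_bcs (Cc_mollB x).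
    rewrite -(Int_mollB x) -(IntZ _ b3) -IntB//; last exact: bcsZ.
    by apply: eq_Int => y; rewrite mulrBr [f x * _]mulrC.
  by rewrite mulrBr /avg mulrCA mulVf ?gt_eqF// mulr1.
by rewrite normrM normfV (gtr0_norm m0) ler_pdivrMl//; exact: Int_moll_le.
Qed.

Lemma avg_eq0 f x : Cc f -> (forall y, `|y - x| <= e -> f y = 0) -> avg f x = 0.
Proof.
move=> Cf h.
have := @Int_moll_le x f 0 (Cc_bcs (Cc_mollM x Cf)).
rewrite mulr0 normr_le0 => h2; rewrite /avg.
have /eqP -> : Int (fun y => moll (y - x) * f y) == 0.
  by apply: h2 => y /h ->; rewrite normr0.
by rewrite mulr0.
Qed.

Lemma Cc_avg f : Cc f -> Cc (avg f).
Proof.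
move=> Cf; have m0 := mass_gt0; have bf := Cc_bcs (Cc_norm Cf).
have [cf [C fC]] := Cf.
split; last first.
  exists (C + e) => x h; apply: avg_eq0 => // y yx; apply: fC.
  by have := lerB_dist x y; rewrite [`|x - y|]distrC; lra.
suff ca (x : Rn) : avg f @ x --> avg f x by move=> x; exact: ca.
apply/(@cvgrPdist_le _ _ _ (nbhs x) (nbhs_filter x)) => d d0.
have I0 : 0 <= Int (fun y => `|f y|) by exact: Int_ge0.
have d1 : 0 < mass * d / (Int (fun y => `|f y|) + 1).
  by rewrite divr_gt0 ?mulr_gt0// ltr_wpDl.
have [r /andP[r0 _] hr] := Cc_unif Cc_moll d1.
apply: filterS (near_normB x r0) => x' /ltW xr /=.
have bx z : bcs (fun y => moll (y - z) * f y) by exact/Cc_bcs/Cc_mollM.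
rewrite /avg -mulrBr normrM normfV (gtr0_norm m0) ler_pdivrMl// -IntB//.
apply: (@le_trans _ _ (Int (fun y => mass * d / (Int (fun y => `|f y|) + 1) * `|f y|))).
  apply: le_norm_Int; [exact: bcsB|exact: bcsZ|].
  move=> y; rewrite -mulrBl normrM ler_wpM2r//; apply: hr.
  by rewrite opprB addrC addrA subrK distrC.
rewrite IntZ// -[leRHS]mulr1 -!mulrA ler_wpM2l ?(ltW m0)// ler_wpM2l ?(ltW d0)//.
by rewrite mulrC ler_pdivrMr ?ltr_wpDl// mul1r lerDl.
Qed.

Let dmoll j : Rn -> R := tens (diff_at moll1 j).

Let Cc_dmoll j : Cc (dmoll j).
Proof. by apply/Cc_tens/bump1_diff_at; exact: bump1_moll1. Qed.

Let moll_line j (z : Rn) (s : R) :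
  is_derive s (1 : R) (fun s : R => moll (z - s *: e_ j)) (- dmoll j (z - s *: e_ j)).
Proof.
have [d1 d2] := @partial_tens _ _ moll1 j (z - s *: e_ j) bump1_moll1.
have h : is_derive (- s) (1 : R) (fun s : R => moll (s *: e_ j + z)) (dmoll j (z - s *: e_ j)).
  apply: is_derive_line; rewrite scaleNr addrC.
  by apply: DeriveDef => //; exact: d2.
have hn : is_derive s (1 : R) (fun s : R => - s) (-1).
  by apply: is_derive_eq; rewrite ?mulN1r.
have := is_derive_compR hn h; rewrite mulrN1.
rewrite (_ : (fun s : R => moll (- s *: e_ j + z)) = (fun s : R => moll (z - s *: e_ j)))//.
by apply/funext => s'; rewrite scaleNr addrC.
Qed.

(** Differentiation under the integral along the line through x; the derivative
    falls on the kernel, so f has to be continuous only. *)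
Lemma partial_avg f j x : Cc f -> derivable (avg f) x (e_ j) /\
  partial j (avg f) x = - mass^-1 * Int (fun y => tens (diff_at moll1 j) (y - x) * f y).
Proof.
move=> Cf; have [cf _] := Cf; have bf := Cc_bcs (Cc_norm Cf).
pose F (s : R) (y : Rn) := moll (y - (s *: e_ j + x)) * f y.
have dF s y : is_derive s (1 : R) (fun s => F s y) (- dmoll j (y - (s *: e_ j + x)) * f y).
  have h := moll_line j (y - x) s.
  have Es (s' : R) : y - x - s' *: e_ j = y - (s' *: e_ j + x).
    by rewrite opprD addrA addrAC.
  rewrite Es in h.
  have h2 := @is_deriveM _ _ _ (cst (f y)) _ _ _ _ h (is_derive_cst _ _ _).
  rewrite (_ : (fun s => F s y) = (fun s => moll (y - x - s *: e_ j)) * cst (f y)).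
    by apply: (is_derive_eq h2); rewrite scaler0 add0r; exact: mulrC.
  by apply/funext => s'; rewrite /F -Es.
have intF s : (lebesgue_rV n).-integrable setT (EFin \o F s).
  by apply/bcs_integrable/Cc_bcs; exact: Cc_mollM.
have [D hD] := Cc_bounded (Cc_dmoll j).
have intG : (lebesgue_rV n).-integrable setT (EFin \o (fun y => `|D| * `|f y|)).
  by apply/bcs_integrable/bcsZ.
have I0 : (`](-1), 1[%classic : set R) 0 by rewrite /= in_itv/=; apply/andP; split; lra.
have h1 := @derivable_under_integral R _ Rn (lebesgue_rV n) F setT measurableT 0 (-1) 1 I0
  (fun s _ => intF s) (fun s y _ _ => @ex_derive _ _ _ _ _ _ _ (dF s y)) (fun y => `|D| * `|f y|)
  (fun y => mulr_ge0 (normr_ge0 _) (normr_ge0 _)) intG.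
have ub s y : (`](-1), 1[%classic : set R) s -> setT y ->
    `|partial1of2 F s y| <= `|D| * `|f y|.
  move=> _ _; rewrite partial1of2E; have [_ ->] := dF s y.
  by rewrite normrM normrN ler_wpM2r// (le_trans (hD _))// ler_norm.
have h2 := @differentiation_under_integral R _ Rn (lebesgue_rV n) F setT measurableT 0 (-1) 1 I0
  (fun s _ => intF s) (fun s y _ _ => @ex_derive _ _ _ _ _ _ _ (dF s y)) (fun y => `|D| * `|f y|)
  (fun y => mulr_ge0 (normr_ge0 _) (normr_ge0 _)) intG ub.
have {}h1 := h1 ub.
have E : is_derive x (e_ j) (avg f) (mass^-1 * Int (fun y => - dmoll j (y - x) * f y)).
  apply: is_derive_of_line.
  have d : is_derive (0 : R) (1 : R) (fun s => Int (F s)) (Int (fun y => - dmoll j (y - x) * f y)).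
    apply: DeriveDef; first exact: h1.
    rewrite -derive1E [LHS]h2; apply: eq_Rintegral => y _.
    by rewrite partial1of2E; have [_ ->] := dF 0 y; rewrite scale0r add0r.
  exact: (@is_deriveZ _ _ _ _ mass^-1 _ _ _ d).
have [E1 E2] := E; split; first exact: E1.
rewrite [LHS]E2 mulNr -mulrN -IntN; last first.
  by apply/Cc_bcs; apply: CcM => //; have := Cc_shift (- x) (Cc_dmoll j);
     under eq_fun do rewrite addrC.
by congr (_ * _); apply: eq_Int => y; rewrite mulNr.
Qed.

Lemma C1c_avg f : Cc f -> C1c (avg f).
Proof.
move=> Cf; split; first exact/Cc_bcs/Cc_avg.
move=> j; split => [x|]; first by case: (partial_avg j x Cf).
have bf := Cc_bcs (Cc_norm Cf); have m0 := mass_gt0.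
have [D hD] := Cc_bounded (Cc_dmoll j).
exists (mass^-1 * (`|D| * Int (fun y => `|f y|))) => x.
have [_ ->] := partial_avg j x Cf.
have Cd : Cc (fun y => dmoll j (y - x)).
  by have := Cc_shift (- x) (Cc_dmoll j); under eq_fun do rewrite addrC.
have im0 : 0 < mass^-1 by rewrite invr_gt0.
rewrite normrM normrN (gtr0_norm im0) ler_wpM2l ?(ltW im0)// -IntZ//.
apply: le_norm_Int; [by apply/Cc_bcs/CcM => //; case: Cf|exact: bcsZ|].
by move=> y; rewrite normrM ler_wpM2r// (le_trans (hD _))// ler_norm.
Qed.

End averages.

(** * Mollified cut-off solutions *)

Section mollified_solution.
Context {R : realType} (n M : nat) (A : 'I_n -> 'M[R]_M).
Notation Rn := 'rV[R]_n.
Notation e_ j := (delta_mx 0 j : Rn).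
Implicit Types (u H : 'I_M -> Rn -> R).

(** Weak form of - sum_j A_j d_j u = H, tested on tensor products: products of
    a mollifying kernel with a factor of the cutoff are of this kind. *)
Definition weak_dirac u H := forall h : 'I_n -> R -> R, (forall i, bump1 (h i)) ->
  forall p, Int (fun y => \sum_j \sum_q A j p q * (u q y * partial j (tens h) y)) =
  Int (fun y => H p y * tens h y).

Definition dominated u H (K : R) := forall p, measurable_fun setT (H p) /\
  forall y, `|H p y| <= K * \sum_q `|u q y|.

Lemma bcs_dominated u H K p (g : Rn -> R) : (forall q, continuous (u q)) -> dominated u H K ->
  Cc g -> bcs (fun y => H p y * g y).
Proof.
move=> cu dH Cg; have [mH bH] := dH p; have [cg _] := Cg.
apply: (@bcs_dom _ _ _ (fun y => \sum_q (K * `|u q y * g y|))).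
- by apply: measurable_funM => //; exact: continuous_measurable_rV.
- apply/Cc_bcs/Cc_sum => q; apply/CcZ/Cc_norm.
  by have := CcM Cg (cu q); under eq_fun do rewrite mulrC.
- move=> y; rewrite normrM -mulr_sumr.
  under eq_bigr do rewrite normrM.
  by rewrite -mulr_suml mulrA ler_wpM2r//; exact: bH.
Qed.

Lemma weak_dirac_shift (a : Rn) u H K : (forall q, continuous (u q)) -> dominated u H K ->
  weak_dirac u H -> weak_dirac (fun q y => u q (a + y)) (fun p y => H p (a + y)).
Proof.
move=> cu dH wu h bh p.
pose h' i t := h i (t - a 0 i).
have bh' i : bump1 (h' i) by exact: bump1_shift.
have E y : tens h y = tens h' (a + y).
  by apply: eq_bigr => i _; rewrite /h' mxE addrAC subrr add0r.
have E' j y : partial j (tens h) y = partial j (tens h') (a + y).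
  have [_ <-] := C1c_shift a (C1c_tens bh').
  by congr (partial j _ y); apply/funext => z; rewrite E.
have Cp j : Cc (partial j (tens h')).
  rewrite (_ : partial j _ = tens (diff_at h' j)); first exact/Cc_tens/bump1_diff_at.
  by apply/funext => y; case: (partial_tens j y bh').
have := wu h' bh' p.
rewrite -(Int_shift a (f := fun y => \sum_j \sum_q A j p q * (u q y * partial j (tens h') y))); last first.
  apply: bcs_sum => j _; apply: bcs_sum => q _; apply/bcsZ/Cc_bcs.
  by have := CcM (Cp j) (cu q); under eq_fun do rewrite mulrC.
rewrite -(Int_shift a (f := fun y => H p y * tens h' y)); last first.
  by apply: bcs_dominated => //; exact: Cc_tens.
move=> h0.
transitivity (Int (fun y => \sum_j \sum_q A j p q * (u q (a + y) * partial j (tens h') (a + y)))).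
  apply: eq_Int => y; apply: eq_bigr => j _; apply: eq_bigr => q _; by rewrite E'.
by rewrite h0; apply: eq_Int => y; rewrite E.
Qed.

Section cutoff.
Variables (h1 h2 : 'I_n -> R -> R).
Hypotheses (b1 : forall i, bump1 (h1 i)) (b2 : forall i, bump1 (h2 i)).

Definition cutoff (y : Rn) := tens h1 y - tens h2 y.
Definition dcutoff j (y : Rn) := tens (diff_at h1 j) y - tens (diff_at h2 j) y.

(** Size of the Dirac operator on the cut-off field: the potential term and the
    commutator of the operator with the cutoff. *)
Definition error (K a0 : R) u (y : Rn) :=
  K * \sum_q `|cutoff y * u q y| + a0 * \sum_j \sum_q `|dcutoff j y * u q y|.

Let Cc_cutoff : Cc cutoff.
Proof. by apply: CcB; exact: Cc_tens. Qed.

Let Cc_dcutoff j : Cc (dcutoff j).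
Proof. by apply: CcB; apply/Cc_tens/bump1_diff_at. Qed.

Let tens_cut (e : R) (e0 : 0 < e) (h : 'I_n -> R -> R) (x : Rn) : (forall i, bump1 (h i)) ->
  let k := fun i t => moll1 e i (t - x 0 i) * h i t in
  [/\ forall i, bump1 (k i), forall y, tens k y = moll e (y - x) * tens h y &
   forall j y, partial j (tens k) y =
     tens (diff_at (@moll1 R n e) j) (y - x) * tens h y + moll e (y - x) * tens (diff_at h j) y].
Proof.
move=> bh k.
have bm := @bump1_moll1 R n e e0.
have bk i : bump1 (k i) by apply: bump1M => //; exact: bump1_shift.
have Ek y : tens k y = moll e (y - x) * tens h y.
  by rewrite /moll /tens -big_split; apply: eq_bigr => i _; rewrite /k !mxE.
split => // j y.
rewrite (_ : tens k = (fun y => moll e (y - x) * tens h y)); last exact/funext.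
have [Km pm] := C1c_shift (- x) (C1c_tens bm).
have Em : (fun y => moll e (y - x)) = (fun y => tens (@moll1 R n e) (- x + y)).
  by apply/funext => z; rewrite addrC.
have [Kh ph] := partial_tens j y bh.
have [_ /(_ j)[dm _]] := Km.
have dmm : derivable (fun y => moll e (y - x)) y (e_ j) by rewrite Em; exact: dm.
rewrite (partialM dmm Kh) ph {1}Em pm; congr (_ * _ + _).
by have [_ ->] := partial_tens j (- x + y) bm; rewrite addrC.
Qed.

(** For fixed x, the kernel centred at x times either term of the cutoff is a test
    function. The weak equation then shows that the Dirac operator on the average
    of [cutoff * u] at x is the average of sum_j A_j dcutoff_j u - H cutoff. Uniform
    continuity makes averages d-close to values once the radius is small. *)
Lemma mollify u H (K a0 : R) : (forall q, continuous (u q)) -> dominated u H K ->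
  (forall j p q, `|A j p q| <= a0) -> weak_dirac u H ->
  forall d r : R, 0 < d -> 0 < r -> exists v : 'I_M -> Rn -> R,
  [/\ forall q, C1c (v q),
      forall q x, `|v q x - cutoff x * u q x| <= d,
      forall q x, (forall y, `|y - x| <= r -> cutoff y = 0) -> v q x = 0 &
      forall p x, `|dirac_real A v p x| <= error K a0 u x + d].
Proof.
move=> cu dH aA wu d r d0 r0.
pose f q y := cutoff y * u q y.
have Cf q : Cc (f q) by exact: CcM.
have Cdf j q : Cc (fun y => dcutoff j y * u q y) by exact: CcM.
have CG : Cc (error K a0 u).
  apply: CcD; apply: CcZ; first by apply: Cc_sum => q; exact: (Cc_norm (Cf q)).
  by apply: Cc_sum => j; apply: Cc_sum => q; exact: (Cc_norm (Cdf j q)).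
have [eG /andP[eG0 _] hG] := Cc_unif CG d0.
have : exists2 ef : R, 0 < ef & forall q x y, `|y - x| <= ef -> `|f q y - f q x| <= d.
  have [ef hef] := choice (fun q => let: ex_intro2 e p1 p2 := Cc_unif (Cf q) d0 in
     ex_intro (fun e => 0 < e /\ forall x y, `|y - x| <= e -> `|f q y - f q x| <= d) e
      (conj (proj1 (andP p1)) p2)).
  exists (\big[Order.min/1]_q ef q).
    by apply/bigmin_gtP; split => // q _; case: (hef q).
  move=> q x y yx; have [_] := hef q; apply; apply: (le_trans yx).
  exact: bigmin_le_cond.
move=> [ef ef0 hf].
pose e := Order.min r (Order.min eG ef).
have e0 : 0 < e by rewrite !lt_min r0 eG0.
have er : e <= r by rewrite ge_min lexx.
have eeG : e <= eG by rewrite !ge_min lexx !orbT.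
have eef : e <= ef by rewrite !ge_min lexx !orbT.
exists (fun q => avg e (f q)); split.
- by move=> q; exact: C1c_avg.
- move=> q x; apply: avg_near => // y yx; apply: hf; exact: le_trans eef.
- move=> q x hx; apply: avg_eq0 => // y yx; rewrite /f hx ?mul0r//; exact: le_trans er.
move=> p x; have m0 : 0 < mass n e by exact: mass_gt0.
pose dm j (y : Rn) := tens (diff_at (@moll1 R n e) j) (y - x).
pose m (y : Rn) := moll e (y - x).
have Cm : Cc m by exact: Cc_mollB.
have Cdm j : Cc (dm j).
  have := Cc_shift (- x) (Cc_tens (bump1_diff_at j (@bump1_moll1 R n e e0))).
  by under eq_fun do rewrite addrC.
have [bk1 Ek1 Pk1] := tens_cut e0 x b1.
have [bk2 Ek2 Pk2] := tens_cut e0 x b2.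
have w1 := wu _ bk1 p; have w2 := wu _ bk2 p.
set k1 := (fun i t => _) in bk1 Ek1 Pk1 w1; set k2 := (fun i t => _) in bk2 Ek2 Pk2 w2.
have bcsk k (bk : forall i, bump1 (k i)) :
    bcs (fun y => \sum_j \sum_q A j p q * (u q y * partial j (tens k) y)) /\
    bcs (fun y => H p y * tens k y).
  split; last by apply: bcs_dominated => //; exact: Cc_tens.
  apply: bcs_sum => j _; apply: bcs_sum => q _; apply/bcsZ/Cc_bcs.
  have -> : (fun y => u q y * partial j (tens k) y) = (fun y => tens (diff_at k j) y * u q y).
    by apply/funext => y; rewrite mulrC; have [_ ->] := partial_tens j y bk.
  by apply: CcM => //; exact/Cc_tens/bump1_diff_at.
have [c1 c1'] := bcsk _ bk1; have [c2 c2'] := bcsk _ bk2.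
have cH : bcs (fun y => H p y * (m y * cutoff y)).
  by apply: bcs_dominated => //; apply: CcM => //; case: Cc_cutoff.
have w : Int (fun y => \sum_j \sum_q A j p q * (dm j y * f q y)) +
    Int (fun y => \sum_j \sum_q A j p q * (m y * (dcutoff j y * u q y))) =
    Int (fun y => H p y * (m y * cutoff y)).
  rewrite -IntD; last 2 first.
  - apply: bcs_sum => j _; apply: bcs_sum => q _; apply/bcsZ/Cc_bcs/CcM => //.
    by case: (Cf q).
  - apply: bcs_sum => j _; apply: bcs_sum => q _; apply/bcsZ/Cc_bcs/CcM => //.
    by case: (Cdf j q).
  have := congr2 (fun a b => a - b) w1 w2; rewrite -!IntB// => w0.
  transitivity (Int (fun y => \sum_j \sum_q A j p q * (u q y * partial j (tens k1) y) -
       \sum_j \sum_q A j p q * (u q y * partial j (tens k2) y))).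
    apply: eq_Int => y; rewrite -sumrB -big_split; apply: eq_bigr => j _ /=.
    rewrite -sumrB -big_split; apply: eq_bigr => q _ /=.
    by rewrite Pk1 Pk2 /f /cutoff /dcutoff /dm /m; ring.
  by rewrite w0; apply: eq_Int => y; rewrite Ek1 Ek2 /m /cutoff; ring.
pose F y := \sum_j \sum_q A j p q * (dcutoff j y * u q y) - H p y * cutoff y.
have EF : dirac_real A (fun q => avg e (f q)) p x = (mass n e)^-1 * Int (fun y => m y * F y).
  transitivity (- (mass n e)^-1 * Int (fun y => \sum_j \sum_q A j p q * (dm j y * f q y))).
    have bb j q : bcs (fun y => A j p q * (dm j y * f q y)).
      by apply/bcsZ/Cc_bcs/CcM => //; case: (Cf q).
    rewrite Int_sum; last by move=> j _; apply: bcs_sum.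
    rewrite mulr_sumr /dirac_real; apply: eq_bigr => j _.
    rewrite Int_sum// mulr_sumr; apply: eq_bigr => q _.
    have [_ ->] := partial_avg e0 j x (Cf q).
    rewrite IntZ; last by apply/Cc_bcs/CcM => //; case: (Cf q).
    by rewrite mulrCA.
  have -> : Int (fun y => m y * F y) =
      Int (fun y => \sum_j \sum_q A j p q * (m y * (dcutoff j y * u q y))) -
      Int (fun y => H p y * (m y * cutoff y)).
    rewrite -IntB//; last first.
      apply: bcs_sum => j _; apply: bcs_sum => q _; apply/bcsZ/Cc_bcs/CcM => //.
      by case: (Cdf j q).
    apply: eq_Int => y; rewrite /F mulrBr [m y * (H p y * _)]mulrCA; congr (_ - _).
    rewrite mulr_sumr; apply: eq_bigr => j _; rewrite mulr_sumr; apply: eq_bigr => q _.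
    by rewrite mulrCA.
  by rewrite -w; ring.
rewrite EF normrM normfV (gtr0_norm m0) ler_pdivrMl//.
apply: Int_moll_le => //.
  rewrite (_ : (fun y => _) = (fun y => \sum_j \sum_q A j p q * (m y * (dcutoff j y * u q y)) -
     H p y * (m y * cutoff y))); last first.
    apply/funext => y; rewrite /F mulrBr [_ * (H p y * _)]mulrCA; congr (_ - _).
    rewrite mulr_sumr; apply: eq_bigr => j _; rewrite mulr_sumr; apply: eq_bigr => q _.
    by rewrite mulrCA.
  apply: bcsB => //.
  apply: bcs_sum => j _; apply: bcs_sum => q _; apply/bcsZ/Cc_bcs/CcM => //.
  by case: (Cdf j q).
move=> y yx; apply: (@le_trans _ _ (error K a0 u y)); last first.
  have := hG x y (le_trans yx eeG); by rewrite ler_distl => /andP[].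
rewrite /F /error addrC (le_trans (ler_normD _ _))// lerD//.
  rewrite normrN normrM mulrC; have [_ hH] := dH p.
  under eq_bigr do rewrite normrM.
  by rewrite -mulr_sumr mulrCA ler_wpM2l.
rewrite (le_trans (ler_norm_sum _ _ _))// mulr_sumr ler_sum// => j _.
rewrite (le_trans (ler_norm_sum _ _ _))// mulr_sumr ler_sum// => q _.
by rewrite normrM ler_wpM2r.
Qed.

End cutoff.
End mollified_solution.

(** * From complex spinors to real systems *)

Section ae_integral.
Context {d} {T : measurableType d} {R : realType} (mu : {measure set T -> \bar R}).

Import HBNNSimple.

(** The integral of f is a supremum over simple functions below f, and each of
    these may be truncated to the complement of the null set. *)
Let ae_ge0_integral (f g : T -> \bar R) : (forall x, 0 <= f x)%E -> (forall x, 0 <= g x)%E ->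
  measurable_fun setT g -> {ae mu, forall x, f x = g x} ->
  (\int[mu]_x f x = \int[mu]_x g x)%E.
Proof.
move=> f0 g0 mg fg; apply/eqP; rewrite eq_le; apply/andP; split.
  rewrite (@ge0_integralTE _ _ _ mu f)//; apply: ge_ereal_sup => _ [h hf <-].
  rewrite -[leLHS]integralT_nnsfun; apply: ae_ge0_le_integral => //.
  - by move=> x _; rewrite lee_fin; exact: fun_ge0.
  - exact/measurable_EFinP.
  - by apply: filterS fg => x <- _; exact: hf.
have [N [mN N0 fgN]] := fg.
have mCN : measurable (~` N) by exact: measurableC.
rewrite (@ge0_negligible_integral _ _ _ mu setT N g)//.
rewrite integral_mkcond.
have mg' : measurable_fun setT (g \_ (setT `\` N)).
  apply/(measurable_restrictT _ _).1; first by rewrite setTD.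
  exact: measurable_funTS.
have g'0 x : (0 <= (g \_ (setT `\` N)) x)%E by apply: erestrict_ge0.
rewrite (@ge0_integralTE _ _ _ mu f)// (@ge0_integralTE _ _ _ mu (g \_ _))//.
apply: ge_ereal_sup => _ [h hg <-]; apply: ereal_sup_ubound; exists h => // x.
apply: (le_trans (hg x)); rewrite patchE; case: ifPn => [|_]; last exact: f0.
rewrite inE => -[_ Nx]; have -> // : f x = g x.
by apply: contrapT => h'; apply/Nx/fgN.
Qed.

(** The integrands in the weak formulation coincide with Borel functions only
    almost everywhere, so f is an arbitrary function. *)
Lemma ae_Rintegral (f g : T -> R) : measurable_fun setT g ->
  {ae mu, forall x, f x = g x} -> Rintegral mu setT f = Rintegral mu setT g.
Proof.
move=> mg fg; rewrite /Rintegral; congr fine.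
have mg' : measurable_fun setT (EFin \o g) by exact/measurable_EFinP.
rewrite integralE [RHS]integralE; congr (_ - _)%E; apply: ae_ge0_integral => //.
- exact: measurable_funepos.
- by apply: filterS fg => x h; rewrite !funeposE /= h.
- exact: measurable_funeneg.
- by apply: filterS fg => x h; rewrite !funenegE /= h.
Qed.

Lemma ae_ord m (P : 'I_m -> T -> Prop) : (forall i, {ae mu, forall x, P i x}) ->
  {ae mu, forall x, forall i, P i x}.
Proof.
move=> h; pose Q (n : nat) x := forall i : 'I_m, n = i :> nat -> P i x.
have : {ae mu, forall x, forall n : nat, Q n x}.
  apply: ae_foralln => n; have [nm|nm] := ltnP n m.
    apply: filterS (h (Ordinal nm)) => x Px i /esym ni.
    by rewrite (_ : i = Ordinal nm)//; exact: val_inj.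
  by apply: aeW => x i ni; move: nm; rewrite ni leqNgt ltn_ord.
by apply: filterS => x hQ i; exact: (hQ i).
Qed.

End ae_integral.

Section realification.
Context {R : realType}.
Notation C := R[i].
Notation Re := (@complex.Re R).
Notation Im := (@complex.Im R).

Lemma ReM (x y : C) : Re (x * y) = Re x * Re y - Im x * Im y.
Proof. by case: x => a b; case: y => c d. Qed.
Lemma ImM (x y : C) : Im (x * y) = Re x * Im y + Im x * Re y.
Proof. by case: x => a b; case: y => c d. Qed.
Lemma ReD (x y : C) : Re (x + y) = Re x + Re y.
Proof. by case: x => a b; case: y => c d. Qed.
Lemma ImD (x y : C) : Im (x + y) = Im x + Im y.
Proof. by case: x => a b; case: y => c d. Qed.
Lemma Re_sum (I : Type) (r : seq I) (F : I -> C) :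
  Re (\sum_(i <- r) F i) = \sum_(i <- r) Re (F i).
Proof. by apply: (big_morph _ ReD). Qed.
Lemma Im_sum (I : Type) (r : seq I) (F : I -> C) :
  Im (\sum_(i <- r) F i) = \sum_(i <- r) Im (F i).
Proof. by apply: (big_morph _ ImD). Qed.

Lemma mulmx_Re m n p (A : 'M[C]_(m, n)) (B : 'M[C]_(n, p)) :
  map_mx Re (A *m B) = map_mx Re A *m map_mx Re B - map_mx Im A *m map_mx Im B.
Proof.
apply/matrixP => i j; rewrite !mxE Re_sum -sumrB; apply: eq_bigr => k _.
by rewrite !mxE ReM.
Qed.

Lemma mulmx_Im m n p (A : 'M[C]_(m, n)) (B : 'M[C]_(n, p)) :
  map_mx Im (A *m B) = map_mx Re A *m map_mx Im B + map_mx Im A *m map_mx Re B.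
Proof.
apply/matrixP => i j; rewrite !mxE Im_sum -big_split; apply: eq_bigr => k _ /=.
by rewrite !mxE ImM.
Qed.

Definition realmx m (B : 'M[C]_m) : 'M[R]_(m + m) :=
  block_mx (map_mx Re B) (- map_mx Im B) (map_mx Im B) (map_mx Re B).
Definition realcv m (v : 'cV[C]_m) : 'cV[R]_(m + m) := col_mx (map_mx Re v) (map_mx Im v).

Lemma realmxM m (A B : 'M[C]_m) : realmx (A *m B) = realmx A *m realmx B.
Proof.
rewrite /realmx mulmx_block mulmx_Re mulmx_Im !mulmxN !mulNmx; congr block_mx.
- by rewrite opprD.
- by rewrite addrC.
- by rewrite addrC.
Qed.

Lemma realmx_mulv m (A : 'M[C]_m) v : realcv (A *m v) = realmx A *m realcv v.
Proof.
by rewrite /realmx /realcv mul_block_col mulmx_Re mulmx_Im mulNmx; congr col_mx; rewrite addrC.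
Qed.

Lemma realmxD m (A B : 'M[C]_m) : realmx (A + B) = realmx A + realmx B.
Proof.
rewrite /realmx add_block_mx; congr block_mx; apply/matrixP => i j;
  by rewrite !mxE ?ReD ?ImD ?opprD.
Qed.

Lemma realmx_scalar m (a : R) : realmx ((Complex a 0)%:M : 'M[C]_m) = a%:M.
Proof.
rewrite /realmx scalar_mx_block; congr block_mx; apply/matrixP => i j;
  by rewrite !mxE; case: eqP; rewrite ?mulr1n ?mulr0n//= ?oppr0.
Qed.

Lemma realmx_tr m (A : 'M[C]_m) : A \is hermsymmx -> (realmx A)^T = realmx A.
Proof.
move=> /is_hermitianmxP; rewrite expr0 scale1r => hA.
have h i j : A i j = (A j i)^* by rewrite {1}hA !mxE.
rewrite /realmx tr_block_mx; congr block_mx; apply/matrixP => i j; rewrite !mxE (h i j);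
  by case: (A j i) => a b //=; rewrite ?opprK.
Qed.

Lemma realcv_norm m (v : 'cV[C]_m) : \sum_p realcv v p 0 ^+ 2 = cnorm v ^+ 2.
Proof.
rewrite /cnorm sqr_sqrtr; last by apply: sumr_ge0 => i _; apply: sumr_ge0 => j _; exact: sqr_ge0.
rewrite big_split_ord /= -big_split /=; apply: eq_bigr => i _.
rewrite big_ord1 /realcv col_mxEu col_mxEd !mxE.
case: (v i 0) => a b /=; by rewrite /Normc.normc sqr_sqrtr// addr_ge0// sqr_ge0.
Qed.

Lemma normc_ge (z : C) : `|Re z| <= Normc.normc z /\ `|Im z| <= Normc.normc z.
Proof.
case: z => a b; rewrite /Normc.normc /= -!(sqrtr_sqr _); split;
  by apply: ler_wsqrtr; rewrite ?lerDl ?lerDr sqr_ge0.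
Qed.

Lemma cnorm_ge m p (B : 'M[C]_(m, p)) i j : Normc.normc (B i j) <= cnorm B.
Proof.
have n0 : 0 <= Normc.normc (B i j) by case: (B i j) => a b; exact: sqrtr_ge0.
rewrite /cnorm -[leLHS]ger0_norm// -sqrtr_sqr; apply: ler_wsqrtr.
rewrite (bigD1 i)//= (bigD1 j)//= -addrA lerDl addr_ge0//.
  by apply: sumr_ge0 => k _; exact: sqr_ge0.
by apply: sumr_ge0 => k _; apply: sumr_ge0 => l _; exact: sqr_ge0.
Qed.

Lemma realmx_clifford n m (alpha : 'I_n -> 'M[C]_m) : dirac_matrices alpha ->
  clifford (fun j => realmx (alpha j)).
Proof.
move=> [ha ca]; split => [j|j k]; first exact: realmx_tr.
rewrite -!realmxM -realmxD ca.
have -> : 2 * (j == k)%:R = Complex (2 * (j == k)%:R) 0 :> C.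
  case: (j == k) => /=; rewrite ?mulr1 ?mulr0//.
  exact: (esym (rmorph_nat (real_complex R) 2)).
exact: realmx_scalar.
Qed.

End realification.

Section real_form.
Context {R : realType} (n m : nat) (alpha : 'I_n -> 'M[R[i]]_m).
Notation C := R[i].
Notation Rn := 'rV[R]_n.
Notation Re := (@complex.Re R).
Notation Im := (@complex.Im R).
Hypothesis halpha : dirac_matrices alpha.

Definition testv (h : 'I_n -> R -> R) (k : 'I_m) (y : Rn) : 'cV[C]_m :=
  \col_l (if l == k then Complex (tens h y) 0 else 0).

Let compact_closure (A : set Rn) (B : R) : (forall x, A x -> `|x| <= B) -> compact (closure A).
Proof.
move=> AB; apply: (subclosed_compact _ (@compact_cube R n B)); first exact: closed_closure.
move=> x clx /=; rewrite leNgt; apply/negP => Bx.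
have nx : nbhs x [set y : Rn | B < `|y|].
  have : (fun y : Rn => `|y|) @ x --> `|x| by exact: norm_continuous.
  by move/cvgr_gt; apply.
have [y [Ay /=]] := clx _ nx.
by rewrite ltNge AB.
Qed.

Lemma test_testv h k : (forall i, bump1 (h i)) -> test_vfun (testv h k).
Proof.
move=> bh l; rewrite /testv.
have [lk|lk] := eqVneq l k.
  have E : (fun x => testv h k x l 0) = (fun x => Complex (tens h x) 0).
    by apply/funext => x; rewrite mxE lk eqxx.
  rewrite E; split; [exact: smooth_tens|exact: smooth0|].
  have [_ [B hB]] := Cc_tens bh.
  apply: (@compact_closure _ B) => x /= /eqP hx; rewrite leNgt; apply/negP => /hB h0.
  by apply: hx; rewrite h0.
have E : (fun x => testv h k x l 0) = (fun x => 0).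
  by apply/funext => x; rewrite mxE (negbTE lk).
rewrite E; split; [exact: smooth0|exact: smooth0|].
by apply: (@compact_closure _ 0) => x /=; rewrite eqxx.
Qed.

Lemma dirac_testv h k (x : Rn) :
  dirac_op alpha (testv h k) x =
  - 'i%C *: \sum_j (Complex (partial j (tens h) x) 0 *: col k (alpha j)).
Proof.
rewrite /dirac_op; congr (_ *: _); apply: eq_bigr => j _.
have -> : \col_l cpartial j (fun y => testv h k y l 0) x =
    Complex (partial j (tens h) x) 0 *: (delta_mx k 0 : 'cV[C]_m).
  apply/colP => l; rewrite !mxE andbT.
  have -> : (fun y => testv h k y l 0) =
      (fun y => if l == k then Complex (tens h y) 0 else 0).
    by apply/funext => y; rewrite mxE.
  rewrite /cpartial; have [lk|lk] := eqVneq l k.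
    by rewrite mulr1 /=; congr Complex; rewrite /partial derive_cst.
  by rewrite mulr0 /= /partial derive_cst.
by rewrite -scalemxAr -colE.
Qed.

Let conjC_E (z : C) : z^* = Complex (Re z) (- Im z).
Proof. by case: z. Qed.

Lemma cdot_testv h k (u w : 'cV[C]_m) (x : Rn) :
  cdot u (dirac_op alpha (testv h k) x) + cdot w (testv h k x) =
  'i%C * \sum_j (Complex (partial j (tens h) x) 0 * (alpha j *m u) k 0) +
  w k 0 * Complex (tens h x) 0.
Proof.
congr (_ + _); last first.
  rewrite /cdot (bigD1 k)//= big1 ?addr0.
    by rewrite mxE eqxx conjC_E /= oppr0.
  by move=> l lk; rewrite mxE (negbTE lk) conjC0 mulr0.
rewrite dirac_testv /cdot.
have ha j l : alpha j k l = (alpha j l k)^*.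
  have := is_hermitianmxP _ _ _ (halpha.1 j); rewrite expr0 scale1r => hA.
  by rewrite {1}hA !mxE.
transitivity (\sum_l \sum_j 'i%C * (Complex (partial j (tens h) x) 0 * (alpha j k l * u l 0))).
  apply: eq_bigr => l _; rewrite mxE summxE rmorphM rmorph_sum /=.
  rewrite mulrA mulr_sumr; apply: eq_bigr => j _.
  rewrite !mxE rmorphM (ha j l) /=.
  have -> : (Complex (partial j (tens h) x) 0)^* = Complex (partial j (tens h) x) 0.
    by rewrite conjC_E /= oppr0.
  have -> : (- 'i%C : C)^* = 'i%C.
    by rewrite conjC_E /=; congr Complex; rewrite ?oppr0 ?opprK.
  by ring.
rewrite exchange_big mulr_sumr; apply: eq_bigr => j _ /=.
by rewrite mxE !mulr_sumr.
Qed.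

Variables (V : Rn -> 'M[C]_m) (U Uc : Rn -> 'cV[C]_m).
Hypothesis Vmeas : forall i j, lebesgue_measurable_cfun (fun x => V x i j).
Hypothesis Vbdd : ess_bounded V.
Hypothesis Usol : weak_solution alpha V U.
Hypothesis UcU : continuous_representative U Uc.

Definition ucomp p (x : Rn) := realcv (Uc x) p 0.

Lemma ucomp_l k x : ucomp (lshift m k) x = Re (Uc x k 0).
Proof. by rewrite /ucomp /realcv col_mxEu mxE. Qed.

Lemma ucomp_r k x : ucomp (rshift m k) x = Im (Uc x k 0).
Proof. by rewrite /ucomp /realcv col_mxEd mxE. Qed.

Lemma continuous_ucomp p : continuous (ucomp p).
Proof.
have [cU _] := UcU; have [k ->|k ->] := split_ordP p.
  by rewrite (_ : ucomp _ = fun x => Re (Uc x k 0)); [case: (cU k)|apply/funext/ucomp_l].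
by rewrite (_ : ucomp _ = fun x => Im (Uc x k 0)); [case: (cU k)|apply/funext/ucomp_r].
Qed.

(** The potential term V U is replaced by a Borel representative, and the weak
    equation is tested on one component at a time: its imaginary part is the row of
    the real part of that component, its real part the row of the imaginary part. *)
Lemma real_form : exists H K, [/\ 0 <= K, dominated ucomp H K &
  weak_dirac (fun j => realmx (alpha j)) ucomp H].
Proof.
have [cU UcUae] := UcU.
pose vR i j := sval (cid2 (Vmeas i j).1); pose vI i j := sval (cid2 (Vmeas i j).2).
have mvR i j : measurable_fun setT (vR i j) by rewrite /vR; case: cid2.
have mvI i j : measurable_fun setT (vI i j) by rewrite /vI; case: cid2.
have avR : {ae lebesgue_rV n, forall x, forall i j, Re (V x i j) = vR i j x}.
  by apply: ae_ord => i; apply: ae_ord => j; rewrite /vR; case: cid2.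
have avI : {ae lebesgue_rV n, forall x, forall i j, Im (V x i j) = vI i j x}.
  by apply: ae_ord => i; apply: ae_ord => j; rewrite /vI; case: cid2.
have [K0 aK] := Vbdd; pose K := `|K0|; have K_ge0 : 0 <= K by exact: normr_ge0.
pose WR k x := \sum_i (vR k i x * ucomp (lshift m i) x - vI k i x * ucomp (rshift m i) x).
pose WI k x := \sum_i (vR k i x * ucomp (rshift m i) x + vI k i x * ucomp (lshift m i) x).
pose S x := \sum_q `|ucomp q x|.
have S0 x : 0 <= S x by exact: sumr_ge0.
pose H0 (p : 'I_(m + m)) x := match fintype.split p with inl k => - WI k x | inr k => WR k x end.
(* truncation makes the essential bound on V U hold at every point *)
pose H p x := Num.max (- (K * S x)) (Num.min (K * S x) (H0 p x)).
have mu p : measurable_fun setT (ucomp p).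
  by apply: continuous_measurable_rV; exact: continuous_ucomp.
have mS : measurable_fun setT S.
  by apply: measurable_sum => q; apply: measurableT_comp => //; exact: mu.
have mKS : measurable_fun setT (fun x => K * S x) by exact: measurable_funM.
have mH p : measurable_fun setT (H p).
  apply: measurable_maxr; first exact: measurableT_comp.
  apply: measurable_minr => //; rewrite /H0; case: (fintype.split p) => k.
    apply: measurableT_comp => //; apply: measurable_sum => i.
    by apply: measurable_funD; apply: measurable_funM.
  by apply: measurable_sum => i; apply: measurable_funB; apply: measurable_funM.
have dH : dominated ucomp H K.
  move=> p; split => // x; rewrite /H ler_norml.
  have KS : 0 <= K * S x by rewrite mulr_ge0.
  by rewrite le_max lexx/= ge_max ge_min lexx/= andbT (@le_trans _ _ 0)// oppr_le0.
exists H; exists K; split => // h bh p.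
have VUE x k : (forall i j, Re (V x i j) = vR i j x) -> (forall i j, Im (V x i j) = vI i j x) ->
    Uc x = U x -> (V x *m U x) k 0 = Complex (WR k x) (WI k x).
  move=> eR eI eU; rewrite -eU mxE.
  apply/eqP; rewrite eq_complex /= Re_sum Im_sum; apply/andP; split; apply/eqP;
    apply: eq_bigr => i _; rewrite ?ReM ?ImM eR eI ucomp_l ucomp_r//.
have HE : {ae lebesgue_rV n, forall x, forall p, H p x = H0 p x}.
  move: avR avI aK; apply: filterS3 => x eR eI eK q.
  suff : `|H0 q x| <= K * S x.
    by rewrite ler_norml => /andP[h1 h2]; rewrite /H (min_idPr h2) (max_idPr h1).
  have cR k i : `|vR k i x| <= K.
    have [h1 _] := normc_ge (V x k i).
    by rewrite -eR (le_trans h1)// (le_trans (cnorm_ge _ _ _))// (le_trans eK)// ler_norm.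
  have cI k i : `|vI k i x| <= K.
    have [_ h1] := normc_ge (V x k i).
    by rewrite -eI (le_trans h1)// (le_trans (cnorm_ge _ _ _))// (le_trans eK)// ler_norm.
  have ES : K * S x = \sum_i (K * `|ucomp (lshift m i) x| + K * `|ucomp (rshift m i) x|).
    by rewrite /S big_split_ord /= -big_split/= mulr_sumr; apply: eq_bigr => i _; rewrite mulrDr.
  rewrite ES /H0; case: (fintype.split q) => k.
    rewrite normrN (le_trans (ler_norm_sum _ _ _))// ler_sum// => i _.
    by rewrite [leRHS]addrC (le_trans (ler_normD _ _))// !normrM lerD// ler_wpM2r.
  rewrite (le_trans (ler_norm_sum _ _ _))// ler_sum// => i _.
  by rewrite (le_trans (ler_normB _ _))// !normrM lerD// ler_wpM2r.
pose ZR k x := \sum_j partial j (tens h) x * Re ((alpha j *m Uc x) k 0).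
pose ZI k x := \sum_j partial j (tens h) x * Im ((alpha j *m Uc x) k 0).
have inte k : {ae lebesgue_rV n, forall x,
    cdot (U x) (dirac_op alpha (testv h k) x) + cdot (V x *m U x) (testv h k x) =
    Complex (H (rshift m k) x * tens h x - ZI k x)
            (ZR k x - H (lshift m k) x * tens h x)}.
  apply: filterS2 (filterI avR avI) (filterI UcUae HE) => x [eR eI] [eU eH].
  rewrite cdot_testv (VUE x k eR eI eU) -eU.
  have -> : WR k x = H (rshift m k) x by rewrite eH /H0 -[rshift m k]/(unsplit (inr k)) unsplitK.
  have -> : WI k x = - H (lshift m k) x.
    by rewrite eH /H0 -[lshift m k]/(unsplit (inl k)) unsplitK opprK.
  set z := \sum_j _.
  have zR : Re z = ZR k x.
    by rewrite Re_sum; apply: eq_bigr => j _; rewrite ReM /= mul0r subr0.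
  have zI : Im z = ZI k x.
    by rewrite Im_sum; apply: eq_bigr => j _; rewrite ImM /= mul0r addr0.
  apply/eqP; rewrite eq_complex; apply/andP; split; apply/eqP.
    rewrite ReD !ReM zR zI /=; ring.
  rewrite ImD !ImM zR zI /=; ring.
have AE k j x : \sum_q realmx (alpha j) (lshift m k) q * ucomp q x = Re ((alpha j *m Uc x) k 0).
  have := congr1 (fun Y : 'cV[R]_(m + m) => Y (lshift m k) 0) (realmx_mulv (alpha j) (Uc x)).
  by rewrite [LHS]col_mxEu !mxE => ->; apply: eq_bigr.
have AE' k j x : \sum_q realmx (alpha j) (rshift m k) q * ucomp q x = Im ((alpha j *m Uc x) k 0).
  have := congr1 (fun Y : 'cV[R]_(m + m) => Y (rshift m k) 0) (realmx_mulv (alpha j) (Uc x)).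
  by rewrite [LHS]col_mxEd !mxE => ->; apply: eq_bigr.
have Cu q j : Cc (fun x => ucomp q x * partial j (tens h) x).
  have -> : (fun y => ucomp q y * partial j (tens h) y) = (fun y => tens (diff_at h j) y * ucomp q y).
    by apply/funext => y; rewrite mulrC; have [_ ->] := partial_tens j y bh.
  by apply: CcM; [exact/Cc_tens/bump1_diff_at|exact: continuous_ucomp].
have bA q0 : bcs (fun x => \sum_j \sum_q realmx (alpha j) q0 q * (ucomp q x * partial j (tens h) x)).
  apply: bcs_sum => j _; apply: bcs_sum => q _; apply/bcsZ; exact: Cc_bcs.
have ZRE k : (fun x => \sum_j \sum_q realmx (alpha j) (lshift m k) q * (ucomp q x * partial j (tens h) x)) = ZR k.
  apply/funext => x; apply: eq_bigr => j _; rewrite -AE mulr_sumr.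
  by apply: eq_bigr => q _; ring.
have ZIE k : (fun x => \sum_j \sum_q realmx (alpha j) (rshift m k) q * (ucomp q x * partial j (tens h) x)) = ZI k.
  apply/funext => x; apply: eq_bigr => j _; rewrite -AE' mulr_sumr.
  by apply: eq_bigr => q _; ring.
have bH q : bcs (fun x => H q x * tens h x).
  by apply: bcs_dominated dH _; [exact: continuous_ucomp|exact: Cc_tens].
have main k := Usol (test_testv k bh).
have split_main k : Int (fun x => H (rshift m k) x * tens h x - ZI k x) = 0 /\
    Int (fun x => ZR k x - H (lshift m k) x * tens h x) = 0.
  have bR : bcs (fun x => H (rshift m k) x * tens h x - ZI k x).
    by apply: bcsB => //; rewrite -ZIE.
  have bI : bcs (fun x => ZR k x - H (lshift m k) x * tens h x).
    by apply: bcsB => //; rewrite -ZRE.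
  pose D x := cdot (U x) (dirac_op alpha (testv h k) x) + cdot (V x *m U x) (testv h k x).
  have eR : Int (fun x => Re (D x)) = Int (fun x => H (rshift m k) x * tens h x - ZI k x).
    by apply: ae_Rintegral; [case: bR|move: (inte k); apply: filterS => x; rewrite /D => ->].
  have eI : Int (fun x => Im (D x)) = Int (fun x => ZR k x - H (lshift m k) x * tens h x).
    by apply: ae_Rintegral; [case: bI|move: (inte k); apply: filterS => x; rewrite /D => ->].
  by rewrite -eR -eI; have [] := main k.
have [k ->|k ->] := split_ordP p.
  have [_] := split_main k; rewrite ZRE IntB//; last by rewrite -ZRE.
  by move/eqP; rewrite subr_eq0 => /eqP.
have [+ _] := split_main k; rewrite ZIE IntB//; last by rewrite -ZIE.
by move/eqP; rewrite subr_eq0 => /eqP ->.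
Qed.

End real_form.

(** * Annular cutoffs *)

Section scaled_plateau.
Context {R : realType}.

Definition plateau_at (s : R) (t : R) : R := plateau (s^-1 * t + 0).

Variables (s : R) (s0 : 0 < s).

Lemma bump1_plateau : bump1 (@plateau R).
Proof.
split; first exact: smooth_plateau.
by exists 2 => t /ltW; exact: plateau_out.
Qed.

Lemma bump1_plateau_at : bump1 (plateau_at s).
Proof. by apply: bump1_affine; [rewrite invr_gt0|exact: bump1_plateau]. Qed.

Let normE t : `|s^-1 * t + 0| = `|t| / s.
Proof. by rewrite addr0 normrM normfV (gtr0_norm s0) mulrC. Qed.

Lemma plateau_at_in t : `|t| <= s -> plateau_at s t = 1.
Proof. by move=> h; rewrite /plateau_at plateau_in// normE ler_pdivrMr// mul1r. Qed.

Lemma plateau_at_out t : 2 * s <= `|t| -> plateau_at s t = 0.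
Proof. by move=> h; rewrite /plateau_at plateau_out// normE ler_pdivlMr. Qed.

Lemma plateau_at_ge0 t : 0 <= plateau_at s t. Proof. exact: plateau_ge0. Qed.
Lemma plateau_at_le1 t : plateau_at s t <= 1. Proof. exact: plateau_le1. Qed.

Lemma derive_plateau_at t : derive1 (plateau_at s) t = derive1 (@plateau R) (s^-1 * t + 0) / s.
Proof.
have h := Dk_is_derive (s^-1 * t + 0) (@smooth_plateau R 1).
have ha : is_derive t (1 : R) (fun t => s^-1 * t + 0) s^-1.
  by apply: is_derive_eq; rewrite /GRing.scale /=; ring.
by have [_ e] := is_derive_compR ha h; rewrite derive1E [LHS]e.
Qed.

Lemma derive_plateau_at0 t : `|t| < s \/ 2 * s < `|t| -> derive1 (plateau_at s) t = 0.
Proof.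
move=> h; suff : is_derive t (1 : R) (plateau_at s) 0 by rewrite derive1E; case.
have cn : (fun y : R => `|y|) @ t --> `|t| by exact: norm_continuous.
case: h => h; last first.
  apply: is_derive_near0; near=> y; rewrite plateau_at_out// ltW//; near: y.
  by move/cvgr_gt : cn; apply.
have hc : is_derive t (1 : R) (cst (1 : R)) 0 by exact: is_derive_cst.
apply: (near_eq_is_derive _ hc).
  near=> y; rewrite plateau_at_in// ltW//; near: y.
  by move/cvgr_lt : cn; apply.
Unshelve. all: by end_near. Qed.

End scaled_plateau.

Section annular_cutoff.
Context {R : realType} (n : nat).
Notation Rn := 'rV[R]_n.
Variables (a b : R) (a0 : 0 < a) (ab : 2 * a <= b).

Definition inner : 'I_n -> R -> R := fun=> plateau_at a.
Definition outer : 'I_n -> R -> R := fun=> plateau_at b.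

Lemma bump1_inner i : bump1 (inner i). Proof. exact: bump1_plateau_at. Qed.
Lemma bump1_outer i : bump1 (outer i).
Proof. apply: bump1_plateau_at; exact: (lt_le_trans (mulr_gt0 (ltr0Sn R 1) a0) ab). Qed.

Notation eta := (cutoff outer inner).
Notation deta := (dcutoff outer inner).

Let b0 : 0 < b. Proof. by move: a0 ab => ? ?; lra. Qed.

Let tens_in s (x : Rn) : 0 < s -> `|x| <= s -> tens (fun=> plateau_at s) x = 1.
Proof.
move=> s0 h; apply: big1 => i _; rewrite plateau_at_in//.
by rewrite (le_trans (coord_le_norm _ _)).
Qed.

Let ex_coord (s : R) (x : Rn) : 0 <= s -> s < `|x| -> exists i, s < `|x 0 i|.
Proof.
move=> s0 sx; apply: contrapT => h; move: sx; rewrite ltNge => /negP; apply.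
by apply/rV_norm_le => // i; rewrite leNgt; apply/negP => hi; apply: h; exists i.
Qed.

Let tens_out s (x : Rn) : 0 < s -> 2 * s < `|x| -> tens (fun=> plateau_at s) x = 0.
Proof.
move=> s0 /ex_coord[|i hi]; first by rewrite mulr_ge0// ltW.
by rewrite /tens (bigD1 i)//= plateau_at_out ?mul0r// ltW.
Qed.

Let dtens_in s j (x : Rn) : 0 < s -> `|x| < s -> tens (diff_at (fun=> plateau_at s) j) x = 0.
Proof.
move=> s0 h; rewrite /tens (bigD1 j)//= /diff_at eqxx derive_plateau_at0 ?mul0r//.
by left; rewrite (le_lt_trans (coord_le_norm _ _)).
Qed.

Let dtens_out s j (x : Rn) : 0 < s -> 2 * s < `|x| -> tens (diff_at (fun=> plateau_at s) j) x = 0.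
Proof.
move=> s0 /ex_coord[|i hi]; first by rewrite mulr_ge0// ltW.
rewrite /tens (bigD1 i)//= /diff_at; case: eqP => _; last by rewrite plateau_at_out ?mul0r// ltW.
by rewrite derive_plateau_at0 ?mul0r//; right.
Qed.

Lemma cutoff_inner (x : Rn) : `|x| <= a -> eta x = 0.
Proof.
move=> h; rewrite /cutoff /inner /outer !tens_in ?subrr//.
by move: a0 ab => ? ?; lra.
Qed.

Lemma cutoff_outer (x : Rn) : 2 * b < `|x| -> eta x = 0.
Proof.
move=> h; rewrite /cutoff /inner /outer !tens_out ?subrr//.
by move: a0 ab => ? ?; lra.
Qed.

Lemma cutoff_one (x : Rn) : 2 * a < `|x| -> `|x| <= b -> eta x = 1.
Proof. by move=> h1 h2; rewrite /cutoff /inner /outer tens_in// tens_out// subr0. Qed.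

Lemma dcutoff_supp j (x : Rn) : deta j x != 0 ->
  a <= `|x| <= 2 * a \/ b <= `|x| <= 2 * b.
Proof.
rewrite /dcutoff /inner /outer => h.
have [xa|xa] := ltP `|x| a.
  move: h; rewrite !dtens_in ?subrr ?eqxx//; by move: a0 ab => ? ?; lra.
have [x2a|x2a] := leP `|x| (2 * a); first by left.
have [xb|xb] := ltP `|x| b.
  by move: h; rewrite (dtens_out _ a0 x2a) dtens_in// subr0 eqxx.
have [x2b|x2b] := leP `|x| (2 * b); first by right.
by move: h; rewrite (dtens_out _ a0 x2a) dtens_out// subr0 eqxx.
Qed.

Lemma dcutoff_bound (D : R) : (forall t, `|derive1 (@plateau R) t| <= D) ->
  forall j (x : Rn), `|deta j x| <= 2 * (D / a).
Proof.
move=> hD j x.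
have D0 : 0 <= D by exact: le_trans (hD 0).
have h s : 0 < s -> `|tens (diff_at (fun=> plateau_at s) j) x| <= D / s.
  move=> s0; rewrite /tens (bigD1 j)//= normrM /diff_at eqxx derive_plateau_at//.
  rewrite normrM normfV (gtr0_norm s0) -[leRHS]mulr1 ler_pM//.
  - by rewrite divr_ge0// ltW.
  - by rewrite ler_wpM2r ?invr_ge0 ?(ltW s0).
  - rewrite normr_prod; apply: prodr_ile1 => i ij; rewrite (negbTE ij).
    by rewrite normr_ge0 ger0_norm ?plateau_at_ge0 ?plateau_at_le1.
rewrite /dcutoff /inner /outer (le_trans (ler_normB _ _))//.
have h1 := h _ a0; have h2 := h _ b0.
have h3 : D / b <= D / a by rewrite ler_wpM2l// lef_pV2 ?posrE//; move: a0 ab => ? ?; lra.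
lra.
Qed.

End annular_cutoff.

(** * Size of the Carleman weight *)

Section auxiliary.
Context {R : realType}.

Lemma sum_sqr_le M (y : 'I_M -> R) : (\sum_q y q) ^+ 2 <= M%:R * \sum_q y q ^+ 2.
Proof.
have : 0 <= \sum_p \sum_q (y p - y q) ^+ 2.
  by apply: sumr_ge0 => p _; apply: sumr_ge0 => q _; exact: sqr_ge0.
have -> : \sum_p \sum_q (y p - y q) ^+ 2 =
    2 * (M%:R * \sum_q y q ^+ 2 - (\sum_q y q) ^+ 2).
  transitivity (\sum_p (M%:R * y p ^+ 2 + \sum_q y q ^+ 2 - 2 * (y p * \sum_q y q))).
    apply: eq_bigr => p _.
    transitivity (\sum_q (y p ^+ 2 + y q ^+ 2 - 2 * (y p * y q))).
      by apply: eq_bigr => q _; ring.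
    rewrite sumrB big_split /= sumr_const card_ord -mulr_sumr -mulr_sumr.
    by rewrite -[_ *+ M]mulr_natl.
  rewrite sumrB big_split /= sumr_const card_ord -!mulr_sumr -mulr_suml.
  by rewrite -[_ *+ M]mulr_natl; ring.
by rewrite pmulr_rge0// subr_ge0.
Qed.

Lemma derive_plateau_bound : exists2 D, 0 <= D & forall t, `|derive1 (@plateau R) t| <= D.
Proof.
have [M hM] := continuous_locally_bounded
  (smooth1_continuous (smooth1_derive (@smooth_plateau R))) 2.
have [_ [C hC]] := bump1_derive (@bump1_plateau R).
have [M' hM'] := continuous_locally_bounded
  (smooth1_continuous (smooth1_derive (@smooth_plateau R))) C.
exists `|M'| => // t; have [tC|tC] := leP `|t| C.
  by rewrite (le_trans (hM' _ tC))// ler_norm.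
by rewrite hC// normr0.
Qed.

(** Used to let the mollification error d tend to 0. *)
Lemma le_of_small (X Y Z N : R) : 0 <= Z -> 0 <= N ->
  (forall d, 0 < d -> N * d ^+ 2 <= 1 / 8 -> X <= Y + Z * d ^+ 2) -> X <= Y.
Proof.
move=> Z0 N0 h; rewrite leNgt; apply/negP => YX.
have Z1 : 0 < 2 * (Z + 1) by lra.
have N1 : 0 < 8 * (N + 1) by lra.
pose d := Num.min 1 (Num.min (8 * (N + 1))^-1 ((X - Y) / (2 * (Z + 1)))).
have d0 : 0 < d by rewrite !lt_min ltr01 invr_gt0 N1/= divr_gt0// subr_gt0.
have d1 : d <= 1 by rewrite ge_min lexx.
have d2 : d <= (8 * (N + 1))^-1 by rewrite !ge_min lexx orbT.
have d3 : d <= (X - Y) / (2 * (Z + 1)) by rewrite !ge_min lexx !orbT.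
have dd : d ^+ 2 <= d by rewrite expr2 ler_piMr// ltW.
have e2 : N * d ^+ 2 <= 1 / 8.
  apply: (@le_trans _ _ (N * (8 * (N + 1))^-1)); first by rewrite ler_wpM2l// (le_trans dd).
  by rewrite ler_pdivrMr//; lra.
have e3 : Z * d ^+ 2 <= (X - Y) / 2.
  apply: (@le_trans _ _ (Z * ((X - Y) / (2 * (Z + 1))))); first by rewrite ler_wpM2l// (le_trans dd).
  rewrite mulrA ler_pdivrMr//.
  have : (X - Y) / 2 * (2 * (Z + 1)) = Z * (X - Y) + (X - Y) by field.
  by move=> ->; rewrite lerDl subr_ge0 ltW.
by have := h d d0 e2; lra.
Qed.

End auxiliary.

Section weights.
Context {R : realType} (n : nat).
Notation Rn := 'rV[R]_n.
Implicit Types (x : Rn) (t tau lam : R).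

Lemma weight_sqr tau lam x :
  weight tau lam x ^+ 2 = expR (tau * (lnr x - lam) ^+ 2 - n%:R * lnr x).
Proof. by rewrite /weight /profile expr2 -expRD; congr expR; field. Qed.

Lemma sqn_expR x : x != 0 -> sqn x = expR (2 * lnr x).
Proof.
move=> x0; rewrite /lnr mulrCA mulfV ?pnatr_eq0// mulr1 lnK// posrE.
exact: sqn_gt0.
Qed.

Lemma lnr_le x t : x != 0 -> 0 < t -> sqn x <= t ^+ 2 -> lnr x <= ln t.
Proof.
move=> x0 t0 h; have s0 := sqn_gt0 x0.
have : ln (sqn x) <= ln (t ^+ 2) by rewrite ler_ln ?posrE// exprn_gt0.
by rewrite lnXn// mulr2n /lnr; lra.
Qed.

Lemma lnr_ge x t : x != 0 -> 0 < t -> t ^+ 2 <= sqn x -> ln t <= lnr x.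
Proof.
move=> x0 t0 h; have s0 := sqn_gt0 x0.
have : ln (t ^+ 2) <= ln (sqn x) by rewrite ler_ln ?posrE// exprn_gt0.
by rewrite lnXn// mulr2n /lnr; lra.
Qed.

(** Since n >= 2, the factor |x|^(2 - n) is at most exp (n e) for log |x| >= - e. *)
Lemma weight_upper tau lam x (rho e : R) : (2 <= n)%N -> 0 <= tau -> 0 < rho -> 0 <= e ->
  - ln rho <= e -> rho <= `|x| -> lnr x <= lam ->
  sqn x * weight tau lam x ^+ 2 <= expR (tau * (lam - ln rho) ^+ 2 + n%:R * e).
Proof.
move=> n2 tau0 rho0 e0 le xr xl.
have x0 : x != 0 by rewrite -normr_gt0 (lt_le_trans rho0).
have lr : ln rho <= lnr x.
  apply: lnr_ge => //; apply: le_trans (sqn_ge x).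
  by rewrite lerXn2r ?nnegrE// ltW.
rewrite weight_sqr sqn_expR// -expRD ler_expR addrCA lerD//.
  rewrite ler_wpM2l// -sqrrN opprB lerXn2r ?nnegrE; lra.
have n2' : 2 <= n%:R :> R by rewrite (ler_nat R 2).
have := mulr_ge0 (_ : 0 <= n%:R - 2 :> R) (_ : 0 <= lnr x + e).
rewrite subr_ge0 n2' => /(_ isT) h.
have /h : 0 <= lnr x + e by lra.
by rewrite mulrDr !mulrBl; lra.
Qed.

Lemma weight_lower tau lam x (t : R) : 0 <= tau -> 0 < t -> x != 0 ->
  sqn x <= t ^+ 2 -> ln t <= lam ->
  expR (tau * (lam - ln t) ^+ 2 - n%:R * ln t) <= weight tau lam x ^+ 2.
Proof.
move=> tau0 t0 x0 xt tl; have lx := lnr_le x0 t0 xt.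
rewrite weight_sqr ler_expR lerB//; last by rewrite ler_wpM2l.
rewrite ler_wpM2l// -[leRHS]sqrrN opprB lerXn2r ?nnegrE; lra.
Qed.

End weights.

(** * The three-annuli inequality *)

Ltac nneg := repeat first
  [exact: sqr_ge0 | assumption | exact: ler0n | exact: expR_ge0 | apply: mulr_ge0].

(** The commutator term lives on the two transition layers of the cutoff, where u is
    bounded by m and B respectively. *)
Lemma error_bound {R : realType} (n M : nat) (K a0 m B a b D : R) (u : 'I_M -> 'rV[R]_n -> R) :
  0 < a -> 2 * a <= b -> 0 <= K -> 0 <= a0 -> 0 <= m -> 0 <= B -> 0 <= D ->
  (forall t, `|derive1 (@plateau R) t| <= D) ->
  (forall q x, `|x| <= 2 * a -> `|u q x| <= m) -> (forall q x, `|u q x| <= B) ->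
  let c := a0 * (n%:R * (M%:R * (2 * (D / a)))) in
  forall x, exists2 E, error (@outer R n b) (@inner R n a) K a0 u x =
      K * (\sum_q `|cutoff (@outer R n b) (@inner R n a) x * u q x|) + E &
    E = 0 \/ [/\ 0 <= E, E <= c * m & a <= `|x| <= 2 * a] \/
             [/\ 0 <= E, E <= c * B & b <= `|x| <= 2 * b].
Proof.
move=> a_gt0 ab K0 a00 m0 B0 D0 hD um uB c x.
pose E := a0 * \sum_j \sum_q `|dcutoff (@outer R n b) (@inner R n a) j x * u q x|.
exists E => //.
have E0 : 0 <= E.
  by rewrite mulr_ge0//; apply: sumr_ge0 => j _; apply: sumr_ge0 => q _.
have bnd (s : R) : 0 <= s -> (forall q, `|u q x| <= s) -> E <= c * s.
  move=> s0 us; rewrite /E /c -mulrA ler_wpM2l//.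
  apply: (@le_trans _ _ (\sum_(j < n) \sum_(q < M) 2 * (D / a) * s)).
    apply: ler_sum => j _; apply: ler_sum => q _; rewrite normrM ler_pM//.
    exact: dcutoff_bound.
  by rewrite !sumr_const !card_ord -[_ *+ M]mulr_natl -[_ *+ n]mulr_natl; lra.
have [h|h] := pselect (exists j, dcutoff (@outer R n b) (@inner R n a) j x != 0); last first.
  left; rewrite /E big1 ?mulr0// => j _; rewrite big1// => q _.
  have -> : dcutoff (@outer R n b) (@inner R n a) j x = 0.
    by apply: contrapT => /eqP hj; apply: h; exists j.
  by rewrite mul0r normr0.
right; have [j /(dcutoff_supp a_gt0 ab)[hj|hj]] := h.
  left; split => //; apply: bnd => // q; apply: um; by have /andP[] := hj.
by right; split => //; exact: bnd.
Qed.

Lemma sqr_le3 {R : realType} (x a b c : R) : `|x| <= a + (b + c) ->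
  x ^+ 2 <= 3 * (a ^+ 2 + (b ^+ 2 + c ^+ 2)).
Proof.
move=> h; have h0 := le_trans (normr_ge0 x) h.
rewrite -real_normK ?num_real//.
apply: (@le_trans _ _ ((a + (b + c)) ^+ 2)); first by rewrite lerXn2r ?nnegrE.
rewrite -subr_ge0 (_ : _ - _ = (a - b) ^+ 2 + (a - c) ^+ 2 + (b - c) ^+ 2); last by ring.
by rewrite !addr_ge0// sqr_ge0.
Qed.

Lemma sum_sqr_absorb {R : realType} (M : nat) (y v : 'I_M -> R) (K e E : R) :
  (forall p, `|y p| <= K * (\sum_q `|v q|) + (e + E)) ->
  \sum_p y p ^+ 2 <= 3 * M%:R * (K ^+ 2 * (M%:R * \sum_q v q ^+ 2)) +
    (3 * M%:R * e ^+ 2 + 3 * M%:R * E ^+ 2).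
Proof.
move=> h.
have V2 : (\sum_q `|v q|) ^+ 2 <= M%:R * \sum_q v q ^+ 2.
  apply: (le_trans (sum_sqr_le _)); rewrite ler_wpM2l// ler_sum// => q _.
  by rewrite real_normK ?num_real.
apply: (le_trans (ler_sum _ (fun p _ => sqr_le3 (h p)))).
rewrite sumr_const card_ord -[_ *+ M]mulr_natl exprMn.
have := ler_wpM2l (mulr_ge0 (mulr_ge0 (ler0n R 3) (ler0n R M)) (sqr_ge0 K)) V2.
by move: (M%:R) (K ^+ 2) (\sum_q v q ^+ 2) ((\sum_q `|v q|) ^+ 2) (e ^+ 2) (E ^+ 2) => *; lra.
Qed.

(** The mollified cut-off field lives where `|x| <= 4 r + 1 <= 5 r, so its
    Euclidean distance to the centre is at most 5 sqrt n r <= 8 n r = exp lam: this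
    is the range where the weight decreases with the distance. *)
Lemma annulus_weights {R : realType} (n : nat) (r tau : R) (x : 'rV[R]_n) :
  (2 <= n)%N -> 1 <= r -> 0 <= tau ->
  let a := (4 * n%:R)^-1 in let lam := ln (8 * n%:R * r) in
  a / 2 <= `|x| -> `|x| <= 4 * r + 1 ->
  [/\ sqn x <= 25 * n%:R * r ^+ 2,
   sqn x * weight tau lam x ^+ 2 <= expR (tau * (lam - ln (a / 2)) ^+ 2 + n%:R * ln (8 * n%:R)),
   a <= `|x| ->
     sqn x * weight tau lam x ^+ 2 <= expR (tau * (lam - ln a) ^+ 2 + n%:R * ln (4 * n%:R)) &
   2 * r <= `|x| -> sqn x * weight tau lam x ^+ 2 <= expR (tau * (lam - ln (2 * r)) ^+ 2)].
Proof.
move=> n2 r1 tau0 a lam xa xr.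
have N2 : (2 : R) <= n%:R by rewrite (ler_nat R 2 n).
have a_gt0 : 0 < a by rewrite invr_gt0; lra.
have a2 : 0 < a / 2 by rewrite divr_gt0.
have x0 : x != 0 by rewrite -normr_gt0 (lt_le_trans a2).
have sx : sqn x <= 25 * n%:R * r ^+ 2.
  apply: (le_trans (sqn_le x)).
  have : `|x| ^+ 2 <= (5 * r) ^+ 2 by rewrite lerXn2r ?nnegrE//; lra.
  by move=> /(ler_wpM2l (ler0n R n)); rewrite exprMn; lra.
have lx : lnr x <= lam.
  apply: lnr_le => //; first by rewrite !mulr_gt0//; lra.
  apply: (le_trans sx); rewrite !exprMn.
  have : n%:R <= n%:R ^+ 2 :> R by rewrite expr2 ler_peMr//; lra.
  by move=> /(ler_wpM2r (sqr_ge0 r)) h; have := mulr_ge0 (ler0n R n) (sqr_ge0 r); lra.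
split => //.
- apply: weight_upper => //; first by apply: ln_ge0; lra.
  by rewrite -lnV ?posrE// invfM !invrK (_ : 4 * n%:R * 2 = 8 * n%:R)//; ring.
- move=> xa1; apply: weight_upper => //; first by apply: ln_ge0; lra.
  by rewrite -lnV ?posrE// invrK.
- move=> xr1; rewrite -[tau * _]addr0 -(mulr0 n%:R); apply: weight_upper => //; first lra.
  by rewrite oppr_le0; apply: ln_ge0; lra.
Qed.

(** The Carleman inequality for the mollification at scale d of the cut-off field.
    Splitting D v into potential, mollification and cutoff terms costs a factor
    3 M, and the potential part is bounded by
    3 M K^2 M * 25 n r^2 <= tau times |v|^2, that is half of the left-hand side. *)
Lemma annuli_delta {R : realType} (n M : nat) (A : 'I_n -> 'M[R]_M) (cA : clifford A)
    (u H : 'I_M -> 'rV[R]_n -> R) (K a0 B m r sigma tau D d : R) (z0 : 'rV[R]_n) :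
  (2 <= n)%N -> (forall q, continuous (u q)) -> dominated u H K -> 0 <= K ->
  (forall j p q, `|A j p q| <= a0) -> 0 <= a0 -> weak_dirac A u H ->
  0 <= B -> (forall q x, `|u q x| <= B) ->
  0 <= D -> (forall t, `|derive1 (@plateau R) t| <= D) ->
  1 <= r -> 0 <= m ->
  let a := (4 * n%:R)^-1 in
  (forall q x, `|x| <= 2 * a -> `|u q x| <= m) ->
  let lam := ln (8 * n%:R * r) in
  let c := a0 * (n%:R * (M%:R * (2 * (D / a)))) in
  75 * n%:R * M%:R ^+ 2 * K ^+ 2 * r ^+ 2 <= tau -> 0 < tau ->
  0 < sigma ->
  (forall z, `|z - z0| <= sigma -> [/\ 2 * a < `|z|, `|z| <= 2 * r,
     sqn z <= (5 / 4 * r) ^+ 2 & 1 / 2 <= \sum_q u q z ^+ 2]) ->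
  0 < d -> M%:R * d ^+ 2 <= 1 / 8 ->
  tau / 8 * (2 * sigma) ^+ n *
    expR (tau * (lam - ln (5 / 4 * r)) ^+ 2 - n%:R * ln (5 / 4 * r)) <=
  3 * M%:R * (c ^+ 2 * m ^+ 2 * expR (tau * (lam - ln a) ^+ 2 + n%:R * ln (4 * n%:R)) * (4 * a) ^+ n +
            c ^+ 2 * B ^+ 2 * expR (tau * (lam - ln (2 * r)) ^+ 2) * (8 * r) ^+ n) +
  3 * M%:R * (K * M%:R + 1) ^+ 2 *
    expR (tau * (lam - ln (a / 2)) ^+ 2 + n%:R * ln (8 * n%:R)) * (2 * (4 * r + 1)) ^+ n * d ^+ 2.
Proof.
move=> n2 cu dH K0 aA a00 wu B0 uB D0 hD r1 m0 a um lam c tauK tau0 sg0 hz d0 dM.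
have N2 : (2 : R) <= n%:R by rewrite (ler_nat R 2 n).
have a_gt0 : 0 < a by rewrite invr_gt0; lra.
have aN : a * (4 * n%:R) = 1 by rewrite mulVf// gt_eqF//; lra.
have a8 : a <= 1 / 8.
  have : a * (4 * 2) <= a * (4 * n%:R) by rewrite ler_wpM2l ?(ltW a_gt0)//; lra.
  by rewrite aN; lra.
have a2 : 0 < a / 2 by lra.
have ab : 2 * a <= 2 * r by lra.
have b1 := @bump1_outer R n _ _ a_gt0 ab; have b2 := @bump1_inner R n _ a_gt0.
have [v [Kv vd vs dv]] := mollify b1 b2 cu dH aA wu d0 a2.
set eta := cutoff (@outer R n (2 * r)) (@inner R n a) in vd vs *.
have v_in q x : `|x| < a / 2 -> v q x = 0.
  move=> xa; apply: vs => y yx; apply: cutoff_inner => //.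
  by have := ler_normD (y - x) x; rewrite subrK; lra.
have v_out q x : 4 * r + 1 < `|x| -> v q x = 0.
  move=> xr; apply: vs => y yx; apply: cutoff_outer => //.
  by have := lerB_dist x y; rewrite [`|x - y|]distrC; lra.
have Cv q : C1c0 (a / 2) (v q) by split; [exact: Kv|split => // x; exact: v_in].
have [bF2 carl] := carleman cA tau lam Cv.
pose W2 (x : 'rV[R]_n) : R := weight tau lam x ^+ 2.
have W20 x : 0 <= W2 x by exact: sqr_ge0.
pose F1 x := W2 x * \sum_p v p x ^+ 2.
pose F2 x := W2 x * (sqn x * \sum_p dirac_real A v p x ^+ 2).
have bF1 : bcs F1.
  have -> : F1 = fun x => \sum_p (weight tau lam x * v p x) * (weight tau lam x * v p x).
    by apply/funext => x; rewrite /F1 mulr_sumr; apply: eq_bigr => p _; rewrite /W2; ring.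
  apply: bcs_sum => p _; have := C1c0_bcs (C1c0_coef (coef_weight n tau lam) (Cv p)).
  by move=> bw; exact: bcsM.
have F10 x : 0 <= F1 x by rewrite mulr_ge0//; apply: sumr_ge0 => p _; exact: sqr_ge0.
pose wS := expR (tau * (lam - ln (a / 2)) ^+ 2 + n%:R * ln (8 * n%:R)).
pose w1 := expR (tau * (lam - ln a) ^+ 2 + n%:R * ln (4 * n%:R)).
pose w2 := expR (tau * (lam - ln (2 * r)) ^+ 2).
pose k2 := K * M%:R + 1.
pose cube (s : R) : 'rV[R]_n -> R := \1_[set x : 'rV[R]_n | `|x - 0| <= s].
have cube_ge0 s x : 0 <= cube s x by rewrite /cube indicE; case: (_ \in _).
have cube1 s x : `|x| <= s -> cube s x = 1 by move=> h; rewrite /cube indicE mem_set//= subr0.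
pose G3 x := tau * F1 x + (3 * M%:R * k2 ^+ 2 * wS * d ^+ 2 * cube (4 * r + 1) x +
   (3 * M%:R * c ^+ 2 * m ^+ 2 * w1 * cube (2 * a) x + 3 * M%:R * c ^+ 2 * B ^+ 2 * w2 * cube (4 * r) x)).
have M0 : (0 : R) <= M%:R by exact: ler0n.
have [wS0 w10 w20] : [/\ 0 <= wS, 0 <= w1 & 0 <= w2] by split; exact: expR_ge0.
have k1 : 0 <= 3 * M%:R * k2 ^+ 2 * wS * d ^+ 2 by nneg.
have k3 : 0 <= 3 * M%:R * c ^+ 2 * m ^+ 2 * w1 by nneg.
have k4 : 0 <= 3 * M%:R * c ^+ 2 * B ^+ 2 * w2 by nneg.
have Dp p x E : error (@outer R n (2 * r)) (@inner R n a) K a0 u x =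
      K * (\sum_q `|eta x * u q x|) + E ->
    `|dirac_real A v p x| <= K * (\sum_q `|v q x|) + (k2 * d + E).
  move=> eE; apply: (le_trans (dv p x)); rewrite eE /k2.
  have : \sum_q `|eta x * u q x| <= \sum_q `|v q x| + M%:R * d.
    apply: (@le_trans _ _ (\sum_q (`|v q x| + d))).
      apply: ler_sum => q _; have := vd q x; rewrite distrC => h.
      have := ler_distD (v q x) (eta x * u q x) 0; rewrite !subr0.
      by move=> /le_trans; apply; rewrite addrC lerD.
    by rewrite big_split/= sumr_const card_ord mulr_natl.
  move=> /(ler_wpM2l K0) h; rewrite mulrDr in h.
  rewrite -addrA [E + d]addrC addrA; apply: (le_trans (lerD (lerD h (lexx d)) (lexx E))).
  by rewrite mulrDl mul1r !addrA mulrA.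
have F2G x : F2 x <= G3 x.
  have G0 : 0 <= G3 x.
    by rewrite /G3; repeat first [exact: F10 | exact: cube_ge0 | assumption |
      exact: (ltW tau0) | apply: addr_ge0 | apply: mulr_ge0].
  have zero (y : 'rV[R]_n) j p : (a / 2 <= `|y| <= 4 * r + 1) = false -> partial j (v p) y = 0.
    move=> /negbT; rewrite negb_and -!ltNge => /orP[h|h].
      by have [_ vp] := Cv p; have [_ vz] := vanish_partial j vp; exact: vz.
    have [_ e] := @supp_partial _ _ (v p) (4 * r + 1) j (v_out p) y h.
    exact: e.
  have [/andP[xa xr]|xS] := boolP (a / 2 <= `|x| <= 4 * r + 1); last first.
    rewrite /F2 big1 ?mulr0// => p _; rewrite /dirac_real big1 ?expr0n// => j _.
    by rewrite big1// => q _; rewrite zero ?mulr0//; exact: negbTE.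
  have x0 : x != 0 by rewrite -normr_gt0 (lt_le_trans a2).
  have [sx hS h1 h2] := annulus_weights n2 r1 (ltW tau0) xa xr.
  have [E eE hE] := error_bound a_gt0 ab K0 a00 m0 B0 D0 hD um uB x.
  have SD : \sum_p dirac_real A v p x ^+ 2 <= _ :=
    sum_sqr_absorb (fun p => Dp p x E eE).
  have s0 : 0 <= sqn x by rewrite ltW// sqn_gt0.
  have sW0 : 0 <= sqn x * W2 x by rewrite mulr_ge0.
  rewrite /F2 mulrA [W2 x * _]mulrC.
  apply: (le_trans (ler_wpM2l sW0 SD)); rewrite !(mulrDr (sqn x * W2 x)).
  have p3 (y : R) : 0 <= 3 * M%:R * y ^+ 2 by nneg.
  apply: lerD; last apply: lerD.
  - set S2 := \sum_q _.
    have S20 : 0 <= S2 by apply: sumr_ge0 => q _; exact: sqr_ge0.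
    have -> : tau * F1 x = W2 x * (tau * S2) by rewrite /F1 mulrCA.
    pose Y := 3 * M%:R * (K ^+ 2 * (M%:R * S2)); have p2 : 0 <= Y by nneg.
    have -> : sqn x * W2 x * Y = W2 x * (sqn x * Y) by ring.
    rewrite ler_wpM2l//.
    apply: (le_trans (ler_wpM2r p2 sx)); apply: le_trans (ler_wpM2r S20 tauK).
    by rewrite le_eqVlt; apply/orP; left; apply/eqP; rewrite /Y; ring.
  - rewrite cube1// mulr1; apply: (le_trans (ler_wpM2r (p3 _) hS)).
    by rewrite le_eqVlt; apply/orP; left; apply/eqP; rewrite /wS; ring.
  - case: hE => [->|[[E0 Em /andP[xa1 xa2]]|[E0 EB /andP[xr1 xr2]]]].
    + by rewrite expr0n/= !mulr0 addr_ge0// mulr_ge0// cube_ge0.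
    + apply: ler_wpDr; first by rewrite mulr_ge0// cube_ge0.
      rewrite cube1// mulr1.
      have E2 : E ^+ 2 <= (c * m) ^+ 2 by rewrite lerXn2r ?nnegrE// (le_trans E0).
      apply: (le_trans (ler_pM sW0 (p3 E) (h1 xa1) (ler_wpM2l (mulr_ge0 (ler0n R 3) M0) E2))).
      by rewrite le_eqVlt; apply/orP; left; apply/eqP; rewrite /w1; ring.
    + apply: ler_wpDl; first by rewrite mulr_ge0// cube_ge0.
      rewrite cube1 ?mulr1; last by apply: (le_trans xr2); rewrite mulrA (_ : 2 * 2 = 4)//; ring.
      have E2 : E ^+ 2 <= (c * B) ^+ 2 by rewrite lerXn2r ?nnegrE// (le_trans E0).
      apply: (le_trans (ler_pM sW0 (p3 E) (h2 xr1) (ler_wpM2l (mulr_ge0 (ler0n R 3) M0) E2))).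
      by rewrite le_eqVlt; apply/orP; left; apply/eqP; rewrite /w2; ring.
have bcube s : bcs (cube s) by exact: bcs_cube.
have Icube (s : R) : 0 <= s -> Int (cube s) = (2 * s) ^+ n by exact: Int_cube.
have IF2 : Int F2 <= tau * Int F1 + (3 * M%:R * k2 ^+ 2 * wS * d ^+ 2 * (2 * (4 * r + 1)) ^+ n +
   (3 * M%:R * c ^+ 2 * m ^+ 2 * w1 * (4 * a) ^+ n + 3 * M%:R * c ^+ 2 * B ^+ 2 * w2 * (8 * r) ^+ n)).
  have -> : 4 * a = 2 * (2 * a) by ring.
  have -> : 8 * r = 2 * (4 * r) by ring.
  have a2' : 0 <= 2 * a by rewrite mulr_ge0// ltW.
  have r4 : 0 <= 4 * r by rewrite mulr_ge0// (le_trans _ r1).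
  have r5 : 0 <= 4 * r + 1 by rewrite addr_ge0.
  rewrite -(Icube _ a2') -(Icube _ r4) -(Icube _ r5).
  rewrite -!(IntZ _ (bcube _)) -(IntZ _ bF1).
  have bZ s k : bcs (fun x => k * cube s x) by exact: bcsZ.
  have bZ1 := bcsZ tau bF1.
  rewrite -(IntD (bZ _ _) (bZ _ _)) -(IntD (bZ _ _) (bcsD (bZ _ _) (bZ _ _))).
  rewrite -(IntD bZ1 (bcsD (bZ _ _) (bcsD (bZ _ _) (bZ _ _)))).
  apply: le_Int => //.
  by apply: (bcsD bZ1 (bcsD (bZ _ _) (bcsD (bZ _ _) (bZ _ _)))).
pose L := expR (tau * (lam - ln (5 / 4 * r)) ^+ 2 - n%:R * ln (5 / 4 * r)) / 8.
have IF1 : L * (2 * sigma) ^+ n <= Int F1.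
  rewrite -(@Int_cube _ _ z0 sigma (ltW sg0)) -IntZ; last exact: bcs_cube.
  apply: le_Int => //; first by apply: bcsZ; exact: bcs_cube.
  move=> x; rewrite indicE; have [|] := boolP (_ \in _); last by rewrite mulr0 F10.
  rewrite inE/= mulr1 => /hz[z1 z2 z3 z4].
  have x0 : x != 0 by rewrite -normr_gt0 (lt_trans _ z1)// mulr_gt0.
  have r0 : 0 < r by exact: lt_le_trans r1.
  have t0 : 0 < 5 / 4 * r by rewrite mulr_gt0.
  have tl : ln (5 / 4 * r) <= lam.
    rewrite ler_ln ?posrE//; last by rewrite !mulr_gt0//; clear -N2; lra.
    by rewrite ler_wpM2r ?(ltW r0)//; clear -N2; lra.
  have hw := weight_lower (ltW tau0) t0 x0 z3 tl.
  rewrite /L /F1 ler_pM ?expR_ge0//.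
  have hu : \sum_q u q x ^+ 2 <= \sum_q (2 * v q x ^+ 2 + 2 * d ^+ 2).
    apply: ler_sum => q _; have := vd q x.
    rewrite /eta (cutoff_one a_gt0 ab z1 z2) mul1r => h.
    have h2 : (v q x - u q x) ^+ 2 <= d ^+ 2.
      by rewrite -real_normK ?num_real// lerXn2r ?nnegrE// ltW.
    have := sqr_ge0 (2 * v q x - u q x).
    rewrite -subr_ge0 in h2; rewrite -subr_ge0.
    move=> h3; rewrite (_ : _ - _ = (2 * v q x - u q x) ^+ 2 + 2 * (d ^+ 2 - (v q x - u q x) ^+ 2)).
      by rewrite addr_ge0// mulr_ge0.
    by ring.
  move: hu; rewrite big_split/= sumr_const card_ord -mulr_sumr -[_ *+ M]mulr_natl; clear -dM z4; lra.
have := le_trans carl IF2; rewrite -/F1 => fin.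
have {}fin : tau * (L * (2 * sigma) ^+ n) <= 3 * M%:R * k2 ^+ 2 * wS * d ^+ 2 * (2 * (4 * r + 1)) ^+ n +
   (3 * M%:R * c ^+ 2 * m ^+ 2 * w1 * (4 * a) ^+ n + 3 * M%:R * c ^+ 2 * B ^+ 2 * w2 * (8 * r) ^+ n).
  apply: (le_trans (ler_wpM2l (ltW tau0) IF1)); clear -fin; lra.
rewrite (_ : tau / 8 * _ * _ = tau * (L * (2 * sigma) ^+ n)); last by rewrite /L; ring.
apply: (le_trans fin); rewrite le_eqVlt; apply/orP; left; apply/eqP.
by rewrite -/w1 -/w2 -/wS -/k2; ring.
Qed.

(** [annuli_delta] translated by x0, with d tending to 0. The cube of radius
    2 a = 1 / (2 n) has Euclidean radius less than 1, so u is bounded by m there. The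
    cube of radius sigma around the origin, before translation, is within Euclidean distance
    5/4 r of x0 because sigma n <= 1/8. *)
Lemma annuli {R : realType} (n M : nat) (A : 'I_n -> 'M[R]_M) (cA : clifford A)
    (u H : 'I_M -> 'rV[R]_n -> R) (K a0 B m r sigma D : R) (x0 : 'rV[R]_n) :
  let tau0 := 75 * n%:R * M%:R ^+ 2 * K ^+ 2 + 1 in
  let tau := tau0 * r ^+ 2 in
  let a := (4 * n%:R)^-1 in
  let lam := ln (8 * n%:R * r) in
  let c := a0 * (n%:R * (M%:R * (2 * (D / a)))) in
  (2 <= n)%N -> (forall q, continuous (u q)) -> dominated u H K -> 0 <= K ->
  (forall j p q, `|A j p q| <= a0) -> 0 <= a0 -> weak_dirac A u H ->
  0 <= B -> (forall q x, `|u q x| <= B) ->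
  0 <= D -> (forall t, `|derive1 (@plateau R) t| <= D) ->
  n%:R <= r -> sqn x0 = r ^+ 2 -> 0 <= m ->
  (forall y, sqn (y - x0) < 1 -> forall q, `|u q y| <= m) ->
  0 < sigma -> sigma * n%:R <= 1 / 8 ->
  (forall y, `|y| <= sigma -> 1 / 2 <= \sum_q u q y ^+ 2) ->
  tau / 8 * (2 * sigma) ^+ n *
    expR (tau * (lam - ln (5 / 4 * r)) ^+ 2 - n%:R * ln (5 / 4 * r)) <=
  3 * M%:R * (c ^+ 2 * m ^+ 2 * expR (tau * (lam - ln a) ^+ 2 + n%:R * ln (4 * n%:R)) * (4 * a) ^+ n +
            c ^+ 2 * B ^+ 2 * expR (tau * (lam - ln (2 * r)) ^+ 2) * (8 * r) ^+ n).
Proof.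
move=> tau0 tau a lam c n2 cu dH K0 aA a00 wu B0 uB D0 hD nr sx0 m0 um sg0 sgn hs.
have N2 : (2 : R) <= n%:R by rewrite (ler_nat R 2 n).
have r2 : 2 <= r by exact: le_trans nr.
have r1 : 1 <= r by lra.
have sg16 : sigma <= 1 / 16.
  have : sigma * 2 <= sigma * n%:R by rewrite ler_wpM2l// ltW.
  by lra.
have x0r : `|x0| <= r.
  have := sqn_ge x0; rewrite sx0 => h.
  by rewrite -(ler_pXn2r (ltn0Sn 1)) ?nnegrE//; lra.
have x01 : 1 <= `|x0|.
  rewrite -(ler_pXn2r (ltn0Sn 1)) ?nnegrE// expr1n.
  have := sqn_le x0; rewrite sx0 => h.
  have nrr : n%:R * 1 <= n%:R * `|x0| ^+ 2.
    apply: le_trans h; rewrite mulr1 (le_trans nr)// expr2 ler_peMl//; lra.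
  by rewrite ler_pM2l in nrr; lra.
have a_gt0 : 0 < a by rewrite invr_gt0; lra.
have aN : a * (4 * n%:R) = 1 by rewrite mulVf// gt_eqF//; lra.
have a8 : a <= 1 / 8.
  have : a * (4 * 2) <= a * (4 * n%:R) by rewrite ler_wpM2l ?(ltW a_gt0)//; lra.
  by rewrite aN; lra.
have tau1 : 1 <= tau0 by rewrite lerDr; nneg.
have tau_gt0 : 0 < tau by rewrite mulr_gt0 ?exprn_gt0//; lra.
have wus := weak_dirac_shift x0 cu dH wu.
have dHs : dominated (fun q y => u q (x0 + y)) (fun q y => H q (x0 + y)) K.
  move=> p; have [mH bH] := dH p; split => [|y]; last exact: bH.
  exact: (measurableT_comp mH (measurable_shift _)).
have cus q : continuous (fun y => u q (x0 + y)).
  move=> y; apply: (@continuous_comp _ _ _ (fun y : 'rV[R]_n => x0 + y) (u q) y); last exact: cu.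
  have h1 : continuous (fun _ : 'rV[R]_n => x0) by exact: cst_continuous.
  have h2 : continuous (fun y : 'rV[R]_n => y) by move=> z; exact: cvg_id.
  exact: (cvgD (h1 y) (h2 y)).
have ums q (x : 'rV[R]_n) : `|x| <= 2 * a -> `|u q (x0 + x)| <= m.
  move=> xa; apply: um; rewrite addrAC subrr add0r.
  have h : `|x| ^+ 2 <= (2 * a) ^+ 2 by rewrite lerXn2r ?nnegrE// mulr_ge0// ltW.
  have := sqn_le x; have := ler_wpM2l (ler0n R n) h => h1 h2.
  apply: (le_lt_trans h2); apply: (le_lt_trans h1).
  have -> : n%:R * (2 * a) ^+ 2 = a * (a * (4 * n%:R)) by ring.
  by rewrite aN mulr1; lra.
have hz z : `|z - - x0| <= sigma -> [/\ 2 * a < `|z|, `|z| <= 2 * r,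
     sqn z <= (5 / 4 * r) ^+ 2 & 1 / 2 <= \sum_q u q (x0 + z) ^+ 2].
  rewrite opprK => zs; split.
  - by have := lerB_dist x0 (- z); rewrite opprK normrN [x0 + z]addrC; lra.
  - by have := ler_normB (z + x0) x0; rewrite addrK; lra.
  - have : sqn z <= \sum_(i < n) (x0 0 i ^+ 2 + (sigma ^+ 2 + 2 * (r * sigma))).
      apply: ler_sum => i _.
      have y1 : `|(z + x0) 0 i| <= sigma by exact: le_trans (coord_le_norm _ _) zs.
      have y2 : `|x0 0 i| <= r by exact: le_trans (coord_le_norm _ _) x0r.
      have -> : z 0 i = (z + x0) 0 i - x0 0 i by rewrite mxE addrK.
      set y := (z + x0) 0 i in y1 *; set w := x0 0 i in y2 *.
      have y3 : y ^+ 2 <= sigma ^+ 2 by rewrite -real_normK ?num_real// lerXn2r ?nnegrE// ltW.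
      have : `|w * y| <= r * sigma by rewrite normrM ler_pM.
      rewrite ler_norml => /andP[y4 _].
      rewrite (_ : (y - w) ^+ 2 = w ^+ 2 + (y ^+ 2 + 2 * - (w * y))); last by ring.
      by rewrite lerD2l lerD// ler_wpM2l// lerNl.
    rewrite big_split/= -/(sqn x0) sx0 sumr_const card_ord -[_ *+ n]mulr_natl => h.
    apply: (le_trans h).
    have e1 : n%:R * (sigma ^+ 2 + 2 * (r * sigma)) = (sigma * n%:R) * (sigma + 2 * r) by ring.
    have e2 : (sigma * n%:R) * (sigma + 2 * r) <= 1 / 8 * (1 / 16 + 2 * r).
      by apply: ler_pM => //; [rewrite mulr_ge0// ltW|lra|lra].
    have e3 : r <= r ^+ 2 by rewrite expr2 ler_peMl//; lra.
    by rewrite e1 exprMn; lra.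
  - by apply: hs; rewrite addrC.
apply: (@le_of_small _ _ _ _ M%:R _ (ler0n R M)); last first.
  move=> d d0 dM.
  apply: (@annuli_delta R n M A cA (fun q y => u q (x0 + y)) (fun p y => H p (x0 + y))
    K a0 B m r sigma tau D d (- x0) n2 cus dHs K0 aA a00 wus B0 _ D0 hD r1 m0 ums _ tau_gt0 sg0 hz d0 dM).
  - by move=> q x; exact: uB.
  - by rewrite /tau /tau0 ler_wpM2r ?sqr_ge0// lerDl.
have rn : 0 <= (2 * (4 * r + 1)) ^+ n by rewrite exprn_ge0//; lra.
by apply: mulr_ge0 => //; nneg.
Qed.

(** * Lower bound for real systems *)

(** As tau >= r^2, the exponential dominates (r^2 delta)^(n+1) / (n+1)!, one power
    of r^2 above the polynomial on the left. *)
Lemma polynomial_le_expR {R : realType} (n : nat) (e g delta : R) :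
  0 <= e -> 0 < g -> 0 < delta -> exists2 Q, 0 <= Q & forall r tau, 1 <= r -> Q <= r ->
  r ^+ 2 <= tau -> e * ((8 * r) ^+ n * (2 * r) ^+ n) <= g * expR (tau * delta).
Proof.
move=> e0 g0 d0.
pose F : R := (n.+1)`!%:R; have F0 : 0 < F by rewrite ltr0n fact_gt0.
have gd : 0 < g * delta ^+ n.+1 by rewrite mulr_gt0// exprn_gt0.
exists (e * 16 ^+ n * F / (g * delta ^+ n.+1)).
  by rewrite divr_ge0 ?(ltW gd)// !mulr_ge0// ?exprn_ge0// ltW.
move=> r tau r1 Qr rt; have r0 : 0 <= r by lra.
have rd : 0 <= r ^+ 2 * delta by rewrite mulr_ge0 ?sqr_ge0// ltW.
have h1 : r ^+ 2 * delta <= tau * delta by rewrite ler_wpM2r// ltW.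
apply: (@le_trans _ _ (g * expR (r ^+ 2 * delta))); last by rewrite ler_wpM2l ?ler_expR// ltW.
have h2 := expR_ge1Dxn n rd.
apply: (@le_trans _ _ (g * ((r ^+ 2 * delta) ^+ n.+1 / F))); last first.
  by rewrite ler_wpM2l ?(ltW g0)//; lra.
rewrite ler_pdivrMr in Qr => //.
have rr : r <= r ^+ 2 by rewrite expr2 ler_peMl.
have p0 : 0 <= (r ^+ 2) ^+ n by rewrite exprn_ge0// sqr_ge0.
have -> : (8 * r) ^+ n * (2 * r) ^+ n = 16 ^+ n * (r ^+ 2) ^+ n.
  by rewrite -!exprMn; congr (_ ^+ n); ring.
rewrite [leRHS]mulrA ler_pdivlMr//.
rewrite (_ : _ * F = (e * 16 ^+ n * F) * (r ^+ 2) ^+ n); last by ring.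
apply: (le_trans (ler_wpM2r p0 Qr)).
have -> : g * (r ^+ 2 * delta) ^+ n.+1 = r ^+ 2 * (g * delta ^+ n.+1) * (r ^+ 2) ^+ n.
  by rewrite exprMn [(r ^+ 2) ^+ n.+1]exprS; ring.
by rewrite ler_wpM2r// ler_wpM2r// ltW.
Qed.

(** Square root of the hypothesis: r^(-2n) costs exp (-2 n log r), which is part of
    exp (- r^2 (log r)^2). *)
Lemma lower_bound_shape {R : realType} (n : nat) (g e1 tau0 r m l : R) :
  0 < g -> 0 < e1 -> 0 <= tau0 -> 0 <= m -> 2 <= r -> 1 <= ln r -> 0 <= l -> l <= 2 * ln r ->
  g / (2 * r) ^+ n <= e1 * m ^+ 2 * expR (tau0 * r ^+ 2 * l ^+ 2) ->
  Num.sqrt (g / e1) * expR (- (2 * tau0 + n%:R) * r ^+ 2 * (ln r) ^+ 2) <= m.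
Proof.
move=> g0 e10 t0 m0 r2 lr l0 l2 h.
have r0 : 0 < r by lra.
rewrite -[leRHS]ger0_norm// -sqrtr_sqr -[X in _ * X <= _]ger0_norm ?expR_ge0// -sqrtr_sqr.
rewrite -sqrtrM ?divr_ge0 ?(ltW g0) ?(ltW e10)//.
apply: ler_wsqrtr.
rewrite expr2 -expRD mulrAC ler_pdivrMr// [leRHS]mulrC.
have lr2 : 1 <= ln r ^+ 2 by rewrite expr_ge1//; lra.
have rr2 : 1 <= r ^+ 2 by rewrite expr_ge1//; lra.
have q1 : expR (- (n%:R * (2 * ln r))) <= ((2 * r) ^+ n)^-1.
  rewrite expRN lef_pV2 ?posrE ?expR_gt0 ?exprn_gt0 ?mulr_gt0//.
  have e2 : expR (2 * ln r) = r ^+ 2 by rewrite (expRM_natl 2) lnK.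
  rewrite expRM_natl e2.
  by rewrite lerXn2r ?nnegrE ?sqr_ge0 ?mulr_ge0 ?(ltW r0)// expr2 ler_wpM2r// ltW.
have q2 : ln r <= r ^+ 2 * ln r ^+ 2.
  rewrite -[leLHS]mul1r ler_pM//; first by lra.
  by rewrite expr2 ler_peMl//; lra.
have q3 : l ^+ 2 <= 4 * ln r ^+ 2.
  by rewrite (_ : 4 * _ = (2 * ln r) ^+ 2) ?lerXn2r ?nnegrE//; [lra|ring].
set y := r ^+ 2 * ln r ^+ 2.
have q4 : tau0 * r ^+ 2 * l ^+ 2 <= tau0 * (4 * y).
  by rewrite -mulrA ler_wpM2l// /y [leRHS]mulrCA ler_wpM2l ?sqr_ge0.
have q5 : expR (- (n%:R * (2 * y))) <= ((2 * r) ^+ n)^-1.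
  apply: le_trans q1; rewrite ler_expR lerN2 ler_wpM2l// ler_wpM2l//.
have h2 : g * expR (- (n%:R * (2 * y))) <= e1 * m ^+ 2 * expR (tau0 * (4 * y)).
  apply: (le_trans (ler_wpM2l (ltW g0) q5)); apply: (le_trans h).
  by rewrite ler_wpM2l ?ler_expR// mulr_ge0 ?sqr_ge0// ltW.
have h3 := ler_wpM2r (expR_ge0 (- (tau0 * (4 * y)))) h2.
rewrite -!mulrA -!expRD subrr expR0 mulr1 in h3.
apply: le_trans h3; rewrite le_eqVlt; apply/orP; left; apply/eqP.
by congr (_ * expR _); rewrite /y; ring.
Qed.

Lemma continuous_sum_sqr {R : realType} (n M : nat) (u : 'I_M -> 'rV[R]_n -> R) :
  (forall q, continuous (u q)) -> continuous (fun y => \sum_q u q y ^+ 2).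
Proof.
move=> cu y; apply: (cvg_big _ (nbhs_filter y)) => [|q _]; first exact: add_continuous.
exact: (cvgM (cu q y) (cu q y)).
Qed.

Lemma near_sum_sqr {R : realType} (n M : nat) (u : 'I_M -> 'rV[R]_n -> R) :
  (forall q, continuous (u q)) -> \sum_q u q 0 ^+ 2 = 1 ->
  exists2 s : R, 0 < s & forall y, `|y| <= s -> 1 / 2 <= \sum_q u q y ^+ 2.
Proof.
move=> cu u0; pose S (y : 'rV[R]_n) := \sum_q u q y ^+ 2.
have cS : continuous S := continuous_sum_sqr cu.
have h0 : (0 : R) < 1 / 2 by lra.
have /cvgrPdist_lt/(_ _ h0) := cS 0.
move=> /nbhs_ballP[e /= e0 he].
exists (e / 2) => [|y ye]; first by rewrite divr_gt0.
have /he : ball (0 : 'rV[R]_n) e y by rewrite -ball_normE/= sub0r normrN; lra.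
by rewrite /= {1}/S u0 ltr_norml -/(S y); lra.
Qed.

(** The gap between the exponents at L1 and L2 pays for the outer layer with half of
    the left-hand side; the other half stays above g / (2 r)^n. *)
Lemma absorb_outer {R : realType} (n : nat) (g e e1 r tau L1 L2 t m2 l : R) :
  0 < g -> 0 <= e -> 0 <= e1 -> 1 <= r -> 1 <= tau -> 0 <= m2 -> 0 < t -> t <= 2 * r ->
  L2 ^+ 2 <= L1 ^+ 2 ->
  e * ((8 * r) ^+ n * (2 * r) ^+ n) <= g * expR (tau * (L1 ^+ 2 - L2 ^+ 2)) ->
  tau * (2 * g) * expR (tau * L1 ^+ 2 - n%:R * ln t) <=
    e1 * m2 * expR (tau * l ^+ 2) + e * expR (tau * L2 ^+ 2) * (8 * r) ^+ n ->
  g / (2 * r) ^+ n <= (e1 + 1) * m2 * expR (tau * l ^+ 2).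
Proof.
move=> g0 e0 e10 r1 tau1 m20 t0 tr L12 he h.
have r20 : 0 < (2 * r) ^+ n by rewrite exprn_gt0//; lra.
have r80 : 0 < (8 * r) ^+ n by rewrite exprn_gt0//; lra.
have tau0 : 0 <= tau by lra.
set P := expR (tau * L2 ^+ 2) in h.
set X := expR (tau * (L1 ^+ 2 - L2 ^+ 2)) in he.
have P1 : 1 <= P by rewrite /P -expR0 ler_expR mulr_ge0// sqr_ge0.
have X1 : 1 <= X by rewrite /X -expR0 ler_expR mulr_ge0// subr_ge0.
have XP : expR (tau * L1 ^+ 2 - n%:R * ln t) = X * P / t ^+ n.
  rewrite /X /P -expRD expRB (expRM_natl n) lnK ?posrE//.
  by congr (expR _ / _); ring.
rewrite XP in h.
have h1 : 2 * g * (X * P / (2 * r) ^+ n) <= tau * (2 * g) * (X * P / t ^+ n).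
  rewrite -[leRHS]mulrA; apply: (@le_trans _ _ (2 * g * (X * P / t ^+ n))).
    apply: ler_wpM2l; first by rewrite mulr_ge0// ltW.
    apply: ler_wpM2l; first by rewrite mulr_ge0; lra.
    have tn : 0 < t ^+ n by rewrite exprn_gt0.
    by rewrite lef_pV2 ?posrE// lerXn2r ?nnegrE//; lra.
  rewrite ler_peMl// !mulr_ge0 ?invr_ge0 ?exprn_ge0 ?(ltW g0)//; lra.
have h2 : e * P * (8 * r) ^+ n <= g * X * P / (2 * r) ^+ n.
  rewrite ler_pdivlMr// (_ : e * P * _ * _ = P * (e * ((8 * r) ^+ n * (2 * r) ^+ n))); last by ring.
  by rewrite [leRHS]mulrC ler_wpM2l//; lra.
have h3 : g / (2 * r) ^+ n <= g * X * P / (2 * r) ^+ n.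
  rewrite ler_wpM2r ?invr_ge0 ?(ltW r20)// -mulrA ler_peMr ?(ltW g0)//.
  by rewrite -[leLHS]mulr1 ler_pM.
have h4 : 2 * g * (X * P / (2 * r) ^+ n) = 2 * (g * X * P / (2 * r) ^+ n) by rewrite !mulrA.
have h5 : e1 * m2 * expR (tau * l ^+ 2) <= (e1 + 1) * m2 * expR (tau * l ^+ 2).
  by rewrite ler_wpM2r ?expR_ge0// ler_wpM2r// lerDl.
apply: le_trans h5; apply: (le_trans h3).
rewrite h4 in h1; have := le_trans h1 h; clear -h2; lra.
Qed.

(** With lam = log (8 n r), the values of lam - log |x| at the distances 5/4 r, 2 r
    and a = 1 / (4 n) are L1 = log (32 n / 5), L2 = log (4 n) and log (32 n^2 r): the
    first two do not depend on r and L2 < L1, and the last one is at most 2 log r as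
    soon as r >= 32 n^2. *)
Lemma real_landis {R : realType} (n M : nat) (A : 'I_n -> 'M[R]_M) (cA : clifford A)
    (u H : 'I_M -> 'rV[R]_n -> R) (K a0 B : R) :
  (2 <= n)%N -> (forall q, continuous (u q)) -> dominated u H K -> 0 <= K ->
  (forall j p q, `|A j p q| <= a0) -> 0 <= a0 -> weak_dirac A u H ->
  0 <= B -> (forall q x, `|u q x| <= B) -> \sum_q u q 0 ^+ 2 = 1 ->
  exists kappa c r0 : R, [/\ 0 < kappa, 0 < c, 1 < r0 & forall r (x0 : 'rV[R]_n) m,
    r0 <= r -> sqn x0 = r ^+ 2 -> 0 <= m ->
    (forall y, sqn (y - x0) < 1 -> forall q, `|u q y| <= m) ->
    c * expR (- kappa * r ^+ 2 * (ln r) ^+ 2) <= m].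
Proof.
move=> n2 cu dH K0 aA a00 wu B0 uB u0.
have N2 : (2 : R) <= n%:R by rewrite (ler_nat R 2 n).
have [D D0 hD] := @derive_plateau_bound R.
have [s s0 hs] := near_sum_sqr cu u0.
pose sigma := Num.min s (8 * n%:R)^-1.
have n80 : (0 : R) < 8 * n%:R by lra.
have sg0 : 0 < sigma by rewrite lt_min s0 invr_gt0.
have sgn : sigma * n%:R <= 1 / 8.
  apply: (@le_trans _ _ ((8 * n%:R)^-1 * n%:R)); first by rewrite ler_wpM2r// ge_min lexx orbT.
  by rewrite invfM mulfVK ?div1r// gt_eqF//; lra.
have hsg (y : 'rV[R]_n) : `|y| <= sigma -> 1 / 2 <= \sum_q u q y ^+ 2.
  by move=> h; apply: hs; apply: (le_trans h); rewrite ge_min lexx.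
pose tau0 := 75 * n%:R * M%:R ^+ 2 * K ^+ 2 + 1.
pose a : R := (4 * n%:R)^-1.
pose c := a0 * (n%:R * (M%:R * (2 * (D / a)))).
pose L1 : R := ln (32 / 5 * n%:R).
pose L2 : R := ln (4 * n%:R).
have L20 : 0 < L2 by rewrite ln_gt0//; lra.
have L21 : L2 < L1 by rewrite ltr_ln ?posrE; lra.
have dl : 0 < L1 ^+ 2 - L2 ^+ 2 by rewrite subr_gt0 ltr_pXn2r ?nnegrE//; lra.
have tau01 : 1 <= tau0 by rewrite lerDr; nneg.
pose g := (2 * sigma) ^+ n / 16.
have g0 : 0 < g by rewrite divr_gt0// exprn_gt0// mulr_gt0.
pose e := 3 * M%:R * c ^+ 2 * B ^+ 2.
have e0 : 0 <= e by rewrite /e; nneg.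
pose e1 := 3 * M%:R * c ^+ 2 * expR (n%:R * ln (4 * n%:R)) * (4 * a) ^+ n.
have a_gt0 : 0 < a by rewrite invr_gt0; lra.
have e10 : 0 <= e1.
  rewrite /e1 mulr_ge0 ?exprn_ge0//; last by rewrite mulr_ge0// ltW.
  by nneg.
have [Q Q0 hQ] := polynomial_le_expR n e0 g0 dl.
pose r0 : R := Q + 32 * n%:R ^+ 2 + expR 1 + 2 + n%:R.
have E0 : 0 < expR 1 :> R by exact: expR_gt0.
have n20 : 0 <= n%:R ^+ 2 :> R by exact: sqr_ge0.
exists (2 * tau0 + n%:R), (Num.sqrt (g / (e1 + 1))), r0; split.
- by lra.
- by rewrite sqrtr_gt0 divr_gt0// ltr_wpDl.
- by rewrite /r0; lra.
move=> r x0 m; rewrite /r0 => rr sx0 m0 um.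
have Qr : Q <= r by lra.
have nr : n%:R <= r by lra.
have r2 : 2 <= r by lra.
have r_gt0 : 0 < r by lra.
have r1 : 1 <= r by lra.
have e1r : expR 1 <= r by lra.
have n2r : 32 * n%:R ^+ 2 <= r by lra.
have lr1 : 1 <= ln r by rewrite -[leLHS]expRK ler_ln ?posrE.
have N0 : (0 : R) < n%:R by lra.
pose lam : R := ln (8 * n%:R * r).
have lamE1 : lam - ln (5 / 4 * r) = L1.
  rewrite /lam (_ : 8 * n%:R * r = (32 / 5 * n%:R) * (5 / 4 * r)); last by field.
  by rewrite lnM ?posrE ?mulr_gt0// addrK.
have lamE2 : lam - ln (2 * r) = L2.
  rewrite /lam (_ : 8 * n%:R * r = (4 * n%:R) * (2 * r)); last by ring.
  by rewrite lnM ?posrE ?mulr_gt0// addrK.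
have lamE3 : lam - ln a = ln (32 * n%:R ^+ 2 * r).
  rewrite /lam -lnV ?posrE// /a invrK -lnM ?posrE ?mulr_gt0//.
  by congr ln; ring.
have nn1 : 1 <= n%:R ^+ 2 :> R by apply: exprn_ege1; lra.
have l0 : 0 <= ln (32 * n%:R ^+ 2 * r).
  by apply: ln_ge0; rewrite -[leLHS]mulr1 ler_pM//; lra.
have l2 : ln (32 * n%:R ^+ 2 * r) <= 2 * ln r.
  rewrite (_ : 2 * ln r = ln (r * r)); last by rewrite lnM ?posrE//; ring.
  rewrite ler_ln ?posrE ?mulr_gt0 ?exprn_gt0//.
  by rewrite ler_wpM2r// ltW.
have rr2 : 1 <= r ^+ 2 by exact: exprn_ege1.
have rtau : r ^+ 2 <= tau0 * r ^+ 2 by rewrite ler_peMl// sqr_ge0.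
have key := annuli cA n2 cu dH K0 aA a00 wu B0 uB D0 hD nr sx0 m0 um sg0 sgn hsg.
rewrite -/lam lamE1 lamE2 lamE3 -/tau0 -/c [expR (_ + n%:R * _)]expRD in key.
apply: (@lower_bound_shape _ n g (e1 + 1) tau0 r m (ln (32 * n%:R ^+ 2 * r))) => //.
- by rewrite ltr_wpDl.
- by lra.
apply: (@absorb_outer _ n g e e1 r (tau0 * r ^+ 2) L1 L2 (5 / 4 * r)) => //.
- exact: le_trans rtau.
- exact: sqr_ge0.
- by rewrite mulr_gt0.
- by lra.
- by rewrite -subr_ge0 ltW.
- exact: hQ.
- apply: le_trans (le_trans key _); rewrite le_eqVlt; apply/orP; left; apply/eqP.
    by rewrite /g; field.
  by rewrite /e /e1 /c; ring.
Qed.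

(** * Back to the complex spinor *)

(** Where a continuous function exceeds K it does so on a cube, which has positive
    measure. *)
Lemma ae_le_everywhere {R : realType} n (f : 'rV[R]_n -> R) K : continuous f ->
  {ae @lebesgue_rV R n, forall x, f x <= K} -> forall x, f x <= K.
Proof.
move=> cf [N [mN N0 fN]] x; rewrite leNgt; apply/negP => Kx.
have d0 : 0 < f x - K by rewrite subr_gt0.
have /cvgrPdist_lt/(_ _ d0)/nbhs_ballP[e /= e0 he] := cf x.
have e2 : 0 < e / 2 by rewrite divr_gt0.
pose A := [set y : 'rV[R]_n | `|y - x| <= e / 2].
have mA : measurable A by exact: measurable_cube.
have : (lebesgue_rV n A <= lebesgue_rV n N)%E.
  apply: le_measure; rewrite ?inE// => y Ay; apply: fN => /=; apply/negP; rewrite -ltNge.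
  have /he : ball x e y.
    by rewrite -ball_normE/= distrC; move: Ay; rewrite /A/=; lra.
  by rewrite /= ltr_norml; lra.
by rewrite N0 lebesgue_rV_cube ?(ltW e2)// lee_fin leNgt exprn_gt0// mulr_gt0.
Qed.

Lemma fin_bounded {R : realType} (I : finType) (F : I -> R) :
  exists2 a, 0 <= a & forall i, `|F i| <= a.
Proof.
exists (\sum_i `|F i|) => [|i]; first by apply: sumr_ge0.
by rewrite (bigD1 i)//= lerDl sumr_ge0.
Qed.

Lemma enorm_sphere {R : realType} n (r : R) : (0 < n)%N -> 0 <= r ->
  exists x : 'rV[R]_n, enorm x = r.
Proof.
case: n => // n _ r0; exists (r *: delta_mx 0 0).
rewrite /enorm big_ord_recl big1 ?addr0 => [|i _]; last by rewrite !mxE/= mulr0 expr0n.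
by rewrite !mxE/= mulr1 sqrtr_sqr ger0_norm.
Qed.

Section essential_bounds.
Context {R : realType} (n m : nat) (U Uc : 'rV[R]_n -> 'cV[R[i]]_m).
Hypothesis UcU : continuous_representative U Uc.

Lemma cnorm_ge0 k p (A : 'M[R[i]]_(k, p)) : 0 <= cnorm A.
Proof. exact: sqrtr_ge0. Qed.

Lemma ucomp_le_cnorm q x : `|ucomp Uc q x| <= cnorm (Uc x).
Proof.
rewrite -(ler_pXn2r (ltn0Sn 1)) ?nnegrE ?cnorm_ge0// real_normK ?num_real//.
rewrite -realcv_norm (bigD1 q)//= lerDl; apply: sumr_ge0 => k _; exact: sqr_ge0.
Qed.

Lemma ess_bounded_cnorm : ess_bounded U -> exists2 B, 0 <= B & forall x, cnorm (Uc x) <= B.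
Proof.
move=> [K hK]; exists `|K| => // x.
rewrite -(ler_pXn2r (ltn0Sn 1)) ?nnegrE ?cnorm_ge0//; move: x.
apply: ae_le_everywhere.
  have -> : (fun x => cnorm (Uc x) ^+ 2) = fun x => \sum_q ucomp Uc q x ^+ 2.
    by apply/funext => x; rewrite -realcv_norm.
  apply: continuous_sum_sqr => q; exact: (continuous_ucomp UcU).
have [_ UU] := UcU; apply: (@filterS2 _ _ (ae_filter_ringOfSetsType _)) hK UU => x h ->.
by rewrite lerXn2r ?nnegrE ?cnorm_ge0// (le_trans h)// ler_norm.
Qed.

End essential_bounds.

Lemma MR_ge {R : realType} n (U : 'rV[R]_n -> 'cV[R[i]]_(spinor_dim n)) (B r b : R) :
  (0 < n)%N -> 0 <= r -> (forall x, cnorm (U x) <= B) ->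
  (forall x m, sqn x = r ^+ 2 -> 0 <= m ->
    (forall y, sqn (y - x) < 1 -> cnorm (U y) <= m) -> b <= m) ->
  b <= MR U r.
Proof.
move=> n0 r0 UB h; rewrite /MR; apply: lb_le_inf.
  have [x hx] := enorm_sphere n0 r0.
  by exists (sup [set cnorm (U y) | y in eball x 1]), x.
move=> _ [x /= xr <-].
have ub y : sqn (y - x) < 1 -> cnorm (U y) <= sup [set cnorm (U y) | y in eball x 1].
  move=> yx; apply: ub_le_sup; first by exists B => _ [z _ <-].
  by exists y => //=; rewrite /eball/= /enorm -(@sqrtr1 R) ltr_sqrt.
apply: (h x) => //.
- by rewrite -xr /enorm sqr_sqrtr//; apply: sumr_ge0 => i _; exact: sqr_ge0.
- apply: le_trans (ub x _); first exact: sqrtr_ge0.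
  by rewrite subrr /sqn big1// => i _; rewrite mxE expr0n.
Qed.

Theorem theorem1p1 (R : realType) (n : nat) (hn : (2 <= n)%N)
  (alpha : 'I_n -> 'M[R[i]]_(spinor_dim n)) (halpha : dirac_matrices alpha)
  (V : 'rV[R]_n -> 'M[R[i]]_(spinor_dim n))
  (Vmeas : forall i j, lebesgue_measurable_cfun (fun x => V x i j))
  (Vbdd : ess_bounded V)
  (U : 'rV[R]_n -> 'cV[R[i]]_(spinor_dim n))
  (UH1 : H1loc_v U) (Ubdd : ess_bounded U) (Usol : weak_solution alpha V U)
  (Uc : 'rV[R]_n -> 'cV[R[i]]_(spinor_dim n))
  (UcU : continuous_representative U Uc) (Uc0 : cnorm (Uc 0) = 1) :
  exists kappa c r0 : R, [/\ 0 < kappa, 0 < c, 1 < r0 &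
    forall r : R, r0 <= r ->
      c * expR (- kappa * r ^+ 2 * (ln r) ^+ 2) <= MR Uc r].
Proof.
have n0 : (0 < n)%N by exact: ltn_trans hn.
have [H [K [K0 dH wu]]] := real_form halpha Vmeas Vbdd Usol UcU.
have [B B0 hB] := ess_bounded_cnorm UcU Ubdd.
have [a0 a00 ha] := fin_bounded (fun i : 'I_n * ('I_(spinor_dim n + spinor_dim n) *
  'I_(spinor_dim n + spinor_dim n)) => realmx (alpha i.1) i.2.1 i.2.2).
have u0 : \sum_q ucomp Uc q 0 ^+ 2 = 1 by rewrite /ucomp realcv_norm Uc0 expr1n.
have uB q x : `|ucomp Uc q x| <= B by exact: le_trans (ucomp_le_cnorm _ _ _) (hB x).
have [kappa [c [r0 [k0 c0 r01 low]]]] := real_landis (realmx_clifford halpha) hn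
  (continuous_ucomp UcU) dH K0 (fun j p q => ha (j, (p, q))) a00 wu B0 uB u0.
exists kappa, c, r0; split => // r r0r.
have r_ge0 : 0 <= r by apply: le_trans r0r; rewrite (le_trans ler01)// ltW.
apply: (MR_ge n0 r_ge0 hB).
move=> x m xr m0 um; apply: (low _ x) => // y yx q.
exact: le_trans (ucomp_le_cnorm _ _ _) (um y yx).
Qed.
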